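(* Let $\mathbf{k}$ be an algebraically closed field of characteristic $0$, let $d\ge 1$, and let $R=\bigoplus_{i\ge 0}R_i$ be a finitely generated positively graded $\mathbf{k}$-algebra which is a domain, with $R_0=\mathbf{k}$ and Krull dimension $\dim(R)=d+1$. Then there exists a homogeneous valuation $\mathfrak{v}:R\setminus\{0\}\to\mathbb{Z}_{\ge 0}\times\mathbb{Z}^{d-1}$ of rank $d$ such that the associated graded algebra $\mathrm{gr}_{\mathfrak{v}}(R)$ is a finitely generated $\mathbf{k}$-algebra (in other words, $(R,\mathfrak{v})$ has a finite Khovanskii basis). Here the first component of $\mathfrak{v}$ is the degree with respect to the grading of $R$, and $\mathbb{Z}_{\ge 0}\times\mathbb{Z}^{d-1}$ is ordered lexicographically, where the ordering on the factor $\mathbb{Z}_{\ge 0}$ is the reverse of its natural ordering.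
   Context: Positively graded means $\mathbb{Z}_{\ge0}$-graded. Let $\Gamma$ be an ordered abelian group (total order compatible with addition). A valuation $\mathfrak{v}:R\setminus\{0\}\to\Gamma$ is a function with $\mathfrak{v}(f+g)\ge\min\{\mathfrak{v}(f),\mathfrak{v}(g)\}$ whenever $f,g,f+g\neq 0$, $\mathfrak{v}(fg)=\mathfrak{v}(f)+\mathfrak{v}(g)$ for $f,g\ne0$, and $\mathfrak{v}(cf)=\mathfrak{v}(f)$ for $0\neq c\in\mathbf{k}$, $f\neq 0$. Its rank is the rank of the subgroup of $\Gamma$ generated by its image. It is homogeneous (with respect to the grading $R=\bigoplus_i R_i$) if for every nonzero $f=\sum_i f_i$ with $f_i\in R_i$ one has $\mathfrak{v}(f)=\min\{\mathfrak{v}(f_i)\mid f_i\ne0\}$. With $R_{\mathfrak{v}\ge a}=\{f\ne0\mid\mathfrak{v}(f)\ge a\}\cup\{0\}$ and $R_{\mathfrak{v}>a}$ defined similarly, the associated graded algebra is $\mathrm{gr}_{\mathfrak{v}}(R)=\bigoplus_{a\in\Gamma}R_{\mathfrak{v}\ge a}/R_{\mathfrak{v}>a}$. A subset $\mathcal{B}\subset R$ is a Khovanskii basis for $(R,\mathfrak{v})$ if the image of $\mathcal{B}$ in $\mathrm{gr}_{\mathfrak{v}}(R)$ generates it as an algebra. *)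

(* Defs.v *)
From HB Require Import structures.
From mathcomp Require Import all_boot all_order all_algebra.
From mathcomp Require Import generic_quotient ring_quotient.
From mathcomp Require Import finmap.
From mathcomp Require Import boolp classical_sets functions cardinality fsbigop.

Set Implicit Arguments.
Unset Strict Implicit.
Unset Printing Implicit Defensive.

Import Order.TTheory GRing.Theory Num.Theory.

Local Open Scope classical_set_scope.
Local Open Scope ring_scope.

HB.mixin Record POrderedZmodule_isOrdGroup T of Num.POrderedZmodule T := {
  ogle_total : total (<=%R : rel T);
  ogle_add2l : forall z x y : T, x <= y -> z + x <= z + y
}.

#[short(type="ordGroupType")]
HB.structure Definition OrdGroup :=
  {T of Num.POrderedZmodule T & POrderedZmodule_isOrdGroup T}.

(* The group Z x Z^m, ordered lexicographically, with the order of the first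
   factor Z reversed and Z^m itself ordered lexicographically. *)
Definition deglex (m : nat) : Type := (int * 'rV[int]_m)%type.

Section Deglex.
Variable m : nat.

Definition deglex_key (x : deglex m) : (int^d *l seqlexi int)%type :=
  (x.1, [seq x.2 ord0 i | i <- enum 'I_m]).

Definition deglex_unkey (y : int^d *l seqlexi int) : option (deglex m) :=
  Some (y.1, \row_(i < m) nth 0 (y.2 : seq int) i).

Lemma deglex_keyK : pcancel deglex_key deglex_unkey.
Proof.
move=> [a u]; congr (Some (_, _)); apply/rowP => i; rewrite mxE /=.
by rewrite (nth_map i) ?size_enum_ord // nth_ord_enum.
Qed.

HB.instance Definition _ := GRing.Zmodule.on (deglex m).
HB.instance Definition _ : Order.isPOrder ring_display (deglex m) :=
  Order.PCanIsPartial ring_display deglex_keyK.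
Lemma deglex_leE (x y : deglex m) : (x <= y) = (deglex_key x <= deglex_key y)%O.
Proof. by []. Qed.

Lemma deglex_total : total (<=%R : rel (deglex m)).
Proof. by move=> x y; rewrite !deglex_leE; apply: le_total. Qed.

Lemma deglex_add2l (z x y : deglex m) : x <= y -> z + x <= z + y.
Proof.
rewrite !deglex_leE !leEprodlexi !leEdual /= !lerD2l.
case/andP=> -> /implyP/= h; apply/implyP => /h.
elim: (enum _) => //= i s IHs; rewrite !lexi_cons !mxE !lerD2l.
by case/andP=> -> /implyP h1; apply/implyP => /h1.
Qed.

HB.instance Definition _ :=
  POrderedZmodule_isOrdGroup.Build (deglex m) deglex_total deglex_add2l.

End Deglex.

Section OrdGroupTheory.
Variable G : ordGroupType.
Implicit Types a b c d : G.

Lemma og_leD a b c d : a <= b -> c <= d -> a + c <= b + d.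
Proof.
move=> ab cd; apply: le_trans (ogle_add2l b _ _ cd).
by rewrite [a + c]addrC [b + c]addrC ogle_add2l.
Qed.

Lemma og_ltD a b c d : a < b -> c <= d -> a + c < b + d.
Proof.
move=> ab cd; apply: lt_le_trans (ogle_add2l b _ _ cd).
rewrite lt_neqAle og_leD ?(ltW ab) // andbT.
by apply: contraTneq ab => /addIr->; rewrite ltxx.
Qed.
End OrdGroupTheory.

(* A valuation is defined on R \ {0}: the value at 0 is irrelevant. *)
Record valuation (k : fieldType) (R : comAlgType k) (G : ordGroupType) :=
  Valuation {
    vfun :> R -> G;
    vfun_min : forall f g, f != 0 -> g != 0 -> f + g != 0 ->
          Order.min (vfun f) (vfun g) <= vfun (f + g);
    vfun_mul : forall f g, f != 0 -> g != 0 -> vfun (f * g) = vfun f + vfun g;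
    vfun_scale : forall (c : k) f, c != 0 -> f != 0 -> vfun (c *: f) = vfun f
  }.

Section AssociatedGraded.
Variables (k : fieldType) (R : comAlgType k) (G : ordGroupType).
Variable v : valuation R G.
Implicit Types (a b c : G) (f g : R).

Definition Rge a : {pred R} := [pred f | (f == 0) || (a <= v f)].
Definition Rgt a : {pred R} := [pred f | (f == 0) || (a < v f)].

Let v_min f g : f != 0 -> g != 0 -> f + g != 0 -> Order.min (v f) (v g) <= v (f + g).
Proof. exact: vfun_min. Qed.

Let v_mul f g : f != 0 -> g != 0 -> v (f * g) = v f + v g.
Proof. exact: vfun_mul. Qed.

Let v_scale (x : k) f : x != 0 -> f != 0 -> v (x *: f) = v f.
Proof. exact: vfun_scale. Qed.

Let v1 : v 1 = 0.
Proof.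
have := v_mul (oner_neq0 R) (oner_neq0 R).
by rewrite mulr1 => /eqP; rewrite -subr_eq0 opprD addrA addrN add0r oppr_eq0 => /eqP.
Qed.

Lemma Rge_submod a : submod_closed (Rge a).
Proof.
split=> [|x f g]; rewrite !inE ?eqxx //.
have [->|f0] := eqVneq f 0; first by rewrite scaler0 add0r.
have [->|x0] := eqVneq x 0; first by rewrite scale0r add0r.
have [->|g0] := eqVneq g 0; first by move=> /= af _; rewrite addr0 v_scale // af orbT.
move=> /= af ag; case: eqVneq => //= h; apply: le_trans (v_min _ _ h) => //.
  by rewrite minEle v_scale //; case: ifP.
by rewrite scaler_eq0 negb_or x0.
Qed.

Lemma Rgt_submod a : submod_closed (Rgt a).
Proof.
split=> [|x f g]; rewrite !inE ?eqxx //.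
have [->|f0] := eqVneq f 0; first by rewrite scaler0 add0r.
have [->|x0] := eqVneq x 0; first by rewrite scale0r add0r.
have [->|g0] := eqVneq g 0; first by move=> /= af _; rewrite addr0 v_scale // af orbT.
move=> /= af ag; case: eqVneq => //= h; apply: lt_le_trans (v_min _ _ h) => //.
  by rewrite minEle v_scale //; case: ifP.
by rewrite scaler_eq0 negb_or x0.
Qed.

HB.instance Definition _ a := GRing.isSubmodClosed.Build k R (Rge a) (Rge_submod a).
HB.instance Definition _ a := GRing.isSubmodClosed.Build k R (Rgt a) (Rgt_submod a).

Definition Rge_type a : Type := {f : R | f \in Rge a}.
HB.instance Definition _ a := SubChoice.on (Rge_type a).
HB.instance Definition _ a := [SubChoice_isSubLmodule of Rge_type a by <:].

Lemma Rge_valD a (x y : Rge_type a) : val (x + y) = val x + val y.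
Proof. exact: raddfD. Qed.

Lemma Rge_valB a (x y : Rge_type a) : val (x - y) = val x - val y.
Proof. exact: raddfB. Qed.

Lemma Rge_insubdK a f : f \in Rge a -> val (insubd (0 : Rge_type a) f) = f.
Proof. exact: insubdK. Qed.

Definition Rgt_in a : {pred Rge_type a} := [pred f | val f \in Rgt a].
Arguments Rgt_in : clear implicits.

Lemma Rgt_inE a (x : Rge_type a) : (x \in Rgt_in a) = (val x \in Rgt a).
Proof. by []. Qed.

Lemma Rgt_in_submod a : submod_closed (Rgt_in a).
Proof.
split=> [|x f g]; rewrite !inE ?linear0 ?eqxx // => hf hg.
by have := (Rgt_submod a).2 x (val f) (val g) hf hg; rewrite !inE linearP.
Qed.

HB.instance Definition _ a :=
  GRing.isSubmodClosed.Build k (Rge_type a) (Rgt_in a) (Rgt_in_submod a).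

Definition gr_piece a : Type := Quotient.quot (Rgt_in a).
HB.instance Definition _ a := GRing.Zmodule.on (gr_piece a).

(* The class of f in R_{v >= a} / R_{v > a}; it is 0 when f is not in
   R_{v >= a}. *)
Definition gr_class a f : gr_piece a := \pi_(gr_piece a)%qT (insubd (0 : Rge_type a) f).

Definition gr_lift a (x : gr_piece a) : R := val (repr x : Rge_type a).

Lemma gr_liftP a (x : gr_piece a) : gr_lift x \in Rge a.
Proof. exact: valP. Qed.

Lemma gr_liftK a (x : gr_piece a) : gr_class a (gr_lift x) = x.
Proof. by rewrite /gr_class valKd reprK. Qed.

Lemma gr_class_eq a f g : f \in Rge a -> g \in Rge a ->
  (gr_class a f == gr_class a g) = (f - g \in Rgt a).
Proof.
move=> fa ga; rewrite /gr_class -Quotient.idealrBE.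
by rewrite Rgt_inE Rge_valB !Rge_insubdK.
Qed.

Lemma gr_lift_class a f : f \in Rge a -> gr_lift (gr_class a f) - f \in Rgt a.
Proof. by move=> fa; rewrite -gr_class_eq ?gr_liftP // gr_liftK. Qed.

Lemma gr_classD a f g : f \in Rge a -> g \in Rge a ->
  gr_class a (f + g) = gr_class a f + gr_class a g.
Proof.
move=> fa ga; rewrite /gr_class -[RHS]raddfD; congr (\pi_(_)%qT _); apply: val_inj.
by rewrite Rge_valD !Rge_insubdK // rpredD.
Qed.

Lemma gr_class0 a : gr_class a 0 = 0.
Proof. by apply: (addIr (gr_class a 0)); rewrite -gr_classD ?rpred0 // addr0 add0r. Qed.

Lemma gr_class_eq0 a f : f \in Rge a -> (gr_class a f == 0) = (f \in Rgt a).
Proof. by move=> fa; rewrite -(gr_class0 a) gr_class_eq ?rpred0 // subr0. Qed.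

Lemma RgeM a b f g : f \in Rge a -> g \in Rge b -> f * g \in Rge (a + b).
Proof.
rewrite !inE; have [->|f0 /= fa] := eqVneq f 0; first by rewrite mul0r eqxx.
have [->|g0 /= gb] := eqVneq g 0; first by rewrite mulr0 eqxx.
by rewrite v_mul // og_leD ?orbT.
Qed.

Lemma RgtMl a b f g : f \in Rgt a -> g \in Rge b -> f * g \in Rgt (a + b).
Proof.
rewrite !inE; have [->|f0 /= fa] := eqVneq f 0; first by rewrite mul0r eqxx.
have [->|g0 /= gb] := eqVneq g 0; first by rewrite mulr0 eqxx.
by rewrite v_mul // og_ltD ?orbT.
Qed.

Lemma Rgt_sub_Rge a : {subset Rgt a <= Rge a}.
Proof. by move=> f; rewrite !inE => /orP[->//|/ltW->]; rewrite orbT. Qed.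

(* For a + b = c, the product
   R_{v >= a} / R_{v > a} x R_{v >= b} / R_{v > b} -> R_{v >= c} / R_{v > c}
   induced by the product of R. *)
Definition gr_pmul a b c (x : gr_piece a) (y : gr_piece b) : gr_piece c :=
  gr_class c (gr_lift x * gr_lift y).

Lemma gr_pmulE a b f g : f \in Rge a -> g \in Rge b ->
  gr_pmul (a + b) (gr_class a f) (gr_class b g) = gr_class (a + b) (f * g).
Proof.
move=> fa gb; apply/eqP; rewrite gr_class_eq ?RgeM ?gr_liftP //.
have := gr_liftP (gr_class b g); have := gr_lift_class fa; have := gr_lift_class gb.
set f' := gr_lift (gr_class a f); set g' := gr_lift (gr_class b g) => hg hf g'b.
have -> : f' * g' - f * g = (f' - f) * g' + (g' - g) * f.
  by rewrite !mulrBl [g' * f]mulrC [g * f]mulrC addrA subrK.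
by apply: rpredD; [apply: RgtMl | rewrite [a + b]addrC; apply: RgtMl].
Qed.

Definition gr_pscale a (t : k) (x : gr_piece a) : gr_piece a :=
  gr_class a (t *: gr_lift x).

Lemma gr_pscaleE a t f : f \in Rge a ->
  gr_pscale t (gr_class a f) = gr_class a (t *: f).
Proof.
move=> fa; apply/eqP; rewrite gr_class_eq ?rpredZ ?gr_liftP //.
by rewrite -scalerBr rpredZ // gr_lift_class.
Qed.

Lemma gr_pieceP a (x : gr_piece a) : exists2 f, f \in Rge a & x = gr_class a f.
Proof. by exists (gr_lift x); rewrite ?gr_liftP ?gr_liftK. Qed.

(* The direct sum of the R_{v >= a} / R_{v > a}. *)
Record assoc_gr := AssocGr {
  gr_comp :> forall a, gr_piece a;
  gr_comp_finite : finite_set [set a | gr_comp a != 0]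
}.

Lemma gr_eqP (x y : assoc_gr) : (forall a, x a = y a) -> x = y.
Proof.
case: x y => [x hx] [y hy] /= e; have {}e : x = y by apply: functional_extensionality_dep.
by case: _ / e in hy *; congr AssocGr; apply: Prop_irrelevance.
Qed.

HB.instance Definition _ := gen_eqMixin assoc_gr.
HB.instance Definition _ := gen_choiceMixin assoc_gr.

Lemma gr0_finite : finite_set [set a | (0 : gr_piece a) != 0].
Proof. by apply: (sub_finite_set _ (finite_set0 G)) => a /=; rewrite eqxx. Qed.
Definition gr0 : assoc_gr := AssocGr gr0_finite.

Lemma gr_opp_finite (x : assoc_gr) : finite_set [set a | - x a != 0].
Proof. by apply: (sub_finite_set _ (gr_comp_finite x)) => a /=; rewrite oppr_eq0. Qed.
Definition gr_opp x : assoc_gr := AssocGr (gr_opp_finite x).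

Lemma gr_add_finite (x y : assoc_gr) : finite_set [set a | x a + y a != 0].
Proof.
have: finite_set ([set a | x a != 0] `|` [set a | y a != 0]).
  by rewrite finite_setU; split; apply: gr_comp_finite.
apply: sub_finite_set => a /=.
by have [->|] := eqVneq (x a) 0; [rewrite add0r; right | left].
Qed.
Definition gr_add x y : assoc_gr := AssocGr (gr_add_finite x y).

Lemma gr_scale_finite (t : k) (x : assoc_gr) : finite_set [set a | gr_pscale t (x a) != 0].
Proof.
apply: (sub_finite_set _ (gr_comp_finite x)) => a /=; apply: contra_neq => ->.
by rewrite -(gr_class0 a) gr_pscaleE ?rpred0 // scaler0.
Qed.
Definition gr_scale t x : assoc_gr := AssocGr (gr_scale_finite t x).

Fact gr_addA : associative gr_add.
Proof. by move=> x y z; apply: gr_eqP => a /=; rewrite addrA. Qed.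
Fact gr_addC : commutative gr_add.
Proof. by move=> x y; apply: gr_eqP => a /=; rewrite addrC. Qed.
Fact gr_add0 : left_id gr0 gr_add.
Proof. by move=> x; apply: gr_eqP => a /=; rewrite add0r. Qed.
Fact gr_addN : left_inverse gr0 gr_opp gr_add.
Proof. by move=> x; apply: gr_eqP => a /=; rewrite addNr. Qed.

HB.instance Definition _ := GRing.isZmodule.Build assoc_gr gr_addA gr_addC gr_add0 gr_addN.

Fact gr_scaleA s t x : gr_scale s (gr_scale t x) = gr_scale (s * t) x.
Proof.
apply: gr_eqP => a /=; have [f fa ->] := gr_pieceP (x a).
by rewrite !gr_pscaleE ?rpredZ // scalerA.
Qed.
Fact gr_scale1 : left_id 1 gr_scale.
Proof.
move=> x; apply: gr_eqP => a /=; have [f fa ->] := gr_pieceP (x a).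
by rewrite gr_pscaleE // scale1r.
Qed.
Fact gr_scaleDr : right_distributive gr_scale +%R.
Proof.
move=> t x y; apply: gr_eqP => a /=.
have [f fa ->] := gr_pieceP (x a); have [g ga ->] := gr_pieceP (y a).
by rewrite -gr_classD // !gr_pscaleE ?rpredD // -gr_classD ?rpredZ // scalerDr.
Qed.
Fact gr_scaleDl x : {morph gr_scale^~ x : s t / s + t}.
Proof.
move=> s t; apply: gr_eqP => a /=; have [f fa ->] := gr_pieceP (x a).
by rewrite !gr_pscaleE // -gr_classD ?rpredZ // scalerDl.
Qed.

HB.instance Definition _ :=
  GRing.Zmodule_isLmodule.Build k assoc_gr gr_scaleA gr_scale1 gr_scaleDr gr_scaleDl.

(* The element of R_{v >= a} / R_{v > a} defined by f, in the direct sum. *)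
Definition gr_in_fun a f b : gr_piece b := if b == a then gr_class b f else 0.

Lemma gr_in_finite a f : finite_set [set b | gr_in_fun a f b != 0].
Proof.
apply: (sub_finite_set _ (finite_set1 a)) => b /=; rewrite /gr_in_fun.
by case: (b =P a) => //; rewrite eqxx.
Qed.
Definition gr_in a f : assoc_gr := AssocGr (gr_in_finite a f).

Lemma gr_compD x y a : (x + y : assoc_gr) a = x a + y a. Proof. by []. Qed.
Lemma gr_comp0 a : (0 : assoc_gr) a = 0. Proof. by []. Qed.
Lemma gr_compZ t x a : (t *: x : assoc_gr) a = gr_pscale t (x a). Proof. by []. Qed.

Lemma gr_sum_in (x : assoc_gr) :
  x = \sum_(a \in [set a | x a != 0]) gr_in a (gr_lift (x a)).
Proof.
have fx := gr_comp_finite x; apply: gr_eqP => b.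
rewrite fsbig_finite //=.
have compsum (I : eqType) (s : seq I) (F : I -> assoc_gr) :
    (\sum_(i <- s) F i) b = \sum_(i <- s) F i b.
  by elim: s => [|i s IHs]; rewrite ?big_nil ?big_cons // gr_compD IHs.
rewrite compsum; have [x0|xb] := eqVneq (x b) 0.
  rewrite big1_seq // => a /=; rewrite in_fset_set // inE /= => xa.
  rewrite /gr_in_fun; case: (b =P a) => // ba; subst a.
  by rewrite x0 eqxx in xa.
have bx : b \in fset_set [set a | x a != 0] by rewrite in_fset_set // inE.
rewrite (bigD1_seq b bx (fset_uniq _)) /=.
rewrite /gr_in_fun eqxx gr_liftK big1 ?addr0 // => a ab.
by rewrite eq_sym (negPf ab).
Qed.

Lemma gr_ind (P : assoc_gr -> Prop) :
    P 0 -> (forall x y, P x -> P y -> P (x + y)) ->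
    (forall a f, f \in Rge a -> P (gr_in a f)) ->
  forall x, P x.
Proof.
move=> P0 PD Pin x; rewrite (gr_sum_in x) fsbig_finite; last exact: gr_comp_finite.
by elim/big_ind: _ => // a _; apply/Pin/gr_liftP.
Qed.

Definition gr_mul_fun (x y : assoc_gr) c : gr_piece c :=
  \sum_(a \in [set: G]) gr_pmul c (x a) (y (c - a)).


Lemma gr_pmulE' a b c f g : a + b = c -> f \in Rge a -> g \in Rge b ->
  gr_pmul c (gr_class a f) (gr_class b g) = gr_class c (f * g).
Proof. by move<-; apply: gr_pmulE. Qed.

Lemma gr_pmulDl a b c (x x' : gr_piece a) (y : gr_piece b) : a + b = c ->
  gr_pmul c (x + x') y = gr_pmul c x y + gr_pmul c x' y.
Proof.
move=> abc; have [f fa ->] := gr_pieceP x; have [f' fa' ->] := gr_pieceP x'.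
have [g gb ->] := gr_pieceP y.
by rewrite -gr_classD // !gr_pmulE' ?rpredD // mulrDl gr_classD // -abc RgeM.
Qed.

Lemma gr_pmul0l a b c (y : gr_piece b) : a + b = c -> gr_pmul c (0 : gr_piece a) y = 0.
Proof.
by move=> abc; apply: (addIr (gr_pmul c (0 : gr_piece a) y)); rewrite -gr_pmulDl // addr0 add0r.
Qed.

Lemma gr_pmulC a b c (x : gr_piece a) (y : gr_piece b) : gr_pmul c x y = gr_pmul c y x.
Proof. by rewrite /gr_pmul mulrC. Qed.

Lemma gr_pmul0r a b c (x : gr_piece a) : a + b = c -> gr_pmul c x (0 : gr_piece b) = 0.
Proof. by move=> abc; rewrite gr_pmulC gr_pmul0l // addrC. Qed.

Lemma gr_mul_finite (x y : assoc_gr) : finite_set [set c | gr_mul_fun x y c != 0].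
Proof.
have := finite_image2 +%R (gr_comp_finite x) (gr_comp_finite y).
apply: sub_finite_set => c /= h; apply: contrapT => h'; move/eqP: h; apply.
apply: fsbig1 => a _; have [->|xa] := eqVneq (x a) 0; first by rewrite gr_pmul0l // subrKC.
have [->|ya] := eqVneq (y (c - a)) 0; first by rewrite gr_pmul0r // subrKC.
by case: h'; exists a => //; exists (c - a) => //; rewrite subrKC.
Qed.
Definition gr_mul x y : assoc_gr := AssocGr (gr_mul_finite x y).

Lemma gr_mul_funE (D : set G) (x y : assoc_gr) c : [set a | x a != 0] `<=` D ->
  gr_mul_fun x y c = \sum_(a \in D) gr_pmul c (x a) (y (c - a)).
Proof.
move=> xD; rewrite /gr_mul_fun -(fsbig_widen D) //= => a [_ /= Da].
have [->|xa] := eqVneq (x a) 0; first by rewrite gr_pmul0l // subrKC.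
by case: Da; apply: xD.
Qed.

Fact gr_mulDl : left_distributive gr_mul +%R.
Proof.
move=> x y z; apply: gr_eqP => c /=; pose D := [set a | x a != 0] `|` [set a | y a != 0].
have fD : finite_set D by rewrite finite_setU; split; apply: gr_comp_finite.
rewrite !(@gr_mul_funE D).
- rewrite -fsbig_split //; apply: eq_fsbigr => a _.
  by apply: gr_pmulDl; rewrite subrKC.
- by move=> a; right.
- by move=> a; left.
move=> a /=; have [->|] := eqVneq (x a) 0; last by left.
by rewrite add0r; right.
Qed.

Fact gr_mulC : commutative gr_mul.
Proof.
move=> x y; apply: gr_eqP => c /=; rewrite /gr_mul_fun.
rewrite (reindex_fsbigT (fun a => c - a)) /=.
  by apply: eq_fsbigr => a _; rewrite gr_pmulC; rewrite subKr.
by exists (fun a => c - a) => a; rewrite subKr.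
Qed.

Lemma gr_in_mul a b f g : f \in Rge a -> g \in Rge b ->
  gr_mul (gr_in a f) (gr_in b g) = gr_in (a + b) (f * g).
Proof.
move=> fa gb; apply: gr_eqP => c /=; rewrite /gr_mul_fun.
rewrite -(fsbig_widen [set a]) //= => [|d [_ /= da]]; last first.
  by rewrite /gr_in_fun (introF eqP da) gr_pmul0l // subrKC.
rewrite fsbig_set1 /gr_in_fun eqxx.
have -> : (c == a + b) = (c - a == b) by rewrite subr_eq addrC.
case: eqP => [cab|_]; last by rewrite gr_pmul0r // subrKC.
by rewrite gr_pmulE' ?subrKC // cab.
Qed.

Fact gr_mulDr : right_distributive gr_mul +%R.
Proof. by move=> x y z; rewrite ![gr_mul x _]gr_mulC gr_mulDl. Qed.

Lemma gr_mul0 x : gr_mul 0 x = 0.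
Proof. by apply: (addIr (gr_mul 0 x)); rewrite -gr_mulDl addr0 add0r. Qed.

Lemma gr_mulx0 x : gr_mul x 0 = 0.
Proof. by rewrite gr_mulC gr_mul0. Qed.

Fact gr_mulA : associative gr_mul.
Proof.
move=> x y z; elim/gr_ind: x => [|x x' IHx IHx'|a f fa]; first by rewrite !gr_mul0.
  by rewrite !gr_mulDl IHx IHx'.
elim/gr_ind: y => [|y y' IHy IHy'|b g gb].
- by rewrite gr_mul0 !gr_mulx0 gr_mul0.
- by rewrite gr_mulDl !gr_mulDr gr_mulDl IHy IHy'.
elim/gr_ind: z => [|z z' IHz IHz'|c h hc].
- by rewrite !gr_mulx0.
- by rewrite !gr_mulDr IHz IHz'.
by rewrite !gr_in_mul ?RgeM // addrA mulrA.
Qed.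

Definition gr1 : assoc_gr := gr_in 0 1.

Lemma Rge1 : 1 \in Rge 0.
Proof. by rewrite inE v1 lexx orbT. Qed.

Fact gr_mul1 : left_id gr1 gr_mul.
Proof.
elim/gr_ind => [|x y IHx IHy|a f fa]; first by rewrite gr_mulx0.
  by rewrite gr_mulDr IHx IHy.
by rewrite gr_in_mul ?Rge1 // add0r mul1r.
Qed.

Fact gr1_neq0 : gr1 != 0.
Proof.
apply/eqP => /(congr1 (fun x : assoc_gr => x 0)) /eqP; rewrite /= /gr_in_fun eqxx.
by rewrite gr_class_eq0 ?Rge1 // inE v1 ltxx oner_eq0.
Qed.

HB.instance Definition _ := GRing.Zmodule_isComNzRing.Build assoc_gr
  gr_mulA gr_mulC gr_mul1 gr_mulDl gr1_neq0.

Lemma gr_inZ t a f : f \in Rge a -> t *: gr_in a f = gr_in a (t *: f).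
Proof.
move=> fa; apply: gr_eqP => b; rewrite gr_compZ /= /gr_in_fun.
case: eqP => [ba|_]; first by rewrite gr_pscaleE // ba.
by rewrite -(gr_class0 b) gr_pscaleE ?rpred0 // scaler0.
Qed.

Lemma gr_inM a b f g : f \in Rge a -> g \in Rge b ->
  gr_in a f * gr_in b g = gr_in (a + b) (f * g).
Proof. exact: gr_in_mul. Qed.

Fact gr_scaleAl t (x y : assoc_gr) : t *: (x * y) = (t *: x) * y.
Proof.
elim/gr_ind: x => [|x x' IHx IHx'|a f fa].
- by rewrite mul0r !scaler0 mul0r.
- by rewrite mulrDl !scalerDr mulrDl IHx IHx'.
elim/gr_ind: y => [|y y' IHy IHy'|b g gb].
- by rewrite !mulr0 scaler0.
- by rewrite !mulrDr scalerDr IHy IHy'.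
by rewrite !gr_inZ ?gr_inM ?gr_inZ ?RgeM ?rpredZ // scalerAl.
Qed.

HB.instance Definition _ := GRing.Lmodule_isLalgebra.Build k assoc_gr gr_scaleAl.
HB.instance Definition _ := GRing.Lalgebra_isComAlgebra.Build k assoc_gr.

End AssociatedGraded.

Section FiniteGeneration.
Variables (k : fieldType) (A : comAlgType k).

Definition generates_algebra (S : set A) : Prop :=
  forall U : {pred A}, GRing.subalg_closed U -> (forall x, S x -> x \in U) ->
  forall x, x \in U.

Definition finitely_generated_algebra : Prop :=
  exists S : set A, finite_set S /\ generates_algebra S.

End FiniteGeneration.

(* The image of f in gr_v(R); in particular the image of 0 is 0. *)
Definition gr_image (k : fieldType) (R : comAlgType k) (G : ordGroupType)
    (v : valuation R G) (f : R) : assoc_gr v :=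
  gr_in v (v f) f.

Definition khovanskii_basis (k : fieldType) (R : comAlgType k)
    (G : ordGroupType) (v : valuation R G) (B : set R) : Prop :=
  generates_algebra (gr_image v @` B).

Section Rank.
Variable G : zmodType.

Definition generated_subgroup (S : set G) : set G :=
  [set x | forall H : {pred G}, GRing.zmod_closed H ->
             (forall y, S y -> y \in H) -> x \in H].

Definition Z_independent (n : nat) (x : 'I_n -> G) : Prop :=
  forall c : 'I_n -> int, \sum_(i < n) x i *~ c i = 0 -> forall i, c i = 0.

Definition subgroup_has_rank (H : set G) (r : nat) : Prop :=
  (exists x : 'I_r -> G, (forall i, H (x i)) /\ Z_independent x) /\
  (forall n (x : 'I_n -> G), (forall i, H (x i)) -> Z_independent x ->
     (n <= r)%N).

End Rank.

Definition valuation_has_rank (k : fieldType) (R : comAlgType k)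
    (G : ordGroupType) (v : valuation R G) (r : nat) : Prop :=
  subgroup_has_rank (generated_subgroup (v @` [set f | f != 0])) r.

(* A decomposition R = \bigoplus_i R_i; [hcomp i f] is the component f_i. *)
Record grading (k : fieldType) (R : comAlgType k) := Grading {
  hpiece : nat -> {pred R};
  hcomp : nat -> R -> R;
  hpiece_submod : forall i, GRing.submod_closed (hpiece i);
  hpieceM : forall i j f g, f \in hpiece i -> g \in hpiece j ->
        f * g \in hpiece (i + j)%N;
  hcomp_piece : forall i f, hcomp i f \in hpiece i;
  hcomp_sum : forall f, exists n, (forall i, (n <= i)%N -> hcomp i f = 0) /\
        f = \sum_(i < n) hcomp i f;
  hpiece_direct : forall n (g : nat -> R), (forall i, g i \in hpiece i) ->
        \sum_(i < n) g i = 0 -> forall i, (i < n)%N -> g i = 0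
}.

Section Graded.
Variables (k : fieldType) (R : comAlgType k) (gR : grading R).

Definition has_degree (f : R) (n : nat) : Prop :=
  hcomp gR n f != 0 /\ (forall i, (n < i)%N -> hcomp gR i f = 0).

Definition homogeneous_valuation (G : ordGroupType) (v : valuation R G) :=
  forall f, f != 0 ->
    (exists2 i, hcomp gR i f != 0 & v f = v (hcomp gR i f)) /\
    (forall i, hcomp gR i f != 0 -> v f <= v (hcomp gR i f)).

End Graded.

Section KrullDimension.
Variable R : comNzRingType.

(* A chain P_0 < ... < P_n of n + 1 prime ideals. *)
Definition has_prime_chain (n : nat) : Prop :=
  exists P : 'I_n.+1 -> prime_idealr R,
    forall i j : 'I_n.+1, (i < j)%N ->
      {subset P i <= P j} /\ ~ {subset P j <= P i}.

Definition krull_dimension_is (n : nat) : Prop :=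
  has_prime_chain n /\ (forall m, has_prime_chain m -> (m <= n)%N).

End KrullDimension.

(* Main.v *)
(** Homogeneous linear Noether normalization makes R a finite module over a
    polynomial ring A = k[y_0, ..., y_d] with all y_i of the same degree M.  By
    the primitive element theorem, delta R^(M) is contained in A[theta] for some
    nonzero delta in A and some theta homogeneous, with monic minimal polynomial
    P over A.  By a Bertini argument, a linear change of coordinates makes the
    restriction of P to the line y_0 = 1, y_2 = ... = y_d = 0 irreducible.

    Give y^u theta^i the weight (total degree, (u_2, ..., u_d)).  The initial
    form of P is its restriction to y_2 = ... = y_d = 0, so a product of two initial forms
    of polynomials of degree less than deg P in theta is nonzero modulo it.
    Hence the minimal weight of the reduced representative of delta f defines,
    up to the shift by the weight of delta, a valuation w on the Veronese
    subring R^(M); the valuation on R is v(f) = w(g^M), where g is the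
    component of f of highest degree.

    For each residue class of degrees modulo M, the initial forms of the reduced
    representatives lie in a Noetherian A-module, that of the polynomials of
    degree less than deg P.  Finitely many of them span all, and together with
    the y_i the corresponding elements of R form a Khovanskii basis. *)

Require Import Defs.
From HB Require Import structures.
From mathcomp Require Import all_boot all_order all_algebra all_field.
From mathcomp Require Import generic_quotient ring_quotient fraction finmap.
From mathcomp Require Import boolp classical_sets functions cardinality fsbigop.
From mathcomp Require Import mpoly ring zify.

Set Implicit Arguments.
Unset Strict Implicit.
Unset Printing Implicit Defensive.

Import GRing.Theory.
Local Open Scope ring_scope.

(** * Noetherian modules and multivariate polynomials *)

(** The rank is d, one less than dim R, because irreducibility has to survive. The weight records
    neither the exponent of y_0 nor that of y_1, and the total degree recovers only their sum, so an
    initial form still contains one free variable and the initial form of P lives on a line.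
    Recording one more exponent would restrict P to a point, where it splits into linear factors
    over an algebraically closed field; products of reduced initial forms could then vanish. A
    general line is the smallest linear section on which P stays irreducible.

    The Veronese subring need not lie in A[theta], which is why the denominator delta appears;
    choosing theta, delta and P homogeneous ties the weights to the degrees in R. Characteristic 0
    enters through the primitive element and through the separability of P at a general point, where
    the Hensel lifting behind Bertini starts.

    No subduction algorithm has to terminate: a class in gr_v(R) depends only on an initial form,
    and these lie in a Noetherian module, so one correction by the chosen generators is enough. *)

Section Span.
Variables (A : comNzRingType) (V : lmodType A).
Implicit Types (X Y : V -> Prop).

(** An inductive predicate instead of a family of coefficients: properties of a span are proved by
    adding one term at a time, for a set X that may be infinite. *)
Inductive lspan X : V -> Prop :=
| lspan0 : lspan X 0
| lspan_cons a x y : X x -> lspan X y -> lspan X (a *: x + y).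

Lemma lspan_in X x : X x -> lspan X x.
Proof. by move=> Xx; rewrite -[x]addr0 -[x]scale1r; apply: lspan_cons => //; apply: lspan0. Qed.

Lemma lspanD X x y : lspan X x -> lspan X y -> lspan X (x + y).
Proof.
by move=> hx hy; elim: hx => [|a u v Xu _ IH]; rewrite ?add0r // -addrA; apply: lspan_cons.
Qed.

Lemma lspanZ X a x : lspan X x -> lspan X (a *: x).
Proof.
elim=> [|b u v Xu _ IH]; first by rewrite scaler0; apply: lspan0.
by rewrite scalerDr scalerA; apply: lspan_cons.
Qed.

Lemma lspanN X x : lspan X x -> lspan X (- x).
Proof. by rewrite -scaleN1r; apply: lspanZ. Qed.

Lemma lspan_sum X (I : Type) (r : seq I) (P : pred I) (F : I -> V) :
  (forall i, P i -> lspan X (F i)) -> lspan X (\sum_(i <- r | P i) F i).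
Proof. by move=> h; elim/big_ind: _ => //; [apply: lspan0 | apply: lspanD]. Qed.

Lemma lspan_trans X Y x : (forall y, X y -> lspan Y y) -> lspan X x -> lspan Y x.
Proof.
move=> h; elim=> [|b u v Xu _ IH]; first exact: lspan0.
by apply: lspanD => //; apply/lspanZ/h.
Qed.

Lemma lspan_sub X Y x : (forall y, X y -> Y y) -> lspan X x -> lspan Y x.
Proof. by move=> h; apply: lspan_trans => y /h; apply: lspan_in. Qed.

Lemma lspan_seqP (s : seq V) x : lspan (fun y => y \in s) x ->
  exists c : 'I_(size s) -> A, x = \sum_i c i *: s`_i.
Proof.
elim=> [|a y z ys _ [c ->]].
  by exists (fun=> 0); rewrite big1 // => i _; rewrite scale0r.
have ys' : (index y s < size s)%N by rewrite index_mem.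
exists (fun i => (if i == Ordinal ys' then a else 0) + c i).
under [RHS]eq_bigr => i _ do rewrite scalerDl.
rewrite big_split /=; congr (_ + _).
rewrite (bigD1 (Ordinal ys')) //= eqxx nth_index // big1 ?addr0 // => i /negPf->.
by rewrite scale0r.
Qed.

Lemma lspan_finite X x : lspan X x ->
  exists2 s : seq V, (forall y, y \in s -> X y) & lspan (fun y => y \in s) x.
Proof.
elim=> [|a y z Xy _ [s sX sz]]; first by exists [::] => //; apply: lspan0.
exists (y :: s) => [u|]; first by rewrite inE => /orP[/eqP->|/sX].
apply: lspan_cons; first exact: mem_head.
by apply: lspan_sub sz => u us; rewrite inE us orbT.
Qed.

(** Quantifies over arbitrary subsets, with generators taken from the subset itself: initial forms
    do not make up a submodule, and their generators must again be initial forms. *)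
Definition noetherian_module := forall X, exists2 s : seq V,
  (forall y, y \in s -> X y) & (forall x, X x -> lspan (fun y => y \in s) x).

(** A generator in the span of X involves finitely many elements of X, which can replace it. *)
Lemma noetherian_from_span : (forall X, exists2 s : seq V,
    (forall y, y \in s -> lspan X y) & (forall x, X x -> lspan (fun y => y \in s) x)) ->
  noetherian_module.
Proof.
move=> h X; have [s sX Xs] := h X.
suff [t tX st] : exists2 t : seq V, (forall y, y \in t -> X y) &
    (forall x, x \in s -> lspan (fun y => y \in t) x).
  by exists t => // x /Xs; apply: lspan_trans.
elim: s {Xs} sX => [|x s IH] sX; first by exists [::].
have [|t tX st] := IH; first by move=> y ys; apply: sX; rewrite inE ys orbT.
have [t' t'X xt'] := lspan_finite (sX x (mem_head _ _)).
exists (t ++ t') => [y|y].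
  by rewrite mem_cat => /orP[/tX|/t'X].
rewrite inE => /orP[/eqP->|/st hy].
  by apply: lspan_sub xt' => z zt; rewrite mem_cat zt orbT.
by apply: lspan_sub hy => z zt; rewrite mem_cat zt.
Qed.

End Span.

Definition noetherian (A : comNzRingType) := noetherian_module (GRing.regular A : lmodType A).

Lemma noetherian_surj (A B : comNzRingType) (f : {rmorphism A -> B}) :
  (forall b, exists a, f a = b) -> noetherian A -> noetherian B.
Proof.
move=> fsurj nA X.
have [s sX Xs] := nA (fun a => X (f a)).
exists (map f s) => [y /mapP[x xs ->]|y Xy]; first exact: sX.
have [a fa] := fsurj y; subst y.
elim: (Xs a Xy) => [|b u v us _ IH]; first by rewrite rmorph0; apply: lspan0.
by rewrite rmorphD rmorphM; apply: (@lspan_cons B (GRing.regular B)) => //; apply: map_f.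
Qed.

Lemma noetherian_field (k : fieldType) : noetherian k.
Proof.
move=> X; have [[x [Xx x0]]|h] := pselect (exists x, X x /\ x != 0).
  exists [:: x] => [y|y Xy]; first by rewrite inE => /eqP->.
  have -> : y = (y / x) *: (x : GRing.regular k) + 0 by rewrite addr0 /GRing.scale /= divfK.
  by apply: lspan_cons; [rewrite inE | apply: lspan0].
exists [::] => // y Xy; have [->|y0] := eqVneq y 0; first exact: lspan0.
by case: h; exists y.
Qed.

(** * Hilbert's basis theorem *)

Section HilbertBasis.
Variable A : comNzRingType.
Hypothesis nA : noetherian A.
Local Notation V := (GRing.regular {poly A}).
Variable X : V -> Prop.
Local Notation in_ s := (fun y : V => y \in s).

Let new (s : seq V) (f : V) := [/\ lspan X f, ~ lspan (in_ s) f &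
  forall g : V, lspan X g -> ~ lspan (in_ s) g -> (size f <= size g)%N].

Let new_exists s (f : V) : lspan X f -> ~ lspan (in_ s) f -> exists f, new s f.
Proof.
move: {2}(size f) (leqnn (size f)) => n; elim: n f => [|n IH] f fn Xf sf.
  by exists f; split=> // g _ _; apply: leq_trans fn _.
have [[g [Xg sg gn]]|h] := pselect (exists g : V, [/\ lspan X g, ~ lspan (in_ s) g &
    (size g <= n)%N]).
  exact: IH gn Xg sg.
exists f; split=> // g Xg sg; rewrite leqNgt; apply/negP => gf.
by apply: h; exists g; split=> //; rewrite -ltnS (leq_trans gf).
Qed.

(** Otherwise there is an endless sequence, each f_n of least size in the span of X outside the span
    of the earlier ones. Finitely many leading coefficients generate all, so for some m shifted
    earlier f_i cancel the leading term of f_m, and the difference contradicts the choice of f_m. *)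
Lemma hilbert_basis_span : exists2 s : seq V,
  (forall y, y \in s -> lspan X y) & (forall x, X x -> lspan (in_ s) x).
Proof.
apply: contrapT => noS.
(* The premise sits under the existential so that the choice function [nxt] is total; the value 0 is
   a placeholder. *)
have ex s : exists f : V, (forall y, y \in s -> lspan X y) -> new s f.
  have [sX|] := pselect (forall y, y \in s -> lspan X y); last by exists 0.
  have [f [Xf sf]] : exists f, X f /\ ~ lspan (in_ s) f.
    apply: contrapT => h; apply: noS; exists s => // x Xx.
    by apply: contrapT => sx; apply: h; exists x.
  by have [g hg] := new_exists (lspan_in Xf) sf; exists g.
have [nxt nxtP] := choice ex.
pose S := fix S n : seq V := if n is n'.+1 then nxt (S n') :: S n' else [::].
have SX n : forall y, y \in S n -> lspan X y.
  elim: n => //= n IH y; rewrite inE => /orP[/eqP->|/IH//].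
  by have [] := nxtP _ IH.
pose f n : {poly A} := nxt (S n).
have fP n : new (S n) (f n) by apply: nxtP; apply: SX.
have fS i n : (i < n)%N -> f i \in S n.
  elim: n => // n IH; rewrite ltnS leq_eqVlt => /orP[/eqP->|/IH] /=; first exact: mem_head.
  by rewrite inE => ->; rewrite orbT.
have szf i j : (i <= j)%N -> (size (f i) <= size (f j))%N.
  move=> ij; have [_ _ h] := fP i; have [Xj Sj _] := fP j; apply: h => // Sif.
  apply: Sj; apply: lspan_sub Sif => y.
  elim: j ij {Xj} => [|j IH]; first by rewrite leqn0 => /eqP->.
  rewrite leq_eqVlt => /orP[/eqP->//|/IH h] /h /=.
  by rewrite inE => ->; rewrite orbT.
have f0 n : f n != 0.
  by have [_ h _] := fP n; apply/eqP => f0; apply: h; rewrite f0; apply: lspan0.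
have [s sf fs] := nA (fun a => exists n, a = lead_coef (f n)).
have [m hm] : exists m, forall a, a \in s -> exists2 i, (i < m)%N & a = lead_coef (f i).
  elim: s sf {fs} => [|a s IH] sf; first by exists 0%N.
  have [|m hm] := IH; first by move=> y ys; apply: sf; rewrite inE ys orbT.
  have [n an] := sf a (mem_head _ _); exists (maxn m n.+1) => b.
  rewrite inE => /orP[/eqP->|/hm[i im ->]]; first by exists n => //; rewrite leq_max ltnSn orbT.
  by exists i => //; rewrite leq_max im.
have {sf fs} hl : lspan (fun a => a \in s) (lead_coef (f m) : GRing.regular A) by apply: fs; exists m.
have [g [gS gX gc gsz]] : exists g : {poly A}, [/\ lspan (in_ (S m)) g, lspan X g,
    g`_(size (f m)).-1 = lead_coef (f m) & (size g <= size (f m))%N].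
  elim: hl => [|a u v us _ [g [gS gX gc gsz]]].
    by exists 0; split; rewrite ?coef0 ?size_poly0 //; apply: lspan0.
  have [i im ui] := hm u us.
  pose h : V := (a *: 'X^((size (f m)).-1 - (size (f i)).-1)) * f i.
  have szi : ((size (f i)).-1 <= (size (f m)).-1)%N by rewrite -!subn1 leq_sub2r // szf // ltnW.
  exists (h + g); split.
  - by apply: lspanD => //; apply: (@lspanZ _ V); apply/lspan_in/fS.
  - by apply: lspanD => //; apply: (@lspanZ _ V); have [] := fP i.
  - rewrite coefD gc; congr (_ + _); rewrite /h -scalerAl coefZ coefXnM ltnNge leq_subr /=.
    by rewrite subKn // -lead_coefE -ui.
  - rewrite (leq_trans (size_polyD _ _)) // geq_max gsz andbT.
    rewrite /h -scalerAl (leq_trans (size_scale_leq _ _)) // (leq_trans (size_polyMleq _ _)) //.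
    rewrite size_polyXn addSn /= -{2}(prednK (n := size (f i))) ?size_poly_gt0 //.
    by rewrite addnS subnK // prednK ?size_poly_gt0.
have [Xm Sm min] := fP m.
have := min (f m - g).
have XB : lspan X (f m - g : V) by apply: lspanD => //; apply: lspanN.
have SB : ~ lspan (in_ (S m)) (f m - g : V).
  by move=> h; apply: Sm; rewrite -(subrK g (f m)); apply: lspanD.
move=> /(_ XB SB); apply/negP; rewrite -ltnNge.
rewrite -(prednK (n := size (f m))) ?size_poly_gt0 //.
rewrite ltnS; apply/leq_sizeP => j; rewrite leq_eqVlt => /orP[/eqP<-|hj].
  by rewrite coefB gc -lead_coefE subrr.
move: hj; rewrite prednK ?size_poly_gt0 // => hj.
by rewrite coefB !nth_default ?subr0 // (leq_trans _ hj).
Qed.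

End HilbertBasis.

Lemma noetherian_poly (A : comNzRingType) : noetherian A -> noetherian {poly A}.
Proof. by move=> nA; apply: noetherian_from_span => X; apply: hilbert_basis_span. Qed.

Lemma mpoly_hom_ext (n : nat) (R : nzRingType) (S : nzRingType)
    (f g : {rmorphism {mpoly R[n]} -> S}) :
  (forall c, f c%:MP = g c%:MP) -> (forall i, f 'X_i = g 'X_i) -> f =1 g.
Proof.
move=> hC hX p; rewrite (mpolyE p) !rmorph_sum; apply: eq_bigr => m _.
rewrite -mul_mpolyC !rmorphM /= hC; congr (_ * _).
rewrite mpolyXE_id !rmorph_prod; apply: eq_bigr => i _.
by rewrite !rmorphXn /= hX.
Qed.

Section Fold.
Variables (n : nat) (R : comNzRingType).

Fact mfold_comm : commr_rmorph (@mwiden n R) 'X_ord_max.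
Proof. by move=> p; apply: mulrC. Qed.

(** Sends the polynomial variable to the last of n + 1 variables. Surjectivity transports
    Noetherianity, and [meval_mfold] evaluates one variable at a time. *)
Definition mfold : {rmorphism {poly {mpoly R[n]}} -> {mpoly R[n.+1]}} :=
  horner_morph mfold_comm.

Lemma mfoldE q : mfold q = (map_poly (@mwiden n R) q).['X_ord_max].
Proof. by []. Qed.

Lemma mfold_surj p : exists q, mfold q = p.
Proof.
elim/mpolyind: p => [|c m p _ _ [q <-]]; first by exists 0; rewrite rmorph0.
suff [r hr] : exists r, mfold r = 'X_[m].
  exists (c%:MP%:P * r + q); rewrite rmorphD rmorphM hr; congr (_ + _).
  by rewrite mfoldE map_polyC hornerC /= mwidenC mul_mpolyC.
pose m' : 'X_{1..n} := [multinom m (widen_ord (leqnSn n) i) | i < n].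
exists ('X_[m']%:P * 'X^(m ord_max)).
rewrite rmorphM rmorphXn mfoldE map_polyC hornerC /= mwidenX.
rewrite horner_morphX mpolyXn -mpolyXD; congr 'X_[_].
apply/mnmP => i; rewrite mnmDE mulmnE mnm1E.
have [[j ->]|->] : (exists j, i = widen_ord (leqnSn n) j) \/ i = ord_max.
- have := ltn_ord i; rewrite ltnS leq_eqVlt => /orP[/eqP e|lin].
    by right; apply: val_inj.
  by left; exists (Ordinal lin); apply: val_inj.
- rewrite mnmwiden_widen mnmE (_ : (_ == _) = false) ?mul0n ?addn0 //.
  by apply/eqP => /(congr1 val) /= e; have := ltn_ord j; rewrite -e ltnn.
- by rewrite mnmwiden_ordmax eqxx mul1n.
Qed.

Lemma meval_mfold (v : 'I_n.+1 -> R) q :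
  (mfold q).@[v] = (map_poly (meval (fun i => v (widen_ord (leqnSn n) i))) q).[v ord_max].
Proof.
have hw p : (mwiden p).@[v] = p.@[fun i => v (widen_ord (leqnSn n) i)].
  have := @mpoly_hom_ext n R R (@meval _ _ v \o @mwiden n R)
     (@meval _ _ (fun i => v (widen_ord (leqnSn n) i))).
  move=> /(_ _ _ p) h; apply: h => [c|i] /=; first by rewrite mwidenC !mevalC.
  by rewrite mwidenX mnmwiden1 !mevalXU.
elim/poly_ind: q => [|q c IH]; first by rewrite !rmorph0 horner0.
rewrite !rmorphD !rmorphM /= !hornerE IH; congr (_ * _ + _).
  by rewrite map_polyX hornerX horner_morphX mevalXU.
by rewrite mfoldE !map_polyC !hornerC hw.
Qed.

End Fold.

Lemma noetherian_mpoly (A : comNzRingType) n : noetherian A -> noetherian {mpoly A[n]}.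
Proof.
move=> nA; elim: n => [|n IH].
  apply: (@noetherian_surj A _ (@mpolyC 0 A)) nA => p.
  by exists p@_0%MM; rewrite [RHS]nvar0_mpolyC.
exact: noetherian_surj (@mfold_surj n A) (noetherian_poly IH).
Qed.

(* The A-submodules of A ^ n are the linear parts of ideals of A[X_1, ..., X_n]. *)
Lemma noetherian_bounded (A : comNzRingType) n (X : {poly A} -> Prop) : noetherian A ->
    (forall F, X F -> (size F <= n)%N) ->
  exists2 s : seq {poly A}, (forall F, F \in s -> X F) &
    (forall F, X F -> lspan (fun H => H \in s) F).
Proof.
move=> nA Xn; pose phi (F : {poly A}) : {mpoly A[n]} := \sum_(i < n) F`_i *: 'X_i.
pose lin (b : {mpoly A[n]}) : {poly A} := \poly_(i < n) (if insub i is Some j then b@_U_(j) else 0).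
have linE b (i : 'I_n) : (lin b)`_i = b@_U_(i).
  by rewrite coef_poly ltn_ord valK.
have lin_ext (F H : {poly A}) : (size F <= n)%N -> (size H <= n)%N ->
    (forall i : 'I_n, F`_i = H`_i) -> F = H.
  move=> sF sH h; apply/polyP => i; have [lt|ge] := ltnP i n; first exact: (h (Ordinal lt)).
  by rewrite !nth_default // (leq_trans _ ge).
(* [phi F] has only terms of degree one, so the linear part of a multiple sees just the constant
   term of the multiplier: an ideal relation among the [phi F] turns into an A-linear one. *)
have linM (a : {mpoly A[n]}) (F : {poly A}) : (size F <= n)%N -> lin (a * phi F) = a@_0%MM *: F.
  move=> sF; apply: lin_ext => [||i]; first exact: size_poly.
    by apply: leq_trans (size_scale_leq _ _) sF.
  rewrite linE coefZ /phi mulr_sumr raddf_sum (bigD1 i) //= -scalerAr mcoeffZ.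
  rewrite -[X in mcoeff X]addm0 mcoeffMX mulrC big1 ?addr0 // => j ji.
  rewrite -scalerAr mcoeffZ memN_msupp_eq0 ?mulr0 //.
  rewrite (perm_mem (msuppMX _ _)); apply/negP => /mapP[u _ /(congr1 (fun v : 'X_{1..n} => v j))].
  by rewrite !mnmDE mnm0E !mnm1E eqxx eq_sym (negPf ji).
have linD (a b : {mpoly A[n]}) : lin (a + b) = lin a + lin b.
  apply: lin_ext => [||i]; first exact: size_poly.
    by rewrite (leq_trans (size_polyD _ _)) // geq_max !size_poly.
  by rewrite coefD !linE mcoeffD.
have [s sX Xs] := @noetherian_mpoly A n nA (fun b => exists2 F, X F & b = phi F).
have [g gP] : exists g : {mpoly A[n]} -> {poly A}, forall b, b \in s -> X (g b) /\ b = phi (g b).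
  have ex b : exists F, b \in s -> X F /\ b = phi F.
    have [/sX[F XF e]|nbs] := boolP (b \in s); [by exists F | by exists 0].
  by have [g hg] := choice ex; exists g.
exists (map g s) => [F /mapP[b /gP[XF _] ->] //|F XF].
have -> : F = lin (phi F).
  by rewrite -[phi F]mul1r linM ?Xn // mcoeff1 eqxx scale1r.
elim: (Xs (phi F) (ex_intro2 _ _ F XF erefl)) => [|a u v us _ IH].
  have -> : lin 0 = 0 by apply/polyP => i; rewrite coef_poly coef0; case: ifP => //; case: insub => // j; rewrite mcoeff0.
  exact: lspan0.
rewrite linD -[a *: u]/(a * (u : {mpoly A[n]})) (gP u us).2 linM ?Xn ?(gP u us).1 //.
apply: lspan_cons => //; apply/mapP; exists u => //.
by case: (gP u us).
Qed.

Lemma mpoly_nonroot (k : closedFieldType) n (p : {mpoly k[n]}) :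
  p != 0 -> exists v, p.@[v] != 0.
Proof.
elim: n p => [|n IH] p p0.
  exists (fun=> 0); rewrite (nvar0_mpolyC p) mevalC.
  by apply: contra_neq p0 => p0; rewrite (nvar0_mpolyC p) p0 mpolyC0.
have [q qp] := mfold_surj p.
have /IH[v hv] : lead_coef q != 0.
  by rewrite lead_coef_eq0; apply: contra_neq p0 => q0; rewrite -qp q0 rmorph0.
have /closed_nonrootP[x] : map_poly (meval v) q != 0.
  apply: contra_neq hv => /polyP/(_ (size q).-1).
  by rewrite coef_map coef0 -lead_coefE.
rewrite rootE => hx; exists (fun i => if unlift ord_max i is Some j then v j else x).
rewrite -qp meval_mfold unlift_none.
rewrite (_ : map_poly _ q = map_poly (meval v) q) //.
apply: eq_map_poly => c /=; apply: meval_eq => i.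
have -> : widen_ord (leqnSn n) i = lift ord_max i.
  by apply: val_inj; rewrite /= /bump leqNgt ltn_ord add0n.
by rewrite liftK.
Qed.

(** * Hensel lifting and a Bertini theorem *)

Lemma ltn_pred_add2r x y z : (x < y)%N -> (0 < x)%N -> ((x + z).-1 < (y + z).-1)%N.
Proof. lia. Qed.

Lemma ltn_pred_add_cancel x y z : (0 < x)%N -> (0 < y)%N -> ((x + y).-1 < (x + z).-1)%N -> (y < z)%N.
Proof. lia. Qed.

Lemma leq_pred_add x y n m : (x < n)%N -> (y < m)%N -> ((x + y).-1 <= (n + m).-2)%N.
Proof. lia. Qed.

Lemma ltn_pred2_pred n m : (0 < n)%N -> (0 < m)%N -> ((n + m).-2 < (n + m).-1)%N.
Proof. lia. Qed.

Lemma leq_addr_pred x y : (0 < y)%N -> (x <= (x + y).-1)%N.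
Proof. lia. Qed.

Section Hensel.
Variable C : comNzRingType.
Implicit Types (f g : nat -> {poly C}).

(* A power series with coefficients in C[T] is given by its sequence of
   coefficients; conv is their product. *)
Definition conv f g l := \sum_(i < l.+1) f i * g (l - i)%N.

Lemma conv0 f g : conv f g 0 = f 0%N * g 0%N.
Proof. by rewrite /conv big_ord1. Qed.

Lemma convS f g l : conv f g l.+1 =
  f 0%N * g l.+1 + (\sum_(i < l) f i.+1 * g (l - i)%N) + f l.+1 * g 0%N.
Proof.
rewrite /conv big_ord_recl big_ord_recr /= subnn subn0 addrA; congr (_ + _ + _).
Qed.

Variables (F0 G0 U V : {poly C}).
Hypotheses (F0m : F0 \is monic) (G0m : G0 \is monic) (UV : U * F0 + V * G0 = 1).

(** Normalizes a Hensel lift: the terms of positive order have smaller degree in T, so lifts stay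
    monic of the degrees of [F0] and [G0] and become unique. *)
Definition small f g := forall l, (0 < l)%N ->
  (size (f l) < size F0)%N /\ (size (g l) < size G0)%N.

(** Division of E * V by [F0] bounds a. The bound on b is then forced, since F0 * b = E - a * G0 is
    smaller than F0 * G0. *)
Lemma bezout_small (E : {poly C}) : (size E < size (F0 * G0)%R)%N ->
  exists a b : {poly C}, [/\ (size a < size F0)%N, (size b < size G0)%N & a * G0 + F0 * b = E].
Proof.
move=> hE; pose a := Pdiv.Ring.rmodp (E * V) F0; pose q := Pdiv.Ring.rdivp (E * V) F0.
have ea : E * V = q * F0 + a by apply: Pdiv.RingMonic.rdivp_eq.
have sa : (size a < size F0)%N by apply: Pdiv.Ring.ltn_rmodpN0; apply: monic_neq0.
pose b := E * U + q * G0.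
have eb : a * G0 + F0 * b = E.
  transitivity (E * U * F0 + E * V * G0); first by rewrite ea /b; ring.
  by rewrite -[RHS]mulr1 -UV; ring.
exists a, b; split=> //.
have [->|b0] := eqVneq b 0; first by rewrite size_poly0 size_poly_gt0 monic_neq0.
have : (size (F0 * b)%R < size (F0 * G0)%R)%N.
  have -> : F0 * b = E - a * G0 by rewrite -eb; ring.
  rewrite (leq_ltn_trans (size_polyD _ _)) // gtn_max hE size_polyN /=.
  have [->|a0] := eqVneq a 0; first by rewrite mul0r size_poly0 (leq_ltn_trans _ hE).
  rewrite size_Mmonic // size_monicM ?monic_neq0 //.
  have a1 : (0 < size a)%N by rewrite size_poly_gt0.
  exact: ltn_pred_add2r sa a1.
rewrite (size_monicM F0m b0) (size_monicM F0m (monic_neq0 G0m)).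
have b1 : (0 < size b)%N by rewrite size_poly_gt0.
have f1 : (0 < size F0)%N by rewrite size_poly_gt0 monic_neq0.
exact: ltn_pred_add_cancel f1 b1.
Qed.

(** The unknown coefficients a, b of order L + 1 enter linearly, as a * G0 + F0 * b, next to a sum M
    of known terms. A finite order is enough: Bertini looks up to order D + D. *)
Lemma hensel_exists (Q : nat -> {poly C}) : Q 0%N = F0 * G0 ->
    (forall l, (0 < l)%N -> (size (Q l) < size (F0 * G0)%R)%N) ->
  forall L, exists f g, [/\ f 0%N = F0, g 0%N = G0, small f g &
    forall l, (l <= L)%N -> conv f g l = Q l].
Proof.
move=> Q0 Qs; elim=> [|L [f [g [f0 g0 sfg fgQ]]]].
  exists (fun l => if l is 0 then F0 else 0), (fun l => if l is 0 then G0 else 0).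
  split=> // [[|l] // _|l].
    by rewrite !size_poly0 !size_poly_gt0 !monic_neq0.
  by rewrite leqn0 => /eqP->; rewrite conv0 Q0.
pose M := \sum_(i < L) f i.+1 * g (L - i)%N.
have [|a [b [sa sb eab]]] := @bezout_small (Q L.+1 - M).
  rewrite (leq_ltn_trans (size_polyD _ _)) // gtn_max Qs //= size_polyN.
  have F0s : (0 < size F0)%N by rewrite size_poly_gt0 monic_neq0.
  have G0s : (0 < size G0)%N by rewrite size_poly_gt0 monic_neq0.
  rewrite size_monicM ?monic_neq0 //.
  apply: (leq_ltn_trans (size_sum _ _ _)); apply: (@leq_ltn_trans (size F0 + size G0).-2).
    apply/bigmax_leqP => i _; apply: leq_trans (size_polyMleq _ _) _.
    have [s1 _] := sfg i.+1 isT; have [|_ s2] := sfg (L - i)%N; first by rewrite subn_gt0.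
    exact: leq_pred_add s1 s2.
  exact: ltn_pred2_pred.
pose f' l := if l == L.+1 then a else f l; pose g' l := if l == L.+1 then b else g l.
exists f', g'; split=> //.
  by move=> l l0; rewrite /f' /g'; case: eqP => // _; apply: sfg.
move=> l; rewrite leq_eqVlt => /orP[/eqP->|].
  rewrite convS /f' /g' !eqxx /= f0 g0.
  rewrite (_ : \sum_(i < L) _ = M); last first.
    apply: eq_bigr => i _; rewrite eqSS !ltn_eqF //.
    by rewrite ltnS leq_subr.
  by rewrite -addrA addrC -addrA eab addrC subrK.
rewrite ltnS => lL; rewrite -fgQ //; apply: eq_bigr => i _.
rewrite /f' /g' !ltn_eqF //; first by rewrite ltnS (leq_trans (leq_subr _ _)).
by rewrite (leq_trans (ltn_ord i)).
Qed.

(** By Bezout a is a multiple of the monic [F0], and it is smaller. *)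
Lemma small_coprime (a b : {poly C}) : (size a < size F0)%N -> a * G0 + F0 * b = 0 -> a = 0 /\ b = 0.
Proof.
move=> sa e.
have ea : a = F0 * (a * U - V * b).
  rewrite -[LHS]mulr1 -UV; transitivity (a * U * F0 + V * (a * G0)); first by ring.
  by move/eqP: e; rewrite addr_eq0 => /eqP->; ring.
have a0 : a = 0.
  apply/eqP; apply: contraLR sa => a0; rewrite -leqNgt ea.
  have w0 : a * U - V * b != 0 by apply: contra_neq a0 => w0; rewrite ea w0 mulr0.
  by rewrite size_monicM //; apply: leq_addr_pred; rewrite size_poly_gt0.
split=> //; move: e; rewrite a0 mul0r add0r => e.
by apply: (monic_lreg F0m); rewrite e mulr0.
Qed.

(** Lifts that agree below order l differ at order l by a solution of the homogeneous equation in
    [small_coprime]. *)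
Lemma hensel_unique f g f' g' L :
    f 0%N = F0 -> g 0%N = G0 -> f' 0%N = F0 -> g' 0%N = G0 ->
    small f g -> small f' g' -> (forall l, (l <= L)%N -> conv f g l = conv f' g' l) ->
  forall l, (l <= L)%N -> f l = f' l /\ g l = g' l.
Proof.
move=> f0 g0 f'0 g'0 s s' e l; have [n] := ubnP l; elim: n l => // n IH [|l] ln lL.
  by rewrite f0 g0 f'0 g'0.
have := e _ lL; rewrite !convS f0 g0 f'0 g'0.
rewrite (_ : \sum_(i < l) f i.+1 * g (l - i)%N = \sum_(i < l) f' i.+1 * g' (l - i)%N); last first.
  apply: eq_bigr => i _; have li := ltn_ord i.
  have [||-> _] := IH i.+1; [lia | lia |].
  by have [||_ ->] := IH (l - i)%N; [lia | lia |].
have [sf _] := s l.+1 isT; have [sf' _] := s' l.+1 isT => h.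
have [||] := @small_coprime (f l.+1 - f' l.+1) (g l.+1 - g' l.+1).
- by rewrite (leq_ltn_trans (size_polyD _ _)) // gtn_max size_polyN sf.
- apply/eqP; move/eqP: h; rewrite -subr_eq0 => /eqP h; apply/eqP; rewrite -[RHS]h; ring.
by move=> /eqP; rewrite subr_eq0 => /eqP-> /eqP; rewrite subr_eq0 => /eqP->.
Qed.

End Hensel.

(** Only monic factorizations count, because they specialize along ring morphisms without losing
    degree. Over k[X], [monic_irreducible_Gauss] deals with the other ones. *)
Definition monic_irreducible (A : nzRingType) (P : {poly A}) :=
  forall F G : {poly A}, F \is monic -> G \is monic -> P = F * G -> F = 1 \/ G = 1.

Lemma monic_size1 (A : nzRingType) (p : {poly A}) : p \is monic -> (size p <= 1)%N -> p = 1.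
Proof.
move=> pm sp; have e := size1_polyC sp; move: pm; rewrite e monicE lead_coefC => /eqP->.
by [].
Qed.

Lemma leq_add_pred_trans x y D : (0 < y)%N -> ((x + y).-1 <= D)%N -> (x <= D.+1)%N.
Proof. lia. Qed.

Lemma leq_add_pred_double x y D l : (x <= D.+1)%N -> (y <= D.+1)%N -> (D + D < l)%N -> ((x + y).-1 <= l)%N.
Proof. lia. Qed.

(** * Irreducibility on a general line through a point *)

Section Bertini.
Variables (k : closedFieldType) (N : nat).
Local Notation C := {mpoly k[N]}.
Variables (P : {poly C}) (p : 'I_N -> k).
Hypotheses (Pm : P \is monic) (Pirr : monic_irreducible P).
Hypothesis Psep : separable_poly (map_poly (meval p) P).

Definition line_point (a : 'I_N -> k) (i : 'I_N) : {poly k} := (p i)%:P + (a i)%:P * 'X.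
Definition line_sub (a : 'I_N -> k) : C -> {poly k} := mmap polyC (line_point a).
HB.instance Definition _ a := GRing.RMorphism.on (line_sub a).

(* gsub c is c(p + tau X) as a polynomial in tau over C = k[X]. *)
Let gpoint (i : 'I_N) : {poly C} := ((p i)%:MP)%:P + ('X_i)%:P * 'X.
Let gsub : {rmorphism C -> {poly C}} := mmap (polyC \o @mpolyC N k) gpoint.

Let gsubC c : gsub c%:MP = (c%:MP)%:P.
Proof. by rewrite /gsub /= mmapC. Qed.
Let gsubX i : gsub 'X_i = gpoint i.
Proof. by rewrite /gsub /= mmapX mmap1U. Qed.

Let line_subC a c : line_sub a c%:MP = c%:P.
Proof. by rewrite /line_sub mmapC. Qed.
Let line_subX a i : line_sub a 'X_i = line_point a i.
Proof. by rewrite /line_sub mmapX mmap1U. Qed.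

Let gsub_spec a c : map_poly (meval a) (gsub c) = line_sub a c.
Proof.
have := @mpoly_hom_ext _ _ _ (map_poly (@meval N k a) \o gsub) (line_sub a).
move=> h; apply: (h _ _ c) => {h} [d|i] /=; first by rewrite gsubC line_subC map_polyC /= mevalC.
rewrite gsubX line_subX /gpoint rmorphD rmorphM /= !map_polyC map_polyX /=.
by rewrite mevalC mevalXU.
Qed.

Let gsub0 c : (gsub c)`_0 = (c.@[p])%:MP.
Proof.
rewrite -horner_coef0.
have := @mpoly_hom_ext _ _ _ (@horner_eval C 0 \o gsub) (@mpolyC N k \o @meval N k p).
move=> h; apply: (h _ _ c) => {h} [d|i] /=.
  by rewrite gsubC /horner_eval hornerC mevalC.
by rewrite gsubX /horner_eval /gpoint !hornerE ?mulr0 ?addr0 mevalXU.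
Qed.

(** The value at tau = 1 is the translation by p; [tr'] is its inverse and carries a factorization
    of the translated P back to P. *)
Let tr : {rmorphism C -> C} := @horner_eval C 1 \o gsub.
Let tr' : {rmorphism C -> C} := mmap (@mpolyC N k) (fun i => 'X_i - (p i)%:MP).

Let trK c : tr' (tr c) = c.
Proof.
have := @mpoly_hom_ext _ _ _ (tr' \o tr) idfun.
move=> h; apply: (h _ _ c) => {h} [d|i] /=.
  by rewrite gsubC /horner_eval hornerC mmapC.
rewrite gsubX /horner_eval /gpoint !hornerE rmorphD /= mmapC mmapX mmap1U.
by rewrite addrC subrK.
Qed.

(* The coefficient of tau ^ l in P(p + tau X, T). *)
Let Q l : {poly C} := \poly_(j < size P) (gsub P`_j)`_l.

Let coefQ l j : (Q l)`_j = (gsub P`_j)`_l.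
Proof. by rewrite coef_poly; case: ltnP => // /(nth_default 0)->; rewrite rmorph0 coef0. Qed.

Let D := \max_(j < size P) size (gsub P`_j)%R.

Let Q_big l : (D <= l)%N -> Q l = 0.
Proof.
move=> Dl; apply/polyP => j; rewrite coefQ coef0; have [jP|jP] := ltnP j (size P).
  apply: nth_default; apply: leq_trans Dl.
  exact: (@leq_bigmax _ (fun j : 'I_(size P) => size (gsub P`_j)%R) (Ordinal jP)).
by rewrite (nth_default 0 jP) rmorph0 coef0.
Qed.

Let Pp := map_poly (meval p) P.
Let Ppm : Pp \is monic. Proof. exact: monic_map. Qed.

Let Q0 : Q 0%N = map_poly (@mpolyC N k) Pp.
Proof. by apply/polyP => j; rewrite coefQ gsub0 !coef_map. Qed.

Let sizePp : size Pp = size P.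
Proof. by rewrite size_map_poly_id0 // (monicP Pm) rmorph1 oner_eq0. Qed.

Let Q_small l : (0 < l)%N -> (size (Q l) < size P)%N.
Proof.
move=> l0; have P0 : (0 < size P)%N by rewrite size_poly_gt0 monic_neq0.
rewrite -(prednK P0) ltnS; apply/leq_sizeP => j; rewrite leq_eqVlt => /orP[/eqP<-|].
  by rewrite coefQ -lead_coefE (monicP Pm) rmorph1 coefC gtn_eqF.
by rewrite prednK // => hj; rewrite coefQ (nth_default _ hj) rmorph0 coef0.
Qed.

(* Hensel lifts F0 G0 to power series f, g in tau over C.  If the coefficients of f
   and g vanished in all degrees from D + 1 to 2 D, then f and g truncated at
   degree D would factor P at tau = 1.  So some such coefficient has a nonzero
   coefficient dlt, and if dlt(a) <> 0 the uniqueness of Hensel lifts excludes a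
   factorization of degree at most D in tau along the line p + tau a. *)
Lemma bertini_factor (F0 G0 : {poly k}) : F0 \is monic -> G0 \is monic ->
    (1 < size F0)%N -> (1 < size G0)%N -> Pp = F0 * G0 ->
  exists2 dlt : C, dlt != 0 & forall a, dlt.@[a] != 0 ->
    forall F G : {poly {poly k}}, F \is monic -> G \is monic ->
      map_poly (line_sub a) P = F * G -> map_poly (horner_eval 0) F = F0 -> False.
Proof.
move=> F0m G0m sF0 sG0 PFG.
have cop : coprimep F0 G0.
  by move: Psep; rewrite -/Pp PFG separable_mul => /and3P[].
have [[u v] /= uv] : exists u : {poly k} * {poly k}, u.1 * F0 + u.2 * G0 = 1.
  move/Bezout_coprimepP: cop => [[u v] /=]; rewrite -size_poly_eq1 => /size_poly1P[c c0 e].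
  exists (c^-1 *: u, c^-1 *: v); rewrite /= -!scalerAl -scalerDr e.
  by rewrite -mul_polyC -polyCM mulVf.
have iF0m : map_poly (@mpolyC N k) F0 \is monic by apply: monic_map.
have iG0m : map_poly (@mpolyC N k) G0 \is monic by apply: monic_map.
have iuv : map_poly (@mpolyC N k) u * map_poly (@mpolyC N k) F0 + map_poly (@mpolyC N k) v * map_poly (@mpolyC N k) G0 = 1.
  by rewrite -!rmorphM -rmorphD uv rmorph1.
have Q0' : Q 0%N = map_poly (@mpolyC N k) F0 * map_poly (@mpolyC N k) G0 by rewrite Q0 PFG rmorphM.
have siPp : size (map_poly (@mpolyC N k) Pp) = size P.
  by rewrite size_map_poly_id0 ?sizePp // (monicP Ppm) rmorph1 oner_eq0.
have sum_small (R : nzRingType) (h : nat -> {poly R}) (h0 : {poly R}) n :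
    h 0%N = h0 -> h0 \is monic -> (forall l, (0 < l)%N -> (size (h l) < size h0)%N) ->
    \sum_(l < n.+1) h l \is monic /\ size (\sum_(l < n.+1) h l) = size h0.
  move=> e0 m0 hs; rewrite big_ord_recl e0.
  have ss : (size (\sum_(l < n) h (lift ord0 l))%R < size h0)%N.
    apply: (leq_ltn_trans (size_sum _ _ _)).
    have h0s : (0 < size h0)%N by rewrite size_poly_gt0 monic_neq0.
    rewrite -(prednK h0s) ltnS; apply/bigmax_leqP => j _.
    by rewrite -ltnS prednK // hs.
  by rewrite size_polyDl // monicE lead_coefDl // (monicP m0).
have [|f [g [f0 g0 sfg fgQ]]] := hensel_exists iF0m iG0m iuv Q0' _ (D + D).
  by move=> l l0; rewrite -Q0' Q0 siPp Q_small.
have [l [lD lDD fgl]] : exists l, [/\ (D < l)%N, (l <= D + D)%N & (f l != 0) || (g l != 0)].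
  apply: contrapT => nofg.
  have fg0 l : (D < l)%N -> (l <= D + D)%N -> f l = 0 /\ g l = 0.
    move=> h1 h2; have [->|fl] := eqVneq (f l) 0; have [->|gl] := eqVneq (g l) 0 => //;
    by case: nofg; exists l; split; rewrite // ?fl ?gl ?orbT.
  pose FF := \poly_(l < D.+1) f l; pose GG := \poly_(l < D.+1) g l.
  (* Up to order D + D the gap makes the truncated product agree with the full one; beyond that both
     sides vanish for degree reasons. *)
  have eFG : FF * GG = \poly_(l < D.+1) Q l.
    apply/polyP => l; have [lDD|lDD] := leqP l (D + D); last first.
      rewrite [RHS]nth_default; last first.
        by apply: leq_trans (size_poly _ _) _; apply: leq_ltn_trans lDD; apply: leq_addr.
      apply: nth_default; apply: leq_trans (size_polyMleq _ _) _.
      exact: leq_add_pred_double (size_poly D.+1 f) (size_poly D.+1 g) lDD.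
    rewrite coefM coef_poly; have -> : (if (l < D.+1)%N then Q l else 0) = Q l.
      by rewrite ltnS; case: leqP => // /ltnW/Q_big->.
    rewrite -fgQ //; apply: eq_bigr => j _; have jl := ltn_ord j.
    rewrite !coef_poly !ltnS; case: leqP => jD; last first.
      by rewrite (fg0 j _ _).1 ?mul0r // (leq_trans _ lDD).
    case: leqP => ljD //; rewrite (fg0 (l - j)%N _ _).2 ?mulr0 //.
    by rewrite (leq_trans _ lDD) // leq_subr.
  have sF : FF.[1] = \sum_(l < D.+1) f l.
    by rewrite horner_poly; apply: eq_bigr => j _; rewrite expr1n mulr1.
  have sG : GG.[1] = \sum_(l < D.+1) g l.
    by rewrite horner_poly; apply: eq_bigr => j _; rewrite expr1n mulr1.
  have sQ : (\poly_(l < D.+1) Q l).[1] = map_poly tr P.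
    rewrite horner_poly; apply/polyP => j; rewrite coef_sum coef_map /=.
    rewrite /horner_eval (@horner_coef_wide _ D.+1); last first.
      have [jP|jP] := ltnP j (size P); last by rewrite (nth_default 0 jP) rmorph0 size_poly0.
      apply: leqW.
      exact: (@leq_bigmax _ (fun j : 'I_(size P) => size (gsub P`_j)%R) (Ordinal jP)).
    by apply: eq_bigr => m _; rewrite !expr1n !mulr1 coefQ.
  have [FFm sFF] := sum_small _ f _ D f0 iF0m (fun l h => (sfg l h).1).
  have [GGm sGG] := sum_small _ g _ D g0 iG0m (fun l h => (sfg l h).2).
  have : map_poly tr P = FF.[1] * GG.[1] by rewrite -sQ -eFG hornerM.
  move=> /(congr1 (map_poly tr')); rewrite rmorphM /= -map_poly_comp.
  have -> : map_poly (tr' \o tr) P = P.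
    by apply: map_poly_id => c _; apply: trK.
  have m1 : map_poly tr' FF.[1] \is monic by rewrite sF; exact: (monic_map tr' FFm).
  have m2 : map_poly tr' GG.[1] \is monic by rewrite sG; exact: (monic_map tr' GGm).
  have smap (q : {poly C}) (h : {rmorphism C -> C}) : q \is monic -> size (map_poly h q) = size q.
    by move=> qm; rewrite size_map_poly_id0 // (monicP qm) rmorph1 oner_eq0.
  have smapi (q : {poly k}) : q \is monic -> size (map_poly (@mpolyC N k) q) = size q.
    by move=> qm; rewrite size_map_poly_id0 // (monicP qm) rmorph1 oner_eq0.
  have s1 : size (map_poly tr' FF.[1]) = size F0.
    by rewrite -(smapi F0) // -sFF sF; apply: (smap _ tr' FFm).
  have s2 : size (map_poly tr' GG.[1]) = size G0.
    by rewrite -(smapi G0) // -sGG sG; apply: (smap _ tr' GGm).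
  move=> /(Pirr m1 m2) [] e.
    by move: s1; rewrite e size_poly1 => e'; rewrite -e' in sF0.
  by move: s2; rewrite e size_poly1 => e'; rewrite -e' in sG0.
(* If this coefficient of the lift does not vanish at a, the lift specialized to a is nonzero at
   order l > D, where the factors on the line vanish. *)
pose c : C := if f l != 0 then lead_coef (f l) else lead_coef (g l).
exists c.
  by rewrite /c; case: eqP fgl => [|/eqP] /=; rewrite !lead_coef_eq0.
move=> a ca F G Fm Gm eFG eF0.
have h0s (h : {poly {poly k}}) : (swapXY h)`_0 = map_poly (horner_eval 0) h.
  by apply/polyP => j; rewrite coef_swapXY coef_map /= /horner_eval horner_coef0.
(* Exchanging tau and T presents the factors on the line as series in tau over k[T], to be compared
   with the specialized lift. *)
pose F' l := (swapXY F)`_l; pose G' l := (swapXY G)`_l.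
have eQ : swapXY F * swapXY G = \poly_(l < D) map_poly (meval a) (Q l).
  rewrite -rmorphM -eFG; apply/polyP => m; apply/polyP => j.
  rewrite coef_swapXY coef_map coef_poly /= -gsub_spec coef_map -coefQ.
  case: ltnP => [_|/Q_big->]; first by rewrite coef_map.
  by rewrite !coef0 raddf0.
have F0' : F' 0%N = F0 by rewrite /F' h0s.
have G0' : G' 0%N = G0.
  have : F' 0%N * G' 0%N = F0 * G0.
    rewrite /F' /G' -coef0M eQ coef_poly -PFG.
    case: ltnP => [_|/Q_big]; rewrite ?Q0.
      by apply/polyP => j; rewrite !coef_map /= mevalC.
    move=> h; exfalso; move: siPp; rewrite -Q0 Q0 h size_poly0 => /esym/eqP.
    by rewrite size_poly_eq0 (negPf (monic_neq0 Pm)).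
  by rewrite F0' => /(mulfI (monic_neq0 F0m)).
have szX (h : {poly {poly k}}) m : h \is monic -> (0 < m)%N ->
    (size ((swapXY h)`_m)%R < size (map_poly (horner_eval 0) h))%N.
  move=> hm m0; have h1 : size (map_poly (horner_eval 0) h) = size h.
    by rewrite size_map_poly_id0 // (monicP hm) rmorph1 oner_eq0.
  have hs : (0 < size h)%N by rewrite size_poly_gt0 monic_neq0.
  rewrite h1 -(prednK hs) ltnS; apply/leq_sizeP => j; rewrite leq_eqVlt => /orP[/eqP<-|].
    by rewrite coef_swapXY -lead_coefE (monicP hm) coef1 gtn_eqF.
  by rewrite prednK // => hj; rewrite coef_swapXY (nth_default _ hj) coef0.
have hconv m : conv F' G' m = map_poly (meval a) (Q m).
  rewrite /conv -coefM eQ coef_poly; case: ltnP => // /Q_big->.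
  by rewrite rmorph0.
pose f' l := map_poly (meval a) (f l); pose g' l := map_poly (meval a) (g l).
have mevi (q : {poly k}) : map_poly (meval a) (map_poly (@mpolyC N k) q) = q.
  by rewrite -map_poly_comp; apply: map_poly_id => c' _ /=; rewrite mevalC.
have mon_ev (q : {poly k}) (h : {poly C}) : q \is monic ->
   (size h < size (map_poly (@mpolyC N k) q))%N -> (size (map_poly (meval a) h) < size q)%N.
  move=> qm; rewrite (size_map_poly_id0 (p := q)) ?(monicP qm) ?rmorph1 ?oner_eq0 //.
  by move=> hq; apply: leq_ltn_trans hq; apply: size_poly.
have := @hensel_unique k F0 G0 u v F0m G0m uv f' g' F' G' (D + D).
(* Degrees in tau add in the domain k[T][tau], so a factor cannot exceed the degree of the
   product. *)
have sD (X Y : {poly {poly k}}) : X * Y = \poly_(l < D) map_poly (meval a) (Q l) ->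
    Y != 0 -> (size X <= D.+1)%N.
  move=> eXY Y0; have [->|X0] := eqVneq X 0; first by rewrite size_poly0.
  have := size_poly D (fun l => map_poly (meval a) (Q l)); rewrite -eXY size_mul //.
  by apply: leq_add_pred_trans; rewrite size_poly_gt0.
have sF' : F' l = 0.
  apply: nth_default; apply: leq_trans lD; apply: sD eQ _.
  by rewrite swapXY_eq0 monic_neq0.
have sG' : G' l = 0.
  apply: nth_default; apply: leq_trans lD; apply: (sD _ (swapXY F)).
    by rewrite mulrC.
  by rewrite swapXY_eq0 monic_neq0.
move=> /(_ _ _ _ _ _ _ _ l lDD) [].
- by rewrite /f' f0 mevi.
- by rewrite /g' g0 mevi.
- exact: F0'.
- exact: G0'.
- by move=> m m0; have [h1 h2] := sfg m m0; split; apply: mon_ev.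
- move=> m m0; split; first by rewrite -eF0; apply: szX.
  rewrite -G0' /G' h0s; apply: szX => //.
- move=> m mD; rewrite hconv -fgQ // /conv rmorph_sum /=.
  by apply: eq_bigr => j _; rewrite rmorphM.
rewrite sF' sG' => f'0 g'0; move: ca; rewrite /c; case: ifP => _.
  by have := congr1 (fun q : {poly k} => q`_(size (f l)).-1) f'0; rewrite coef_map coef0 -lead_coefE /= => ->; rewrite eqxx.
by have := congr1 (fun q : {poly k} => q`_(size (g l)).-1) g'0; rewrite coef_map coef0 -lead_coefE /= => ->; rewrite eqxx.
Qed.

Let line_sub0 a : map_poly (horner_eval 0) (map_poly (line_sub a) P) = Pp.
Proof.
apply/polyP => j; rewrite !coef_map /= /horner_eval horner_coef0 -gsub_spec coef_map gsub0.
by rewrite /= mevalC.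
Qed.

Let prod_mask (m : bitseq) (s : seq k) : size m = size s ->
  \prod_(r <- s) ('X - r%:P) =
  \prod_(r <- mask m s) ('X - r%:P) * \prod_(r <- mask (map negb m) s) ('X - r%:P).
Proof.
elim: s m => [|r s IH] [|b m] //=; first by rewrite big_nil mulr1.
by move=> [/IH e]; case: b; rewrite !big_cons e; ring.
Qed.

(** At tau = 0 a factorization along the line becomes one of P(p, T), whose monic divisors are the
    finitely many subproducts of its linear factors, indexed by masks. The product of their
    exceptional polynomials [dlt] serves all of them; it is 1 when one of the two parts is
    constant. *)
Theorem bertini : exists2 dlt : C, dlt != 0 & forall a, dlt.@[a] != 0 ->
  monic_irreducible (map_poly (line_sub a) P).
Proof.
have [rs ers] : exists rs, Pp = \prod_(r <- rs) ('X - r%:P).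
  have [rs e] := closed_field_poly_normal Pp; exists rs.
  by rewrite e (monicP Ppm) scale1r.
pose prd (s : seq k) := \prod_(r <- s) ('X - r%:P).
have prdm s : prd s \is monic by apply: monic_prod_XsubC.
have ex (m : (size rs).-tuple bool) : exists dlt : C, dlt != 0 /\ forall a, dlt.@[a] != 0 ->
    forall F G : {poly {poly k}}, F \is monic -> G \is monic ->
      map_poly (line_sub a) P = F * G -> map_poly (horner_eval 0) F = prd (mask m rs) ->
      F = 1 \/ G = 1.
  have szF a (F : {poly {poly k}}) : F \is monic -> size F = size (map_poly (horner_eval a) F).
    by move=> Fm; rewrite size_map_poly_id0 // (monicP Fm) rmorph1 oner_eq0.
  have [F0|sF] := leqP (size (prd (mask m rs))) 1.
    exists 1; split=> [|a _ F G Fm Gm _ e]; first exact: oner_neq0.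
    by left; apply: monic_size1 => //; rewrite (szF 0) // e.
  have eP : Pp = prd (mask m rs) * prd (mask (map negb m) rs).
    rewrite ers; apply: prod_mask; exact: size_tuple.
  have hG a F G : map_poly (line_sub a) P = F * G ->
      map_poly (horner_eval 0) F = prd (mask m rs) ->
      map_poly (horner_eval 0) G = prd (mask (map negb m) rs).
    move=> /(congr1 (map_poly (horner_eval 0))); rewrite line_sub0 rmorphM /= eP => e eF.
    by move: e; rewrite eF => /(mulfI (monic_neq0 (prdm _)))->.
  have [G0|sG] := leqP (size (prd (mask (map negb m) rs))) 1.
    exists 1; split=> [|a _ F G Fm Gm e eF]; first exact: oner_neq0.
    by right; apply: monic_size1 => //; rewrite (szF 0) // (hG a F G).
  have [dlt dlt0 h] := bertini_factor (prdm _) (prdm _) sF sG eP.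
  by exists dlt; split=> // a ha F G Fm Gm e eF; case: (h a ha F G Fm Gm e eF).
have [dlt hdlt] := choice ex.
exists (\prod_m dlt m); first by apply/prodf_neq0 => m _; have [] := hdlt m.
move=> a; rewrite rmorph_prod => /prodf_neq0 ha F G Fm Gm e.
have : map_poly (horner_eval 0) F %| prd rs.
  by rewrite /prd -ers -(line_sub0 a) e rmorphM dvdp_mulr.
move=> /dvdp_prod_XsubC[m em].
have /subseqP[m' /eqP sm' em'] := mask_subseq m rs.
have [_ h] := hdlt (Tuple sm'); apply: (h a (ha _ isT)) => //=.
rewrite -em'; apply/eqP; rewrite -eqp_monic ?prdm //.
exact: (monic_map (horner_eval 0) Fm).
Qed.
End Bertini.

Lemma pred_add_absurd x y z : (x <= 1)%N -> (y < z)%N -> z = (x + y).-1 -> False.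
Proof. lia. Qed.

(** * Gauss's lemma for monic irreducible polynomials over k[X] *)

Section Gauss.
Variable k : closedFieldType.
Implicit Types (c : {poly k}) (p q g : {poly {poly k}}).

Lemma map_horner_eq0 (x : k) q : map_poly (horner_eval x) q = 0 ->
  exists q', q = ('X - x%:P) *: q'.
Proof.
move=> q0; exists (map_poly (fun c => c %/ ('X - x%:P)) q).
apply/polyP => i; rewrite coefZ coef_map_id0 ?div0p // mulrC divpK // dvdp_XsubCl.
by apply/eqP; have /polyP/(_ i) := q0; rewrite coef_map coef0.
Qed.

(** Induction on the size of c. At a root x of c the product q * g vanishes modulo X - x, hence so
    does one of the factors, and X - x cancels. Once c is a unit, division by the leading
    coefficients gives a monic factorization of p. *)
Lemma monic_irreducible_Gauss p c q g : p \is monic -> monic_irreducible p ->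
  c != 0 -> c *: p = q * g -> (size q <= 1)%N || (size g <= 1)%N.
Proof.
move=> pm pirr; have [n] := ubnP (size c); elim: n c q g => // n IH c q g cn c0 e.
have [c1|c1] := leqP (size c) 1.
  have lc : lead_coef q * lead_coef g = c.
    by rewrite -lead_coefM -e lead_coefZ (monicP pm) mulr1.
  have [lq lg] : lead_coef q \is a GRing.unit /\ lead_coef g \is a GRing.unit.
    apply/andP; rewrite -unitrM lc poly_unitE (size1_polyC c1) coefC eqxx unitfE.
    have c00 : c`_0 != 0 by apply: contra_neq c0 => h; rewrite (size1_polyC c1) h.
    by rewrite size_polyC c00.
  have un (u : {poly {poly k}}) : lead_coef u \is a GRing.unit ->
      (lead_coef u)^-1 *: u \is monic.
    by move=> uu; rewrite monicE lead_coefZ mulVr.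
  have sz (u : {poly {poly k}}) : lead_coef u \is a GRing.unit ->
      size ((lead_coef u)^-1 *: u) = size u.
    by move=> uu; rewrite size_scale // invr_eq0; apply: contraTneq uu => ->; rewrite unitr0.
  have [||] := pirr _ _ (un _ lq) (un _ lg).
  - rewrite -scalerAl -scalerAr -e !scalerA -lc -[LHS]scale1r; congr (_ *: _).
    by rewrite mulrC mulrACA mulrV // mulrV // mulr1.
  - by move=> eq1; rewrite -(sz q lq) eq1 size_poly1.
  - by move=> eq1; rewrite -(sz g lg) eq1 size_poly1 orbT.
have /closed_rootP[x rx] : size c != 1 by rewrite gtn_eqF.
have /factor_theorem[c' ec] := rx.
have c'0 : c' != 0 by apply: contra_neq c0; rewrite ec => ->; rewrite mul0r.
have c'n : (size c' < n)%N.
  move: cn; rewrite ec size_Mmonic ?monicXsubC // size_XsubC addn2 /=.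
  by [].
have X0 : 'X - x%:P != 0 :> {poly k} by rewrite polyXsubC_eq0.
have XI (u v : {poly {poly k}}) : ('X - x%:P) *: u = ('X - x%:P) *: v -> u = v.
  rewrite -!mul_polyC; apply: mulfI; by rewrite polyC_eq0.
have : map_poly (horner_eval x) q * map_poly (horner_eval x) g == 0.
  rewrite -rmorphM -e; apply/eqP/polyP => i; rewrite coef_map coefZ coef0 /=.
  by rewrite /horner_eval hornerM (rootP rx) mul0r.
rewrite mulf_eq0 => /orP[] /eqP/map_horner_eq0[u eu].
  have := IH c' u g c'n c'0; rewrite eu size_scale //; apply.
  apply: XI; rewrite scalerA mulrC -ec e eu -scalerAl //.
have := IH c' q u c'n c'0; rewrite eu size_scale //; apply.
by apply: XI; rewrite scalerA mulrC -ec e eu -scalerAr.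
Qed.

(** Divisibility here is up to nonzero factors in k[X]. If p and F were coprime, p would divide the
    smaller G. So their gcd has positive degree and divides some c *: p, and Gauss's lemma makes it
    as large as p, although it divides F. *)
Lemma monic_irreducible_prime p (F G Q : {poly {poly k}}) : p \is monic -> monic_irreducible p ->
    F != 0 -> G != 0 -> (size F < size p)%N -> (size G < size p)%N ->
  F * G = Q * p -> False.
Proof.
move=> pm pirr F0 G0 sF sG e.
have pFG : p %| F * G by rewrite e dvdp_mulIr.
have [cop|ncop] := boolP (coprimep p F).
  move: pFG; rewrite Gauss_dvdpr // => /(dvdp_leq G0).
  by rewrite leqNgt sG.
have p0 := monic_neq0 pm.
have g0 : gcdp p F != 0 by rewrite gcdp_eq0 negb_and p0.
have gp : (size (gcdp p F) < size p)%N.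
  by apply: leq_ltn_trans sF; apply: dvdp_leq => //; apply: dvdp_gcdr.
have /Pdiv.Idomain.dvdpP[[c q] /= c0 ecq] := dvdp_gcdl p F.
have := monic_irreducible_Gauss pm pirr c0 ecq.
have sg : (1 < size (gcdp p F))%N.
  move: ncop; rewrite coprimep_def => h.
  by rewrite ltn_neqAle eq_sym h size_poly_gt0.
rewrite [(size (gcdp _ _) <= 1)%N]leqNgt sg orbF => sq.
have q0 : q != 0.
  apply: contra_neq p0 => q0; move/eqP: ecq; rewrite q0 mul0r -mul_polyC mulf_eq0 polyC_eq0 (negPf c0).
  by move/eqP.
have := congr1 (fun u : {poly {poly k}} => size u) ecq; rewrite /= size_scale // size_mul // => es.
by have := pred_add_absurd sq gp es.
Qed.

End Gauss.

(** * Gradings and Noether normalization *)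

(* R as an A-module through f. *)
Definition restr_mod (A R : comNzRingType) (f : {rmorphism A -> R}) : Type := R.

Section RestrictScalars.
Variables (A R : comNzRingType) (f : {rmorphism A -> R}).
HB.instance Definition _ := GRing.Zmodule.on (restr_mod f).
Definition restr_scale (a : A) (x : restr_mod f) : restr_mod f := f a * (x : R).
Fact restr_scaleA a b x : restr_scale a (restr_scale b x) = restr_scale (a * b) x.
Proof. by rewrite /restr_scale rmorphM mulrA. Qed.
Fact restr_scale1 : left_id 1 restr_scale.
Proof. by move=> x; rewrite /restr_scale rmorph1 mul1r. Qed.
Fact restr_scaleDr : right_distributive restr_scale +%R.
Proof. by move=> a x y; rewrite /restr_scale mulrDr. Qed.
Fact restr_scaleDl (x : restr_mod f) : {morph restr_scale^~ x : a b / a + b}.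
Proof. by move=> a b; rewrite /restr_scale rmorphD mulrDl. Qed.
HB.instance Definition _ := GRing.Zmodule_isLmodule.Build A (restr_mod f)
  restr_scaleA restr_scale1 restr_scaleDr restr_scaleDl.
End RestrictScalars.

Section Evaluation.
Variables (k : fieldType) (R : comAlgType k) (N : nat).

Definition mev (y : 'I_N -> R) : {mpoly k[N]} -> R := mmap (in_alg R) y.
HB.instance Definition _ y := GRing.RMorphism.on (mev y).

Lemma mevC y c : mev y c%:MP = c%:A.
Proof. by rewrite /mev mmapC. Qed.

Lemma mevX y m : mev y 'X_[m] = \prod_(i < N) y i ^+ m i.
Proof. by rewrite /mev mmapX. Qed.

Lemma mevXU y i : mev y 'X_i = y i.
Proof. by rewrite /mev mmapX mmap1U. Qed.

Lemma mevZ y c p : mev y (c *: p) = c *: mev y p.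
Proof. by rewrite -mul_mpolyC rmorphM /= mevC mulr_algl. Qed.

End Evaluation.

Section Graded.
Variables (k : fieldType) (R : comAlgType k) (gR : grading R).
Local Notation "f \in_ i" := (f \in hpiece gR i) (at level 70).

Lemma hp0 i : 0 \in_ i.
Proof. exact: (hpiece_submod gR i).1. Qed.

Lemma hpZD i c f g : f \in_ i -> g \in_ i -> c *: f + g \in_ i.
Proof. exact: (hpiece_submod gR i).2. Qed.

Lemma hpD i f g : f \in_ i -> g \in_ i -> f + g \in_ i.
Proof. by move=> fi gi; rewrite -[f]scale1r; apply: hpZD. Qed.

Lemma hpZ i c f : f \in_ i -> c *: f \in_ i.
Proof. by move=> fi; rewrite -[_ *: _]addr0; apply: hpZD => //; apply: hp0. Qed.

Lemma hpN i f : f \in_ i -> - f \in_ i.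
Proof. by rewrite -scaleN1r; apply: hpZ. Qed.

Lemma hpB i f g : f \in_ i -> g \in_ i -> f - g \in_ i.
Proof. by move=> fi gi; apply: hpD => //; apply: hpN. Qed.

Lemma hp_sum i (I : Type) (r : seq I) (P : pred I) (F : I -> R) :
  (forall j, P j -> F j \in_ i) -> \sum_(j <- r | P j) F j \in_ i.
Proof. by move=> h; elim/big_ind: _ => //; [apply: hp0 | move=> x y; apply: hpD]. Qed.

(** A [grading] does not postulate that [hcomp] is linear. Directness of the sum makes components
    unique, and additivity follows. *)
Lemma hcomp_unique n (g : nat -> R) : (forall i, g i \in_ i) ->
    (forall i, (n <= i)%N -> g i = 0) ->
  forall i, hcomp gR i (\sum_(j < n) g j) = g i.
Proof.
move=> gi gn i; set f := \sum_(j < n) _; have [m [fm fE]] := hcomp_sum gR f.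
pose h j := hcomp gR j f - g j; pose M := (maxn n m + i.+1)%N.
have wid (u : nat -> R) l : (l <= M)%N -> (forall j, (l <= j)%N -> u j = 0) ->
    \sum_(j < M) u j = \sum_(j < l) u j.
  move=> lM u0; rewrite -(subnKC lM) big_split_ord /= [X in _ + X]big1 ?addr0 // => j _.
  by rewrite u0 // leq_addr.
apply/eqP; rewrite -subr_eq0; apply/eqP.
apply: (@hpiece_direct _ _ gR M h) => [j||]; last by rewrite /M addnS ltnS leq_addl.
  by apply: hpB; [apply: hcomp_piece | apply: gi].
rewrite sumrB (wid (fun j => hcomp gR j f) m) // ?(wid g n) // -?fE ?subrr //.
  by rewrite /M (leq_trans (leq_maxl n m)) // leq_addr.
by rewrite /M (leq_trans (leq_maxr n m)) // leq_addr.
Qed.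

Lemma hcompE i j f : f \in_ i -> hcomp gR j f = if j == i then f else 0.
Proof.
move=> fi; pose g l := if l == i then f else 0.
have {1}-> : f = \sum_(l < i.+1) g l.
  rewrite (bigD1 ord_max) //= /g eqxx big1 ?addr0 // => l; rewrite -val_eqE /= => /negPf->.
  by [].
rewrite hcomp_unique // => l; last by rewrite /g => il; rewrite gtn_eqF.
by rewrite /g; case: eqP => [->|] // _; apply: hp0.
Qed.

Lemma hcomp_id i f : f \in_ i -> hcomp gR i f = f.
Proof. by move=> /hcompE->; rewrite eqxx. Qed.

Lemma hcompD i f g : hcomp gR i (f + g) = hcomp gR i f + hcomp gR i g.
Proof.
have [n [fn fE]] := hcomp_sum gR f; have [m [gm gE]] := hcomp_sum gR g.
pose u j := hcomp gR j f + hcomp gR j g.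
have wid (h : nat -> R) l M : (l <= M)%N -> (forall j, (l <= j)%N -> h j = 0) ->
    \sum_(j < l) h j = \sum_(j < M) h j.
  move=> lM h0; rewrite -(subnKC lM) big_split_ord /= [X in _ = _ + X]big1 ?addr0 // => j _.
  by rewrite h0 // leq_addr.
have -> : f + g = \sum_(j < maxn n m) u j.
  rewrite [in LHS]fE [in LHS]gE (wid (fun j => hcomp gR j f) n (maxn n m)) ?leq_maxl //.
  by rewrite (wid (fun j => hcomp gR j g) m (maxn n m)) ?leq_maxr // -big_split.
rewrite hcomp_unique // => j; first by apply: hpD; apply: hcomp_piece.
by rewrite geq_max => /andP[nj mj]; rewrite /u fn // gm // addr0.
Qed.

Lemma hcomp0 i : hcomp gR i 0 = 0.
Proof. by rewrite (hcompE i (hp0 0)); case: ifP. Qed.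

Lemma hcomp_sumE i (I : Type) (r : seq I) (P : pred I) (F : I -> R) :
  hcomp gR i (\sum_(j <- r | P j) F j) = \sum_(j <- r | P j) hcomp gR i (F j).
Proof. by elim/big_rec2: _ => [|j u v _ <-]; rewrite ?hcomp0 ?hcompD. Qed.

Lemma hcomp_total f : exists2 n, (forall i, (n <= i)%N -> hcomp gR i f = 0) &
  f = \sum_(i < n) hcomp gR i f.
Proof. by have [n [? ?]] := hcomp_sum gR f; exists n. Qed.

Lemma hcomp_eq0 f : (forall i, hcomp gR i f = 0) -> f = 0.
Proof. by move=> h; have [n [_ ->]] := hcomp_sum gR f; rewrite big1. Qed.

Lemma hcompM i j f g : f \in_ i -> hcomp gR (i + j) (f * g) = f * hcomp gR j g.
Proof.
move=> fi; have [n gn gE] := hcomp_total g.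
have sum1 (h : R) : (\sum_(l < n) if l == j :> nat then h else 0) = if (j < n)%N then h else 0.
  case: ltnP => jn.
    by rewrite (bigD1 (Ordinal jn)) //= eqxx big1 ?addr0 // => l; rewrite -val_eqE => /negPf->.
  by rewrite big1 // => l _; rewrite ltn_eqF // (leq_trans _ jn).
rewrite [in LHS]gE mulr_sumr hcomp_sumE.
transitivity (\sum_(l < n) if l == j :> nat then f * hcomp gR j g else 0).
  apply: eq_bigr => l _; rewrite (hcompE _ (hpieceM fi (hcomp_piece gR l g))) eqn_add2l eq_sym.
  by case: eqP => // ->.
by rewrite sum1; case: ltnP => // /gn->; rewrite mulr0.
Qed.

Lemma hcompM_lt i j f g : f \in_ i -> (j < i)%N -> hcomp gR j (f * g) = 0.
Proof.
move=> fi ji; have [n _ ->] := hcomp_total g.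
rewrite mulr_sumr hcomp_sumE big1 // => l _.
by rewrite (hcompE _ (hpieceM fi (hcomp_piece gR l g))) ltn_eqF // ltn_addr.
Qed.

Hypothesis h1 : 1 \in_ 0%N.

Lemma hpX i f n : f \in_ i -> f ^+ n \in_ (i * n)%N.
Proof.
move=> fi; elim: n => [|n IH]; first by rewrite expr0 muln0.
by rewrite exprS mulnS; apply: hpieceM.
Qed.

Lemma hp_prod (I : Type) (r : seq I) (F : I -> R) (e : I -> nat) :
  (forall j, F j \in_ e j) -> \prod_(j <- r) F j \in_ (\sum_(j <- r) e j)%N.
Proof. by move=> h; elim/big_rec2: _ => // j u v _ uv; apply: hpieceM. Qed.

Section Eval.
Variables (N M : nat) (y : 'I_N -> R).
Hypothesis hy : forall i, y i \in_ M.

Lemma mevX_piece m : mev y 'X_[m] \in_ (M * mdeg m)%N.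
Proof.
rewrite mevX mdegE big_distrr /=; apply: hp_prod => i; exact: hpX.
Qed.

Lemma mev_piece j (p : {mpoly k[N]}) : p \is j.-homog -> mev y p \in_ (M * j)%N.
Proof.
move=> /dhomogP hp; rewrite (mpolyE p) rmorph_sum big_seq; apply: hp_sum => m /hp <-.
by rewrite /= mevZ; apply: hpZ; apply: mevX_piece.
Qed.

Lemma hcomp_mev j p : (0 < M)%N -> hcomp gR (M * j) (mev y p) = mev y (pihomog mdeg j p).
Proof.
move=> M0; rewrite {1}(mpolyE p) rmorph_sum hcomp_sumE pihomogE rmorph_sum /= [RHS]big_mkcond.
apply: eq_bigr => m _ /=; rewrite mevZ (hcompE _ (hpZ _ (mevX_piece m))) eqn_mul2l eqn0Ngt M0 /=.
by rewrite eq_sym; case: ifP => //; rewrite mevZ.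
Qed.

End Eval.
End Graded.

(** * Noether normalization with all variables in one degree *)

Section Normalization.
Variables (k : closedFieldType) (R : comAlgType k) (gR : grading R).
Local Notation "f \in_ i" := (f \in hpiece gR i) (at level 70).

Definition rspan N (y : 'I_N -> R) (s : seq R) (f : R) :=
  lspan (V := restr_mod (mev y)) (fun w => w \in s) f.

Definition finite_over N (y : 'I_N -> R) := exists2 s : seq R,
  (forall w, w \in s -> exists i, w \in_ i) & (forall f, rspan y s f).

Definition alg_indep N (y : 'I_N -> R) := forall p, mev y p = 0 -> p = 0.

Lemma rspanM N (y : 'I_N -> R) s p f : rspan y s f -> rspan y s (mev y p * f).
Proof. exact: (@lspanZ _ (restr_mod (mev y))). Qed.

Lemma rspanD N (y : 'I_N -> R) s f g : rspan y s f -> rspan y s g -> rspan y s (f + g).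
Proof. exact: (@lspanD _ (restr_mod (mev y))). Qed.

Lemma rspan_sum N (y : 'I_N -> R) s (I : Type) (r : seq I) (P : pred I) (F : I -> R) :
  (forall i, P i -> rspan y s (F i)) -> rspan y s (\sum_(i <- r | P i) F i).
Proof. exact: (@lspan_sum _ (restr_mod (mev y))). Qed.

Lemma rspan_in N (y : 'I_N -> R) (s : seq R) f : f \in s -> rspan y s f.
Proof. by move=> fs; apply: (@lspan_in _ (restr_mod (mev y))). Qed.

Hypothesis hfg : finitely_generated_algebra R.
Hypothesis hR0 : forall f : R, f \in_ 0%N <-> exists c : k, f = c%:A.

Let h1 : 1 \in_ 0%N.
Proof. by apply/hR0; exists 1; rewrite scale1r. Qed.

(** Components of generators generate as well; those of degree 0 are constants by [hR0], so only the
    positive degrees are listed. *)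
Lemma homogeneous_generators : exists (s : nat) (g : 'I_s -> R) (e : 'I_s -> nat),
  [/\ forall i, g i \in_ e i, forall i, (0 < e i)%N & forall f, exists p, f = mev g p].
Proof.
have [S [/finite_seqP[L SL] gen]] := hfg.
have [n hn] : exists n, forall f, f \in L -> forall i, (n <= i)%N -> hcomp gR i f = 0.
  elim: L {SL} => [|f L [n hn]]; first by exists 0%N.
  have [m fm _] := hcomp_total gR f; exists (maxn m n) => g.
  rewrite inE => /orP[/eqP->|gL] i; rewrite geq_max => /andP[mi ni]; first exact: fm.
  exact: hn.
pose G := [seq hcomp gR i.+1 f | f <- L, i <- iota 0 n].
have Ghom (j : 'I_(size G)) : exists e, (0 < e)%N /\ G`_j \in_ e.
  have /allpairsP[[f i] /= [_ _ ->]] := mem_nth 0 (ltn_ord j).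
  by exists i.+1; split=> //; apply: hcomp_piece.
have [e he] := choice Ghom.
exists (size G), (fun j => G`_j), e; split=> [j|j|f]; try by case: (he j).
pose U : {pred R} := fun f => `[< exists p, f = mev (fun j : 'I_(size G) => G`_j) p >].
have UP u : (u \in U) <-> exists p, u = mev (fun j : 'I_(size G) => G`_j) p.
  by split=> [/asboolP|/asboolP].
have Ucl : GRing.subalg_closed U.
  split; first by apply/UP; exists 1; rewrite rmorph1.
    move=> a u v /UP[p ->] /UP[q ->]; apply/UP; exists (a *: p + q).
    by rewrite rmorphD /= mevZ.
  by move=> u v /UP[p ->] /UP[q ->]; apply/UP; exists (p * q); rewrite rmorphM.
suff /(gen U Ucl)/(_ f)/UP : forall x, S x -> x \in U by [].
move=> x Sx; have xL : x \in L by move: Sx; rewrite SL.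
have [m xm xE] := hcomp_total gR x.
have Ucomp i : hcomp gR i x \in U.
  case: i => [|i].
    have /hR0[c ->] := hcomp_piece gR 0 x.
    by apply/UP; exists c%:MP; rewrite mevC.
  have [ni|iN] := leqP n i.+1.
    by rewrite hn //; apply/UP; exists 0; rewrite rmorph0.
  have jG : hcomp gR i.+1 x \in G.
    apply/allpairsP; exists (x, i); split=> //=; first by rewrite mem_iota add0n; apply: ltnW.
  apply/UP; exists 'X_(Ordinal (etrans (index_mem _ _) jG)).
  by rewrite mevXU /= nth_index.
rewrite xE; apply/UP.
elim: m {xm xE} => [|m [p ep]]; first by exists 0; rewrite big_ord0 rmorph0.
have /UP[q eq] := Ucomp m.
by exists (p + q); rewrite big_ord_recr /= ep eq rmorphD.
Qed.

(** Powers bring the generators to a common degree M, the product of their degrees. Dividing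
    exponents by the [b i] with remainder leaves finitely many monomials in g, of total degree below
    K. *)
Lemma finite_over_powers : exists (N M : nat) (y : 'I_N -> R),
  [/\ (0 < M)%N, forall i, y i \in_ M & finite_over y].
Proof.
have [N [g [e [ge e0 gen]]]] := homogeneous_generators.
pose M := (\prod_i e i)%N; pose b i := (M %/ e i)%N.
have eM i : (e i %| M)%N by rewrite /M (bigD1 i) //= dvdn_mulr.
have M0 : (0 < M)%N by apply: prodn_gt0.
have b0 i : (0 < b i)%N by rewrite divn_gt0 // dvdn_leq.
pose y i := g i ^+ b i.
exists N, M, y; split=> // [i|].
  by rewrite -(divnK (eM i)) mulnC; apply: (hpX h1).
pose K := (\sum_i b i).+1.
exists [seq mev g 'X_[m] | m : 'X_{1..N < K}] => [w /mapP[m _ ->]|f].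
  by rewrite mevX; exists (\sum_i e i * m i)%N; apply: (hp_prod h1) => i; apply: (hpX h1).
have [p ->] := gen f; rewrite (mpolyE p) rmorph_sum; apply: rspan_sum => m _ /=.
pose q : 'X_{1..N} := [multinom (m i %/ b i)%N | i < N].
pose r : 'X_{1..N} := [multinom (m i %% b i)%N | i < N].
have rK : (mdeg r < K)%N.
  rewrite /K ltnS mdegE leq_sum // => i _; rewrite mnmE ltnW //; exact: ltn_pmod.
have -> : mev g (p@_m *: 'X_[m]) = mev y (p@_m *: 'X_[q]) * mev g 'X_[r].
  rewrite !mevZ -scalerAl; congr (_ *: _); rewrite !mevX -big_split /=.
  by apply: eq_bigr => i _; rewrite !mnmE /y -exprM -exprD mulnC -divn_eq.
apply/rspanM/rspan_in/mapP; exists (BMultinom rK) => //.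
by rewrite mem_enum.
Qed.

Section Step.
Variables (n M : nat) (y : 'I_n.+1 -> R).
Hypotheses (hy : forall i, y i \in_ M) (fy : finite_over y).
Variables (j : nat) (p : {mpoly k[n.+1]}).
Hypotheses (pj : p \is j.-homog) (py : mev y p = 0).
Variable c : 'I_n.+1 -> k.
Hypotheses (pc : p.@[c] != 0) (cmax : c ord_max != 0).
Local Notation wid i := (widen_ord (leqnSn n) i).
Local Notation B := {mpoly k[n]}.

(** The new coordinates satisfy y_i = y'_i + c_i Y with y'_i = 0 for the last index, which is solved
    for Y. Being linear in y, they keep the degree M. *)
Let Y : R := (c ord_max)^-1 *: y ord_max.
Let y' (i : 'I_n) : R := y (wid i) - c (wid i) *: Y.

Let pt (i : 'I_n.+1) : {poly B} :=
  (if unlift ord_max i is Some l then 'X_l else 0)%:P + (c i)%:MP%:P * 'X.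
Let rho : {rmorphism {mpoly k[n.+1]} -> {poly B}} := mmap (polyC \o @mpolyC n k) pt.

Fact eval_comm : commr_rmorph (mev y') Y. Proof. by move=> b; apply: mulrC. Qed.
Let E : {rmorphism {poly B} -> R} := horner_morph eval_comm.

Let E_rho a : E (rho a) = mev y a.
Proof.
have := @mpoly_hom_ext _ _ _ (E \o rho) (mev y).
move=> h; apply: (h _ _ a) => {h} [d|i] /=.
  by rewrite mmapC /= horner_morphC /= !mevC.
rewrite mmapX mmap1U mevXU /pt rmorphD rmorphM /= !horner_morphC horner_morphX /= mevC mulr_algl.
case: unliftP => [l ->|->]; last first.
  by rewrite rmorph0 add0r /Y scalerA mulfV // scale1r.
have -> : lift ord_max l = wid l by apply: val_inj; rewrite /= /bump leqNgt ltn_ord add0n.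
by rewrite /= mevXU /y' subrK.
Qed.

Let E_coef F : E F = \sum_(i < size F) mev y' F`_i * Y ^+ i.
Proof.
rewrite /E /= /horner_morph horner_poly.
by apply: eq_bigr.
Qed.

(** A formal degree: a may be 0, so sums and products of formal leading terms need no case
    distinction. *)
Let topc d (a : k) (u : {poly B}) := (size u <= d.+1)%N /\ u`_d = a%:MP.

Let topcM d d' a a' u u' : topc d a u -> topc d' a' u' -> topc (d + d') (a * a') (u * u').
Proof.
move=> [s e] [s' e']; split.
  by apply: leq_trans (size_polyMleq _ _) _; move: (size u) (size u') s s' => m m'; lia.
rewrite coefM (bigD1 (inord d)) //= inordK ?ltnS ?leq_addr // addKn e e' mpolyCM big1 ?addr0 //.
move=> i; rewrite -val_eqE /= inordK ?ltnS ?leq_addr // => id.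
have [di|di] := leqP i d.
  rewrite [u'`__]nth_default ?mulr0 //; apply: leq_trans s' _.
  by move: (val i) id di => m; lia.
by rewrite nth_default ?mul0r // (leq_trans s).
Qed.

Let topc_pt i : topc 1 (c i) (pt i).
Proof.
split; last by rewrite coefD coefC coefCM coefX mulr1 add0r.
apply: leq_trans (size_polyD _ _) _; rewrite geq_max (leq_trans (size_polyC_leq1 _)) //=.
apply: leq_trans (size_polyMleq _ _) _; rewrite size_polyX addn2 /=.
by rewrite ltnS size_polyC_leq1.
Qed.

Let topc_rho : topc j p.@[c] (rho p).
Proof.
have mon m : topc (mdeg m) (\prod_i c i ^+ m i) (\prod_i pt i ^+ m i).
  rewrite mdegE; elim/big_rec3: _ => [|i u a d _ h].
    by split; [rewrite size_poly1 | rewrite coef1].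
  apply: topcM h; elim: (m i) => [|e IH]; first by split; [rewrite size_poly1 | rewrite coef1].
  by rewrite !exprS; apply: (@topcM 1 e) (topc_pt i) _.
rewrite mevalE /rho /= /mmap; have : {subset msupp p <= msupp p} by [].
elim: {1 3 4}(msupp p) => [|m s IH] hs.
  by rewrite !big_nil; split; [rewrite size_poly0 | rewrite coef0 mpolyC0].
rewrite !big_cons; have [|s1 e1] := IH; first by move=> l ls; apply: hs; rewrite inE ls orbT.
have := mon m; rewrite (dhomogP _ _ _ pj m (hs _ (mem_head _ _))) => -[s2 e2].
split; last by rewrite coefD e1 /= coefCM e2 mpolyCD mpolyCM.
apply: leq_trans (size_polyD _ _) _; rewrite geq_max s1 andbT /=.
by rewrite mul_polyC (leq_trans (size_scale_leq _ _)).
Qed.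

(** In the new coordinates the homogeneous relation p becomes a polynomial of degree j in Y with the
    constant p(c) as leading coefficient. Hence Y is integral over the y', and the old generators
    times the powers of Y below j generate. *)
Lemma normalization_step : exists2 y' : 'I_n -> R,
  (forall i, y' i \in_ M) & finite_over y'.
Proof.
have YM : Y \in_ M by apply: hpZ.
exists y' => [i|]; first by apply: hpB => //; apply: hpZ.
pose q := (p.@[c])^-1%:MP *: rho p.
have [sq cq] := topc_rho.
have qj : q`_j = 1 by rewrite coefZ cq -mpolyCM mulVf.
have szq : size q = j.+1.
  apply/eqP; rewrite eqn_leq (leq_trans (size_scale_leq _ _)) //=.
  by rewrite ltnNge; apply/negP => /leq_sizeP/(_ j (leqnn _))/eqP; rewrite qj oner_eq0.
have qm : q \is monic by rewrite monicE lead_coefE szq qj.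
have Eq : E q = 0 by rewrite /q -mul_polyC rmorphM /= E_rho py mulr0.
have [s hs fs] := fy.
exists [seq Y ^+ i * w | i <- iota 0 j, w <- s] => [w|f].
  move=> /allpairsP[[i u] /= [_ us ->]]; have [l ul] := hs u us.
  by exists (M * i + l)%N; apply: hpieceM => //; apply: (hpX h1).
have : rspan y s f by [].
elim=> [|a w g ws _ IH]; first exact: (@lspan0 _ (restr_mod (mev y'))).
apply: rspanD IH; rewrite -[a *: w]/(mev y a * (w : R)) -E_rho.
rewrite (Pdiv.RingMonic.rdivp_eq qm (rho a)) rmorphD rmorphM Eq mulr0 add0r E_coef mulr_suml.
apply: rspan_sum => i _; rewrite -mulrA; apply/rspanM/rspan_in.
apply/allpairsP; exists (val i, w); split=> //=.
rewrite mem_iota add0n /=; apply: leq_trans (ltn_ord i) _.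
by rewrite -ltnS -szq Pdiv.Ring.ltn_rmodpN0 // monic_neq0.
Qed.

End Step.

Lemma noether_normalization : exists (N M : nat) (y : 'I_N -> R),
  [/\ (0 < M)%N, forall i, y i \in_ M, finite_over y & alg_indep y].
Proof.
have [N [M [y [M0 hy fy]]]] := finite_over_powers.
elim: N y hy fy => [|n IH] y hy fy.
  exists 0%N, M, y; split=> // p; rewrite (nvar0_mpolyC p) mevC => /eqP.
  by rewrite scaler_eq0 oner_eq0 orbF => /eqP->; rewrite mpolyC0.
have [|] := pselect (alg_indep y); first by exists n.+1, M, y.
move=> nind; have [q [qy q0]] : exists q, mev y q = 0 /\ q != 0.
  by apply: contrapT => h; apply: nind => q qy; apply: contrapT => /eqP q0; apply: h; exists q.
have [j pj0] : exists j, pihomog mdeg j q != 0.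
  apply: contrapT => h; move/eqP: q0; apply.
  rewrite (pihomog_partitionE (leqnn (mmeasure mdeg q))) big1 // => j _.
  by apply: contrapT => /eqP hj; apply: h; exists (val j).
(* All y lie in the same degree, so homogeneous components of relations are relations. *)
have py : mev y (pihomog mdeg j q) = 0 by rewrite -(hcomp_mev h1 hy) // qy hcomp0.
(* The extra factor makes the last coordinate of c nonzero, so that one can solve for Y. *)
have [c] : exists c, (pihomog mdeg j q * 'X_ord_max).@[c] != 0.
  apply: mpoly_nonroot; rewrite mulf_neq0 //.
  by apply/eqP => /mpolyP/(_ U_(ord_max)%MM)/eqP; rewrite mcoeffX eqxx mcoeff0 oner_eq0.
rewrite mevalM mevalXU mulf_eq0 negb_or => /andP[pc cm].
have [y' hy' fy'] := normalization_step hy fy (pihomogP _ _ _) py pc cm.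
exact: IH hy' fy'.
Qed.

End Normalization.

(** * Krull dimension *)

Section PrimeIdeals.
Variable R : comNzRingType.

Definition ideal_pred (I : R -> Prop) := I 0 /\ forall a x y, I x -> I y -> I (a * x + y).

Definition prime_pred (I : R -> Prop) :=
  [/\ ideal_pred I, ~ I 1 & forall x y, I (x * y) -> I x \/ I y].

Lemma ideal_predM I a x : ideal_pred I -> I x -> I (a * x).
Proof. by move=> [I0 IZ] Ix; rewrite -[_ * _]addr0; apply: IZ. Qed.

Lemma ideal_predD I x y : ideal_pred I -> I x -> I y -> I (x + y).
Proof. by move=> [I0 IZ] Ix Iy; rewrite -[x]mul1r; apply: IZ. Qed.

Lemma ideal_predB I x y : ideal_pred I -> I x -> I y -> I (x - y).
Proof. by move=> hI Ix Iy; apply: ideal_predD => //; rewrite -mulN1r; apply: ideal_predM. Qed.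

Lemma prime_predX I x n : prime_pred I -> I (x ^+ n) -> I x.
Proof.
move=> [hI I1 Ip]; elim: n => [|n IH]; first by rewrite expr0 => /I1.
by rewrite exprS => /Ip[].
Qed.

Lemma prime_pred_ideal I : prime_pred I ->
  exists P : prime_idealr R, forall x, (x \in P) <-> I x.
Proof.
move=> [[I0 IZ] I1 Ip]; pose S : R -> bool := fun x => `[< I x >].
have SE x : (x \in S) <-> I x by split=> [/asboolP|/asboolP].
have Sid : idealr_closed S.
  split; [exact/SE | by apply/negP => /SE |].
  by move=> a x y /SE Ix /SE Iy; apply/SE/IZ.
have Spr : prime_idealr_closed S.
  by move=> x y /SE/Ip[] h; apply/orP; [left | right]; apply/SE.
pose S1 : idealr R := HB.pack S (isIdealr.Build R S Sid).
pose S2 : prime_idealr R := HB.pack S (isIdealr.Build R S Sid) (isPrimeIdealrClosed.Build R S Spr).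
by exists S2.
Qed.

(* Krull: an ideal maximal among those disjoint from a multiplicative set is prime. *)
Lemma prime_avoiding (I S : R -> Prop) : ideal_pred I -> S 1 ->
    (forall x y, S x -> S y -> S (x * y)) -> (forall x, I x -> ~ S x) ->
  exists Q, [/\ prime_pred Q, forall x, I x -> Q x & forall x, Q x -> ~ S x].
Proof.
move=> hI S1 SM IS; pose gen (A : set R) := lspan (V := GRing.regular R) (fun x => A x \/ I x).
(* Zorn is applied to subsets that, together with I, generate an ideal avoiding S; a maximal one
   equals the ideal it generates. *)
pose P (A : set R) := forall x, gen A x -> ~ S x.
have [|A [PA Amax]] := @Zorn_bigcup R P.
- move=> F FP Ftot x.
  suff h : gen (\bigcup_(X in F) X)%classic x -> gen set0 x \/ exists2 X, F X & gen X x.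
    move=> /h[g0|[X FX gX]]; last exact: FP gX.
    apply: IS; elim: g0 => [|a y z [//|Iy] _ Iz]; first exact: hI.1.
    exact: hI.2.
  elim=> [|a y z yF _ IH]; first by left; apply: (@lspan0 R (GRing.regular R)).
  case: yF => [[X FX Xy]|Iy].
    case: IH => [h0|[X' FX' h']].
      right; exists X => //; apply: (@lspan_cons R (GRing.regular R)); first by left.
      by apply: lspan_sub h0 => u [//|]; right.
    have [XX'|X'X] := Ftot _ _ FX FX'.
      right; exists X' => //; apply: (@lspan_cons R (GRing.regular R)) => //.
      by left; apply: XX'.
    right; exists X => //; apply: (@lspan_cons R (GRing.regular R)); first by left.
    by apply: lspan_sub h' => u [/X'X|]; [left | right].
  case: IH => [h0|[X' FX' h']]; [left | right; exists X' => //];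
    by apply: (@lspan_cons R (GRing.regular R)) => //; right.
- have AA : gen A = A.
    apply/seteqP; split=> x; last by move=> Ax; apply: (@lspan_in R (GRing.regular R)); left.
    apply: contrapT => hx; apply: (Amax (gen A)).
      split; first by move=> y Ay; apply: (@lspan_in R (GRing.regular R)); left.
      by move=> h; apply: hx => gx; apply: h.
    move=> y gy; apply: PA; apply: lspan_trans gy => z [//|Iz].
    by apply: (@lspan_in R (GRing.regular R)); right.
  have IA x : I x -> A x by move=> Ix; rewrite -AA; apply: (@lspan_in R (GRing.regular R)); right.
  have idA : ideal_pred A.
    split; first exact/IA/hI.1.
    move=> a x y Ax Ay; rewrite -AA; apply: (@lspan_cons R (GRing.regular R)); first by left.
    by rewrite /gen in AA; rewrite -AA in Ay.
  have AS x : A x -> ~ S x by rewrite -AA; apply: PA.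
  exists A; split=> //; split=> //; first by move=> /AS.
  have ext x : ~ A x -> exists a r, A a /\ S (a + r * x).
    move=> nAx; apply: contrapT => h; apply: (Amax (fun y => A y \/ y = x)).
      split; first by move=> y; left.
      by move=> h'; apply: nAx; apply: h'; right.
    move=> y gy Sy; apply: h.
    suff [a [r [Aa ey]]] : exists a r, A a /\ y = a + r * x by exists a, r; rewrite -ey.
    elim: gy {Sy} => [|b u v uA _ [a [r [Aa ->]]]].
      by exists 0, 0; split; [apply: idA.1 | rewrite mul0r addr0].
    have h2 : A u -> exists a' r', A a' /\ b *: (u : GRing.regular R) + (a + r * x) = a' + r' * x.
      move=> Au; exists (b * u + a), r; split; first exact: idA.2.
      by rewrite addrA.
    case: uA => [[/h2//|->]|/IA/h2//].
    exists a, (b + r); split=> //; rewrite mulrDl addrCA; congr (_ + _).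
  move=> x y Axy; have [Ax|/ext[a [r [Aa Sx]]]] := pselect (A x); first by left.
  have [Ay|/ext[b [s [Ab Sy]]]] := pselect (A y); first by right.
  exfalso; apply: (AS _ _ (SM _ _ Sx Sy)).
  have -> : (a + r * x) * (b + s * y) = (b + s * y) * a + ((r * x) * b + (r * s) * (x * y)).
    ring.
  by apply: idA.2 => //; apply: idA.2 => //; apply: ideal_predM.
Qed.

End PrimeIdeals.

(* The chain step of going-up: an equation of integral dependence of r over B, multiplied by
   t ^+ n, shows that (Q, t) R does not meet the image of B \ J. *)
Lemma going_up_step (B R : comNzRingType) (f : {rmorphism B -> R}) (Q : R -> Prop)
    (J : B -> Prop) (t : B) :
    (forall r, exists2 g : {poly B}, g \is monic & (map_poly f g).[r] = 0) ->
    prime_pred Q -> prime_pred J -> (forall b, Q (f b) -> J b) -> J t ->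
    (forall b, J b -> exists c, Q (f (b - c * t))) ->
  exists Q', [/\ prime_pred Q', forall x, Q x -> Q' x & forall b, Q' (f b) <-> J b].
Proof.
move=> int [idQ Q1 Qp] [idJ J1 Jp] QJ Jt JQ.
pose I x := exists r, Q (x - f t * r).
have idI : ideal_pred I.
  split; first by exists 0; rewrite mulr0 subr0; apply: idQ.1.
  move=> a x y [r hr] [s hs]; exists (a * r + s).
  have -> : a * x + y - f t * (a * r + s) = a * (x - f t * r) + (y - f t * s) by ring.
  exact: idQ.2.
have [|||Q' [pQ' IQ' Q'S]] := @prime_avoiding _ I (fun x => exists2 b, ~ J b & x = f b) idI.
- by exists 1 => //; rewrite rmorph1.
- by move=> _ _ [b nb ->] [c nc ->]; exists (b * c); rewrite ?rmorphM // => /Jp[].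
- move=> x [r Qr] [u nu xu]; rewrite {x}xu in Qr; apply: nu.
  have [g gm gr] := int r; pose n := (size g).-1.
  have g0 : (0 < size g)%N by rewrite size_poly_gt0 monic_neq0.
  (* The homogenization t ^+ n * g(u / t). As f u is f t * r modulo Q, its image is f t ^+ n * g(r)
     = 0 modulo Q; modulo t it is u ^+ n. *)
  pose w := \sum_(i < size g) g`_i * t ^+ (n - i) * u ^+ i.
  have Qw : Q (f w).
    have e : f w - \sum_(i < size g) f g`_i * f t ^+ (n - i) * (f t * r) ^+ i = f w.
      rewrite -[RHS]subr0; congr (_ - _).
      transitivity (f t ^+ n * (map_poly f g).[r]); last by rewrite gr mulr0.
      rewrite (@horner_coef_wide _ (size g)) ?size_poly // mulr_sumr.
      apply: eq_bigr => i _; rewrite coef_map /= exprMn.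
      have -> : f t ^+ n = f t ^+ (n - i) * f t ^+ i.
        by rewrite -exprD subnK // -ltnS prednK.
      ring.
    rewrite -e /w rmorph_sum -sumrB; elim/big_ind: _ => //; first exact: idQ.1.
      by move=> x y; apply: ideal_predD.
    move=> i _; rewrite !rmorphM !rmorphXn /= -mulrBr subrXX mulrCA mulrC.
    exact: ideal_predM.
  have : J w by apply: QJ.
  rewrite /w -(prednK g0) big_ord_recr /= -/n subnn expr0 mulr1.
  rewrite -[g`_n]/(lead_coef g) (monicP gm) mul1r => Jw.
  apply: (@prime_predX _ J u n) => //.
  rewrite -[u ^+ n](addKr (\sum_(i < n) g`_i * t ^+ (n - i) * u ^+ i)) addrC.
  apply: ideal_predB => //; elim/big_ind: _ => //; first exact: idJ.1.
    by move=> x y; apply: ideal_predD.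
  move=> i _; have -> : (n - i)%N = (n - i).-1.+1 by rewrite prednK // subn_gt0.
  rewrite exprS; set a := g`_i; set b := t ^+ _; set c := u ^+ _.
  have -> : a * (t * b) * c = (a * b * c) * t by ring.
  exact: ideal_predM.
exists Q'; split=> // [x Qx|b].
  by apply: IQ'; exists 0; rewrite mulr0 subr0.
split=> [Qb|Jb].
  by apply: contrapT => nb; apply: (Q'S _ Qb); exists b.
have [c Qc] := JQ b Jb; apply: IQ'; exists (f c).
by rewrite -rmorphM -rmorphB mulrC.
Qed.

Lemma mpoly_ring_ind (n : nat) (R : nzRingType) (P : {mpoly R[n]} -> Prop) :
    (forall c, P c%:MP) -> (forall i, P 'X_i) -> (forall p q, P p -> P q -> P (p + q)) ->
    (forall p q, P p -> P q -> P (p * q)) ->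
  forall p, P p.
Proof.
move=> PC PX PD PM p; rewrite (mpolyE p).
have P0 : P 0 by rewrite -mpolyC0.
elim/big_ind: _ => // m _; rewrite -mul_mpolyC; apply: (PM) => //.
rewrite mpolyXE_id; elim/big_ind: _ => [|p' q' hp hq|i _]; first by rewrite -mpolyC1.
  exact: (PM).
by elim: (m i) => [|e IH]; rewrite ?expr0 -?mpolyC1 // exprS; apply: (PM).
Qed.

Section Dimension.
Variables (k : closedFieldType) (R : comAlgType k) (gR : grading R).
Hypothesis hdom : GRing.integral_domain_axiom R.
Variables (N : nat) (y : 'I_N -> R).
Hypotheses (fy : finite_over gR y).
Local Notation B := {mpoly k[N]}.

(** The determinant trick: for the matrix A of multiplication by r on the module generators, the
    determinant of r - A kills every generator, hence 1. *)
Lemma finite_over_integral (r : R) :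
  exists2 g : {poly B}, g \is monic & (map_poly (mev y) g).[r] = 0.
Proof.
have [s _ fs] := fy; pose q := size s.
have coef f : exists c : 'I_q -> B, f = \sum_i mev y (c i) * s`_i.
  have [c ->] := @lspan_seqP _ (restr_mod (mev y)) s f (fs f).
  by exists c; apply: eq_bigr.
have [C hC] := choice (fun i : 'I_q => coef (r * s`_i)).
pose A : 'M[B]_q := \matrix_(i, j) C i j.
exists (char_poly A); first exact: char_poly_monic.
pose A' := map_mx (mev y) A; pose w : 'cV[R]_q := \col_i s`_i.
have Aw : (r%:M - A') *m w = 0.
  apply/eqP; rewrite mulmxBl subr_eq0 mul_scalar_mx; apply/eqP/matrixP => i j.
  by rewrite !mxE hC; apply: eq_bigr => l _; rewrite !mxE.
have detE : (map_poly (mev y) (char_poly A)).[r] = \det (r%:M - A').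
  rewrite map_char_poly /char_poly -[LHS]/(horner_eval r _) -det_map_mx; congr (\det _).
  apply/matrixP => i j; rewrite !mxE -[LHS]/(('X *+ (i == j) - (mev y (C i j))%:P).[r]).
  by rewrite hornerD hornerN hornerMn hornerX hornerC.
have detw (i : 'I_q) : \det (r%:M - A') * s`_i = 0.
  have : \adj (r%:M - A') *m ((r%:M - A') *m w) = 0 by rewrite Aw mulmx0.
  rewrite mulmxA mul_adj_mx mul_scalar_mx => /matrixP/(_ i 0); rewrite !mxE.
  by [].
have [u eu] := coef 1.
rewrite detE -[LHS]mulr1 eu mulr_sumr big1 // => i _.
by rewrite mulrCA detw mulr0.
Qed.

Section Chain.
Hypothesis iy : alg_indep y.

(** Its kernel [J i] is the ideal of the first i variables, prime because the target is a domain. *)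
Let kill (i : nat) : {rmorphism B -> B} :=
  mmap (@mpolyC N k) (fun j : 'I_N => if (j < i)%N then 0 else 'X_j).

Let killX i j : kill i 'X_j = if (j < i)%N then 0 else 'X_j.
Proof. by rewrite /kill /= mmapX mmap1U. Qed.

Let killC i c : kill i c%:MP = c%:MP.
Proof. by rewrite /kill /= mmapC. Qed.

Let kill0 p : kill 0 p = p.
Proof.
have := @mpoly_hom_ext _ _ _ (kill 0) idfun; apply=> [c|j]; first by rewrite killC.
by rewrite killX.
Qed.

(** Modulo [J i] the ideal [J i.+1] is generated by X_i alone, which is what [going_up_step] asks of
    t. *)
Let killS (i : 'I_N) p : exists c, kill i (p - c * 'X_i) = kill i.+1 p.
Proof.
elim/mpoly_ring_ind: p => [d|j|p q [c hc] [d hd]|p q [c hc] [d hd]].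
- by exists 0; rewrite mul0r subr0 !killC.
- have [->|ji] := eqVneq j i.
    by exists 1; rewrite mul1r subrr rmorph0 killX ltnSn.
  by exists 0; rewrite mul0r subr0 !killX ltnS [(j <= i)%N]leq_eqVlt val_eqE (negPf ji).
- by exists (c + d); rewrite [RHS]rmorphD /= -hc -hd -[RHS]rmorphD; congr (kill i _); ring.
exists (c * q + p * d - c * d * 'X_i); rewrite [RHS]rmorphM /= -hc -hd -[RHS]rmorphM.
congr (kill i _); ring.
Qed.

Let killKS i p : kill i.+1 (kill i p) = kill i.+1 p.
Proof.
have := @mpoly_hom_ext _ _ _ (kill i.+1 \o kill i) (kill i.+1).
apply=> [c|j]; first by rewrite /= !killC.
rewrite /= killX; case: ltnP => ji; last by [].
by rewrite rmorph0 killX ltnS ltnW.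
Qed.

Let J i (b : B) := kill i b = 0.

Let prime_J i : prime_pred (J i).
Proof.
split; rewrite /J.
- split; first exact: rmorph0.
  by move=> a x z hx hz; rewrite rmorphD rmorphM /= hx hz mulr0 addr0.
- by rewrite rmorph1; apply/eqP; rewrite oner_eq0.
- by move=> x z /eqP; rewrite rmorphM mulf_eq0 => /orP[]/eqP; [left | right].
Qed.

(** Starts at the zero ideal, which contracts to zero by independence, and goes up one variable at a
    time. *)
Let chain i : (i <= N)%N -> exists P : nat -> R -> Prop,
  (forall j, (j <= i)%N -> prime_pred (P j) /\ forall b, P j (mev y b) <-> J j b) /\
  (forall j, (j < i)%N -> forall x, P j x -> P j.+1 x).
Proof.
elim: i => [|i IH] iN.
  exists (fun _ x => x = 0); split=> // j; rewrite leqn0 => /eqP->; split.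
    split; first by split=> // a x z -> ->; rewrite mulr0 addr0.
      by apply/eqP; rewrite oner_eq0.
    by move=> x z /hdom/orP[]/eqP; [left | right].
  by move=> b; rewrite /J kill0; split=> [/iy|->] //; rewrite rmorph0.
have [P [Pp Ps]] := IH (ltnW iN).
have [pP PJ] := Pp i (leqnn i).
have [|||Q [pQ PQ QJ]] := @going_up_step _ _ (mev y) (P i) (J i.+1) 'X_(Ordinal iN)
    finite_over_integral pP (prime_J _).
- by move=> b /PJ; rewrite /J => hb; rewrite -killKS hb rmorph0.
- by rewrite /J killX /= ltnSn.
- move=> b Jb; have [c hc] := killS (Ordinal iN) b; exists c; apply/PJ.
  by rewrite /J hc.
exists (fun j => if j == i.+1 then Q else P j); split=> j.
  rewrite leq_eqVlt; case: eqP => [->//|_] /=; rewrite ltnS; exact: Pp.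
rewrite ltnS leq_eqVlt => /orP[/eqP->|ji]; first by rewrite ltn_eqF // eqxx.
by rewrite ltn_eqF ?(ltn_trans ji) // eqSS ltn_eqF //; apply: Ps.
Qed.

Lemma prime_chain_of_indep : has_prime_chain R N.
Proof.
have [P [Pp Ps]] := chain (leqnn N).
have mono i j x : (i <= j)%N -> (j <= N)%N -> P i x -> P j x.
  move=> ij; rewrite -(subnKC ij); elim: (j - i)%N => [|l IH]; first by rewrite addn0.
  by rewrite addnS => ilN Px; apply: Ps => //; apply: IH => //; apply: ltnW.
have [Q hQ] := choice (fun i : 'I_N.+1 => prime_pred_ideal (Pp i (leq_ord i)).1).
exists Q => i j ij; split=> [x /hQ Px|QQ]; first by apply/hQ; apply: mono Px; rewrite ?leq_ord // ltnW.
have iN : (i < N)%N by apply: leq_trans ij _; rewrite -ltnS ltn_ord.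
have : mev y 'X_(Ordinal iN) \in Q j.
  by apply/hQ; apply/(Pp j (leq_ord j)).2; rewrite /J killX /= ij.
move=> /QQ/hQ/(Pp i (leq_ord i)).2; rewrite /J killX /= ltnn => /mpolyP/(_ U_(Ordinal iN)%MM)/eqP.
by rewrite mcoeffX eqxx mcoeff0 oner_eq0.
Qed.

End Chain.
End Dimension.

(** * An upper bound for the Krull dimension by counting monomials *)

Lemma linear_dependence (k : fieldType) (V : lmodType k) (I T : finType) (u : I -> V) (v : T -> V)
    (A : I -> T -> k) : (forall i, u i = \sum_t A i t *: v t) -> (#|T| < #|I|)%N ->
  exists l : I -> k, (exists i, l i != 0) /\ \sum_i l i *: u i = 0.
Proof.
move=> uA TI; pose M : 'M[k]_(#|I|, #|T|) := \matrix_(i, t) A (enum_val i) (enum_val t).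
have : kermx M != 0.
  rewrite -mxrank_eq0 mxrank_ker subn_eq0 -ltnNge.
  exact: leq_ltn_trans (rank_leq_col M) TI.
move=> /rowV0Pn[x /sub_kermxP xM x0]; exists (fun i => x 0 (enum_rank i)); split.
  have [j xj] : exists j, x 0 j != 0.
    apply: contrapT => h; move/eqP: x0; apply; apply/rowP => j; rewrite mxE.
    by apply: contrapT => /eqP hj; apply: h; exists j.
  by exists (enum_val j); rewrite enum_valK.
under eq_bigr => i _ do rewrite uA scaler_sumr.
rewrite exchange_big big1 //= => t _.
under eq_bigr => i _ do rewrite scalerA.
rewrite -scaler_suml; move/rowP/(_ (enum_rank t)): xM; rewrite !mxE => e.
rewrite (_ : \sum_i _ = 0) ?scale0r // -[RHS]e.
rewrite (reindex (@enum_val I predT)) /=; last first.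
  by exists enum_rank => i _; rewrite ?enum_valK ?enum_rankK.
by apply: eq_bigr => i _; rewrite !mxE enum_valK enum_rankK.
Qed.

Lemma card_bmultinom n b : (#|{: 'X_{1..n < b}}| <= b ^ n)%N.
Proof.
case: b => [|b].
  by rewrite eq_card0 // => m; have := bmdeg m; rewrite ltn0.
pose f (m : 'X_{1..n < b.+1}) : {ffun 'I_n -> 'I_b.+1} := [ffun i => inord (m i)].
have fi : injective f.
  move=> m m' /ffunP e; apply/val_inj/mnmP => i.
  have hm (l : 'X_{1..n < b.+1}) : (l i < b.+1)%N.
    by apply: leq_ltn_trans (bmdeg l); rewrite mdegE (bigD1 i) //= leq_addr.
  by have := congr1 val (e i); rewrite !ffunE /= !inordK.
by apply: leq_trans (leq_card f fi) _; rewrite card_ffun !card_ord.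
Qed.

Lemma leq_expn2r a b n : (a <= b)%N -> (a ^ n <= b ^ n)%N.
Proof. by move=> ab; elim: n => // n IH; rewrite !expnS leq_mul. Qed.

Section Counting.
Variables (k : closedFieldType) (R : comAlgType k) (gR : grading R).
Variables (N : nat) (y : 'I_N -> R).
Hypotheses (fy : finite_over gR y).

(* The n ^ D monomials in z with exponents below n are independent, and lie in the
   span of the products of a module generator with a monomial in y of degree O(n). *)
Lemma indep_leq D (z : 'I_D -> R) : alg_indep z -> (D <= N)%N.
Proof.
move=> iz; have [s _ fs] := fy; pose q := size s; pose w (i : 'I_q) := s`_i.
have coef f : exists c : 'I_q -> {mpoly k[N]}, f = \sum_i mev y (c i) * w i.
  have [c ->] := @lspan_seqP _ (restr_mod (mev y)) s f (fs f).
  by exists c; apply: eq_bigr.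
(* A filtration of R by the degree of coefficients with respect to the generators; representations
   need not be unique. *)
pose W e f := exists2 a : 'I_q -> {mpoly k[N]},
  (forall i, msize (a i) <= e.+1)%N & f = \sum_i mev y (a i) * w i.
have Wex f : exists e, W e f.
  have [c ->] := coef f; exists (\max_i msize (c i)); exists c => // i.
  by apply: leqW; apply: (@leq_bigmax _ (fun i => msize (c i))).
have Wmono e e' f : (e <= e')%N -> W e f -> W e' f.
  by move=> ee' [a ha ->]; exists a => // i; apply: leq_trans (ha i) _.
have WD e f g : W e f -> W e g -> W e (f + g).
  move=> [a ha ->] [b hb ->]; exists (fun i => a i + b i) => [i|].
    by apply: leq_trans (msizeD_le _ _) _; rewrite geq_max ha hb.
  by rewrite -big_split; apply: eq_bigr => i _; rewrite rmorphD mulrDl.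
have WM e e' a f : (msize a <= e.+1)%N -> W e' f -> W (e + e') (mev y a * f).
  move=> ha [b hb ->]; exists (fun i => a * b i) => [i|].
    have [->|a0] := eqVneq a 0; first by rewrite mul0r msize0.
    have [->|b0] := eqVneq (b i) 0; first by rewrite mulr0 msize0.
    rewrite msizeM //; move: ha (hb i); case: (msize _) => [|u]; case: (msize _) => [|v] //=; lia.
  by rewrite mulr_sumr; apply: eq_bigr => i _; rewrite rmorphM mulrA.
have Wsum e (I : Type) (r : seq I) (F : I -> R) : (forall i, W e (F i)) -> W e (\sum_(i <- r) F i).
  move=> h; elim/big_ind: _ => //; last exact: WD.
  exists (fun=> 0) => [i|]; first by rewrite msize0.
  by rewrite big1 // => i _; rewrite rmorph0 mul0r.
(* A uniform constant: multiplication by any z_i raises the filtration by at most c. *)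
have [c hc] : exists c, W c 1 /\ forall i e f, W e f -> W (e + c)%N (z i * f).
  have [c1 h1] := Wex 1.
  have [c2 h2] : exists c2, forall (i : 'I_D) (j : 'I_q), W c2 (z i * w j).
    have [e he] := choice (fun ij : 'I_D * 'I_q => Wex (z ij.1 * w ij.2)).
    exists (\max_ij e ij) => i j; apply: Wmono (he (i, j)).
    exact: (@leq_bigmax _ e (i, j)).
  exists (maxn c1 c2); split; first by apply: Wmono h1; apply: leq_maxl.
  move=> i e f [a ha ->]; apply: (@Wmono (e + c2)); first by rewrite leq_add2l leq_maxr.
  rewrite mulr_sumr; apply: Wsum => j; rewrite mulrCA; exact: WM.
have Wz (m : 'X_{1..D}) : W (c * (mdeg m).+1)%N (mev z 'X_[m]).
  rewrite mevX mdegE; have {hc}[h1 hM] := hc.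
  elim/big_rec2: _ => [|i e f _ h]; first by rewrite muln1.
  elim: (m i) => [|l IH]; first by rewrite expr0 mul1r add0n.
  by rewrite exprS -mulrA addSn mulnS addnC; apply: hM.
clear hc WM WD Wmono Wsum Wex.
(* Monomials in z with exponents below n lie in level c * (D * n + 1), which is less than K *
   n.+1. *)
pose K := (c * (D + 1) + 1)%N.
have bound n : (n ^ D <= q * (K * n.+1) ^ N)%N.
  rewrite leqNgt; apply/negP => big.
  pose b := (c * (D * n + 1)).+1.
  have bK : (b <= K * n.+1)%N by rewrite /b /K; nia.
  pose mon (t : {ffun 'I_D -> 'I_n}) : 'X_{1..D} := [multinom (t i : nat) | i < D].
  have hmon t : W b.-1 (mev z 'X_[mon t]).
    have [a ha e] := Wz (mon t); exists a => // i; apply: leq_trans (ha i) _.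
    rewrite ltnS leq_mul2l addn1 ltnS mdegE; apply/orP; right.
    have -> : (D * n = \sum_(i < D) n)%N by rewrite sum_nat_const card_ord.
    by apply: leq_sum => j _; rewrite mnmE ltnW.
  have hmon' t : exists a : 'I_q -> {mpoly k[N]}, (forall i, msize (a i) <= b)%N /\
      mev z 'X_[mon t] = \sum_i mev y (a i) * w i.
    by have [a ha e] := hmon t; exists a.
  have [a ha] := choice hmon'.
  pose v (t : 'X_{1..N < b} * 'I_q) := mev y 'X_[t.1] * w t.2.
  have [||l [[t lt] sl]] := @linear_dependence k R _ _ (fun t => mev z 'X_[mon t]) v
      (fun t t' => (a t t'.2)@_t'.1).
  - move=> t; have [ha1 ->] := ha t.
    rewrite -(pair_bigA _ (fun (m : 'X_{1..N < b}) (i : 'I_q) => (a t i)@_m *: v (m, i))) exchange_big /=.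
    apply: eq_bigr => i _; rewrite {1}(mpolywE (ha1 i)) rmorph_sum mulr_suml.
    by apply: eq_bigr => m _; rewrite /= mevZ -scalerAl.
  - rewrite card_prod card_ffun !card_ord; apply: leq_ltn_trans big.
    rewrite mulnC leq_mul2l; apply/orP; right.
    by apply: leq_trans (card_bmultinom _ _) _; apply: leq_expn2r.
  have : \sum_t l t *: 'X_[mon t] = 0.
    by apply: iz; rewrite -[RHS]sl rmorph_sum; apply: eq_bigr => t' _ /=; rewrite mevZ.
  move=> /mpolyP/(_ (mon t)); rewrite mcoeff0 raddf_sum (bigD1 t) //= mcoeffZ mcoeffX eqxx mulr1.
  rewrite big1 ?addr0 => [/eqP|t' tt']; first by rewrite (negPf lt).
  rewrite mcoeffZ mcoeffX; case: eqP => [/mnmP e|]; last by rewrite mulr0.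
  by case/eqP: tt'; apply/ffunP => j; apply/val_inj; have := e j; rewrite !mnmE.
rewrite leqNgt; apply/negP => ND.
(* As n.+1 <= 2 * n, this n gives q * (K * n.+1) ^ N < n ^ N.+1 <= n ^ D, against [bound]. *)
pose n := (q * (K * 2) ^ N).+1.
have := bound n; apply/negP; rewrite -ltnNge.
have n0 : (0 < n)%N by [].
apply: (@leq_ltn_trans (q * (K * 2) ^ N * n ^ N)).
  rewrite -mulnA leq_mul2l -expnMn; apply/orP; right; apply: leq_expn2r.
  by rewrite -mulnA leq_mul2l mul2n -addnn -addn1 leq_add2l n0 orbT.
apply: (@leq_trans (n * n ^ N)); first by rewrite ltn_pmul2r ?expn_gt0 ?n0.
by rewrite -expnS leq_pexp2l.
Qed.

End Counting.

Section ChainIndep.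
Variables (k : closedFieldType) (R : comAlgType k).

(** Since f lies in Q, the part of a relation free of the new variable is a relation modulo Q, hence
    0. The remaining factor f is not in the prime P and can be divided out; induction on the degree
    in the new variable finishes. *)
Lemma indep_mod_extend (P Q : prime_idealr R) n (z : 'I_n -> R) (f : R) :
    {subset P <= Q} -> f \in Q -> f \notin P ->
    (forall p, mev z p \in Q -> p = 0) ->
  exists z' : 'I_n.+1 -> R, forall p, mev z' p \in P -> p = 0.
Proof.
move=> PQ fQ fP iz.
exists (fun i => if unlift ord_max i is Some j then z j else f) => p.
set z' := fun i => _; have [q <-] := mfold_surj p.
have zw (a : {mpoly k[n]}) : mev z' (mwiden a) = mev z a.
  have := @mpoly_hom_ext n k R (mev z' \o @mwiden n k) (mev z).
  move=> h; apply: (h _ _ a) => {h} [c|i] /=; first by rewrite mwidenC !mevC.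
  rewrite mwidenX mnmwiden1 !mevXU /z'.
  have -> : widen_ord (leqnSn n) i = lift ord_max i.
    by apply: val_inj; rewrite /= /bump leqNgt ltn_ord add0n.
  by rewrite liftK.
elim/poly_ind: q => [|q c IH]; first by rewrite rmorph0.
have mX : mev z' (mfold n k 'X) = f.
  by rewrite mfoldE map_polyX hornerX mevXU /z' unlift_none.
have mC a : mev z' (mfold n k a%:P) = mev z a by rewrite mfoldE map_polyC hornerC /= zw.
have eq : mev z' (mfold n k (q * 'X + c%:P)) = mev z' (mfold n k q) * f + mev z c.
  by rewrite rmorphD rmorphM rmorphD rmorphM /= mX mC.
rewrite eq => hP.
have c0 : c = 0.
  apply: iz; have := PQ _ hP; rewrite addrC => h.
  rewrite -(addrK (mev z' (mfold n k q) * f) (mev z c)); apply: rpredB => //.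
  exact: idealMr.
move: hP; rewrite c0 rmorph0 addr0 prime_idealrM (negPf fP) orbF => /IH e.
by rewrite polyC0 addr0 rmorphM /= e mul0r.
Qed.

(** Descends from the top of the chain: the empty family is independent modulo the largest prime,
    and each strict inclusion supplies one more element. *)
Lemma indep_of_chain m : has_prime_chain R m -> exists z : 'I_m -> R, alg_indep z.
Proof.
move=> [P hP].
suff [z hz] : exists z : 'I_m -> R, forall p, mev z p \in P ord0 -> p = 0.
  by exists z => p pz; apply: hz; rewrite pz rpred0.
suff h j : (j <= m)%N -> exists z : 'I_j -> R, forall p, mev z p \in P (inord (m - j)) -> p = 0.
  have [z hz] := h m (leqnn m); exists z => p hp; apply: hz.
  by rewrite subnn; have -> : inord 0 = ord0 :> 'I_m.+1 by apply: val_inj; rewrite /= inordK.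
elim: j => [|j IH] jm.
  exists (fun i : 'I_0 => 0) => p; rewrite (nvar0_mpolyC p) mevC => h.
  have [->|c0] := eqVneq (p@_0%MM) 0; first by rewrite mpolyC0.
  have : 1 \in P (inord (m - 0)).
    have -> : 1 = (p@_0%MM)^-1%:A * (p@_0%MM)%:A :> R by rewrite mulr_algl scalerA mulVf ?scale1r.
    exact: idealMr.
  by rewrite idealr1.
have [z hz] := IH (ltnW jm).
have lt : ((inord (m - j.+1) : 'I_m.+1) < (inord (m - j) : 'I_m.+1))%N.
  by rewrite !inordK; lia.
have [PQ nQP] := hP _ _ lt.
have [f [fQ fP]] : exists f, f \in P (inord (m - j)) /\ f \notin P (inord (m - j.+1)).
  apply: contrapT => h; apply: nQP => f fQ; apply: contrapT => fP; apply: h.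
  by exists f; split=> //; apply/negP.
exact: indep_mod_extend PQ fQ fP hz.
Qed.

End ChainIndep.

Lemma normalization_dimension (k : closedFieldType) (R : comAlgType k) (gR : grading R)
    (N D : nat) (y : 'I_N -> R) : GRing.integral_domain_axiom R ->
  finite_over gR y -> alg_indep y -> krull_dimension_is R D -> N = D.
Proof.
move=> hdom fy iy [hD hmax]; apply/eqP; rewrite eqn_leq; apply/andP; split.
  exact/hmax/(prime_chain_of_indep hdom fy iy).
by have [z /(indep_leq fy)] := indep_of_chain hD.
Qed.

(** * A homogeneous primitive element *)

(** An alias of R with an integral domain structure, inverses being chosen classically, so that its
    fraction field can be formed. *)
Definition domain_of (R : comNzRingType) of GRing.integral_domain_axiom R : Type := R.

Section DomainOf.
Variables (R : comNzRingType) (h : GRing.integral_domain_axiom R).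
Local Notation D := (domain_of h).
HB.instance Definition _ := GRing.ComNzRing.on D.

Definition dom_unit : {pred D} := fun x => `[< exists y : D, y * x = 1 >].
Definition dom_inv (x : D) : D := if pselect (exists y : D, y * x = 1) is left e
  then projT1 (cid e) else x.

Fact dom_mulV : {in dom_unit, left_inverse 1 dom_inv *%R}.
Proof.
move=> x /asboolP e; rewrite /dom_inv; case: pselect => // e'; exact: (projT2 (cid e')).
Qed.

Fact dom_unitP (x y : D) : y * x = 1 -> dom_unit x.
Proof. by move=> e; apply/asboolP; exists y. Qed.

Fact dom_inv_out : {in [predC dom_unit], dom_inv =1 id}.
Proof. by move=> x /asboolP e; rewrite /dom_inv; case: pselect. Qed.

HB.instance Definition _ := GRing.ComNzRing_hasMulInverse.Build D dom_mulV dom_unitP dom_inv_out.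
HB.instance Definition _ := GRing.ComUnitRing_isIntegral.Build D h.
End DomainOf.

Section FractionMap.
Variables (A R : idomainType) (f : {rmorphism A -> R}).
Hypothesis finj : injective f.
Local Notation tf := (@FracField.tofrac _).

Lemma fraction_div (B : idomainType) (u : {fraction B}) :
  exists a b, b != 0 /\ u = tf a / tf b.
Proof.
elim/quotW: u => r; exists (\n_r), (\d_r); split; first exact: denom_ratioP.
have d0 := denom_ratioP r.
apply: (mulIf (_ : tf \d_r != 0)); first by rewrite tofrac_eq0.
rewrite divfK ?tofrac_eq0 //.
unlock FracField.tofrac; rewrite -[LHS]FracField.pi_mul; apply/eqmodP.
rewrite /= FracField.equivfE /FracField.mulf !numden_Ratio ?oner_neq0 ?mulr1 //.
by rewrite mulrC.
Qed.

Definition frac_map (u : {fraction A}) : {fraction R} :=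
  let ab := cid (fraction_div u) in
  let b := cid (projT2 ab) in tf (f (projT1 ab)) / tf (f (projT1 b)).

Let f0 a : a != 0 -> f a != 0.
Proof. by move=> a0; apply: contra_neq a0 => fa; apply: finj; rewrite fa rmorph0. Qed.

Lemma frac_mapE a b : b != 0 -> frac_map (tf a / tf b) = tf (f a) / tf (f b).
Proof.
move=> b0; rewrite /frac_map; case: cid => a' [b' h] /=; case: cid => {h}b' /= [b'0 e].
have tb0 : tf b != 0 by rewrite tofrac_eq0.
have tb'0 : tf b' != 0 by rewrite tofrac_eq0.
have {e} e : a * b' = a' * b.
  by apply/eqP; rewrite -tofrac_eq !tofracM -eqr_div // e.
by apply/eqP; rewrite eqr_div ?tofrac_eq0 ?f0 // -!tofracM -!rmorphM e.
Qed.

Fact frac_map_zmod : zmod_morphism frac_map.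
Proof.
move=> u v; have [a [b [b0 ->]]] := fraction_div u; have [c [d [d0 ->]]] := fraction_div v.
have t0 (B : idomainType) (x : B) : x != 0 -> tf x != 0 by rewrite tofrac_eq0.
have sub (B : idomainType) (x y z w : B) : y != 0 -> w != 0 ->
    tf x / tf y - tf z / tf w = tf (x * w - z * y) / tf (y * w).
  move=> y0 w0; rewrite -mulNr addf_div ?t0 // mulNr.
  by rewrite tofracB !tofracM.
by rewrite sub // !frac_mapE ?mulf_neq0 // rmorphB !(rmorphM f) sub ?f0 //.
Qed.

Fact frac_map_monoid : monoid_morphism frac_map.
Proof.
split=> [|u v].
  by rewrite -[1](divff (oner_neq0 _)) -tofrac1 frac_mapE ?oner_neq0 // rmorph1 divff ?tofrac_eq0 ?oner_neq0.
have [a [b [b0 ->]]] := fraction_div u; have [c [d [d0 ->]]] := fraction_div v.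
by rewrite !frac_mapE // !mulf_div -!tofracM frac_mapE ?mulf_neq0 // !(rmorphM f).
Qed.

End FractionMap.

Section PrimitiveElement.
Variables (A R : idomainType) (f : {rmorphism A -> R}).
Hypotheses (finj : injective f) (charA : [pchar A] =i pred0).
Local Notation tf := (@FracField.tofrac _).

Let iota_ (u : {fraction A}) : {fraction R} := frac_map f u.
HB.instance Definition _ := GRing.isZmodMorphism.Build _ _ iota_ (frac_map_zmod finj).
HB.instance Definition _ := GRing.isMonoidMorphism.Build _ _ iota_ (frac_map_monoid finj).
Let iota : {rmorphism {fraction A} -> {fraction R}} := iota_.

Let iotaE a : iota (tf a) = tf (f a).
Proof.
have := frac_mapE finj a (oner_neq0 A).
by rewrite !rmorph1 !divr1.
Qed.

Let map_tf p : map_poly iota (map_poly tf p) = map_poly tf (map_poly f p).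
Proof. by apply/polyP => i; rewrite !coef_map /= iotaE. Qed.

Lemma clear_denominators (q : {poly {fraction A}}) :
  exists c p, c != 0 /\ tf c *: q = map_poly tf p.
Proof.
elim/poly_ind: q => [|q u [c [p [c0 e]]]].
  by exists 1, 0; rewrite oner_neq0 scaler0 rmorph0.
have [a [b [b0 ->]]] := fraction_div u.
exists (c * b), (b *: p * 'X + (c * a)%:P); split; first by rewrite mulf_neq0.
have -> : map_poly tf (b *: p * 'X + (c * a)%:P) =
    tf b *: map_poly tf p * 'X + (tf c * tf a)%:P.
  by rewrite rmorphD rmorphM /= map_polyX map_polyZ map_polyC /= tofracM.
rewrite -e tofracM.
have <- : tf c * tf b * (tf a / tf b) = tf c * tf a.
  by rewrite -mulrA; congr (_ * _); rewrite mulrC divfK ?tofrac_eq0.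
by rewrite -!mul_polyC !(polyCM (tf c * tf b)) polyCM; ring.
Qed.

(** The primitive element theorem over {fraction A} with denominators cleared. The integral
    combination z of x and y is homogeneous when they have the same degree. *)
Lemma domain_PET (x y : R) (p q : {poly A}) : p != 0 -> root (map_poly f p) x ->
    q != 0 -> root (map_poly f q) y ->
  exists n z, [/\ z = y *+ n - x,
    exists c r, c != 0 /\ f c * x = (map_poly f r).[z] &
    exists c r, c != 0 /\ f c * y = (map_poly f r).[z]].
Proof.
move=> p0 px q0 qy.
have t0 (r : {poly A}) : r != 0 -> map_poly tf r != 0.
  move=> r0; rewrite map_poly_eq0_id0 //.
  by rewrite tofrac_eq0 lead_coef_eq0.
have tr (r : {poly A}) w : root (map_poly f r) w -> root (map_poly iota (map_poly tf r)) (tf w).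
  by rewrite map_tf => /rootP e; apply/rootP; rewrite horner_map e rmorph0.
have char0 : [pchar {fraction A}] =i pred0.
  move=> l; rewrite !inE; apply/negP => /andP[lp /eqP l0].
  have := charA l; rewrite !inE lp /= => /negP; apply.
  by rewrite -tofrac_eq0 rmorph_nat l0.
have [n [[q1 e1] [q2 e2]]] := pchar0_PET (t0 _ p0) (tr _ _ px) (t0 _ q0) (tr _ _ qy) char0.
pose z := y *+ n - x; exists n, z.
have ez : tf y *+ n - tf x = tf z by rewrite tofracB tofracMn.
have aux w (r : {poly {fraction A}}) : (map_poly iota r).[tf z] = tf w ->
    exists c r', c != 0 /\ f c * w = (map_poly f r').[z].
  move=> e; have [c [r' [c0 er]]] := clear_denominators r.
  exists c, r'; split=> //; apply/eqP; rewrite -tofrac_eq tofracM -e -horner_map -map_tf -er.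
  by rewrite map_polyZ hornerZ /= iotaE.
by split=> //; [apply: (aux _ q1) | apply: (aux _ q2)]; rewrite -ez.
Qed.

End PrimitiveElement.

Section EvT.
Variables (k : fieldType) (R : comAlgType k) (N : nat) (y : 'I_N -> R) (theta : R).

Definition evt (F : {poly {mpoly k[N]}}) : R := (map_poly (mev y) F).[theta].

Fact evt_zmod : zmod_morphism evt.
Proof. by move=> F G; rewrite /evt rmorphB hornerD hornerN. Qed.
Fact evt_monoid : monoid_morphism evt.
Proof. by split=> [|F G]; rewrite /evt ?rmorph1 ?hornerC // rmorphM hornerM. Qed.
HB.instance Definition _ := GRing.isZmodMorphism.Build _ _ evt evt_zmod.
HB.instance Definition _ := GRing.isMonoidMorphism.Build _ _ evt evt_monoid.

Lemma evtC a : evt a%:P = mev y a.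
Proof. by rewrite /evt map_polyC hornerC. Qed.

Lemma evtX : evt 'X = theta.
Proof. by rewrite /evt map_polyX hornerX. Qed.

Lemma evtE F : evt F = \sum_(i < size F) mev y F`_i * theta ^+ i.
Proof.
rewrite /evt (@horner_coef_wide _ (size F)) ?size_poly //.
by apply: eq_bigr => i _; rewrite coef_map.
Qed.

End EvT.

Section Primitive.
Variables (k : closedFieldType) (R : comAlgType k) (gR : grading R).
Hypotheses (hchar : [pchar k] =i pred0) (hdom : GRing.integral_domain_axiom R).
Local Notation "f \in_ i" := (f \in hpiece gR i) (at level 70).
Hypothesis h1 : 1 \in_ 0%N.
Variables (N M : nat) (y : 'I_N -> R).
Hypotheses (M0 : (0 < M)%N) (hy : forall i, y i \in_ M).
Hypotheses (fy : finite_over gR y) (iy : alg_indep y).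
Local Notation A := {mpoly k[N]}.

Lemma dom_mulf_eq0 (x z : R) : (x * z == 0) = (x == 0) || (z == 0).
Proof.
apply/idP/orP => [/eqP/hdom/orP //|[]/eqP->]; by rewrite ?mul0r ?mulr0.
Qed.

Lemma dom_mulf_neq0 (x z : R) : x != 0 -> z != 0 -> x * z != 0.
Proof. by rewrite dom_mulf_eq0 negb_or => -> ->. Qed.

Let mevd (a : A) : domain_of hdom := mev y a.
Fact mevd_zmod : zmod_morphism mevd. Proof. by move=> a b; rewrite /mevd rmorphB. Qed.
Fact mevd_monoid : monoid_morphism mevd.
Proof. by split=> [|a b]; rewrite /mevd ?rmorph1 ?rmorphM. Qed.
HB.instance Definition _ := GRing.isZmodMorphism.Build _ _ mevd mevd_zmod.
HB.instance Definition _ := GRing.isMonoidMorphism.Build _ _ mevd mevd_monoid.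

(** Membership of f in Frac(A)[z], written inside R by clearing denominators. *)
Definition rational (z f : R) := exists c F, c != 0 /\ mev y c * f = evt y z F.

Lemma rational_PET (x w : R) : exists n, rational (w *+ n - x) x /\ rational (w *+ n - x) w.
Proof.
have [g gm gx] := finite_over_integral fy x; have [h hm hw] := finite_over_integral fy w.
have inj : injective mevd.
  move=> a b; rewrite /mevd => /eqP; rewrite -subr_eq0 -rmorphB => /eqP/iy/eqP.
  by rewrite subr_eq0 => /eqP.
have charA : [pchar A] =i pred0.
  move=> l; rewrite !inE; apply/negP => /andP[lp /eqP l0].
  have := hchar l; rewrite !inE lp /= => /negP; apply.
  by rewrite -(mpolyC_eq0 N) rmorph_nat l0.
have rx : root (map_poly mevd g) (x : domain_of hdom) by apply/rootP.
have rw : root (map_poly mevd h) (w : domain_of hdom) by apply/rootP.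
have [n [z [ez hx' hw']]] := domain_PET inj charA (monic_neq0 gm) rx (monic_neq0 hm) rw.
by exists n; rewrite -[_ - _]ez.
Qed.

Lemma rational_mev z a : rational z (mev y a).
Proof. by exists 1, a%:P; rewrite oner_neq0 rmorph1 mul1r evtC. Qed.

Lemma rational_id z : rational z z.
Proof. by exists 1, 'X; rewrite oner_neq0 rmorph1 mul1r evtX. Qed.

Lemma rationalD z f g : rational z f -> rational z g -> rational z (f + g).
Proof.
move=> [c [F [c0 e]]] [c' [F' [c'0 e']]]; exists (c * c'), (c'%:P * F + c%:P * F').
split; first by rewrite mulf_neq0.
rewrite rmorphD !(rmorphM (evt y z)) /= !evtC -e -e' rmorphM /=; ring.
Qed.

Lemma rationalM z f g : rational z f -> rational z g -> rational z (f * g).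
Proof.
move=> [c [F [c0 e]]] [c' [F' [c'0 e']]]; exists (c * c'), (F * F').
split; first by rewrite mulf_neq0.
by rewrite !rmorphM /= -e -e'; ring.
Qed.

Lemma rational_div z a f : a != 0 -> rational z (mev y a * f) -> rational z f.
Proof.
move=> a0 [c [F [c0 e]]]; exists (c * a), F; split; first by rewrite mulf_neq0.
by rewrite -e rmorphM mulrA.
Qed.

Lemma rational_trans z x f : rational z x -> rational x f -> rational z f.
Proof.
move=> zx [c [F [c0 e]]]; apply: (rational_div c0); rewrite e.
elim/poly_ind: F {e} => [|F a IH]; first by rewrite rmorph0 -(rmorph0 (mev y)); apply: rational_mev.
rewrite rmorphD rmorphM /= evtX evtC; apply: rationalD; last exact: rational_mev.
exact: rationalM.
Qed.

Lemma rational_common z (s : seq R) : (forall w, w \in s -> rational z w) ->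
  exists2 c : A, c != 0 & forall w, w \in s -> exists F, mev y c * w = evt y z F.
Proof.
elim: s => [|w s IH] h; first by exists 1; rewrite ?oner_neq0.
have [|c c0 hc] := IH; first by move=> u us; apply: h; rewrite inE us orbT.
have [c' [F [c'0 e]]] := h w (mem_head _ _).
exists (c * c'); first by rewrite mulf_neq0.
move=> u; rewrite inE => /orP[/eqP->|/hc[G eG]].
  by exists (c%:P * F); rewrite [RHS]rmorphM /= evtC -e rmorphM mulrA.
by exists (c'%:P * G); rewrite [RHS]rmorphM /= evtC -eG rmorphM /=; ring.
Qed.

(** Elements are added one at a time, and each new primitive element w *+ n - x stays in degree
    E. *)
Lemma rational_generator E (s : seq R) : (forall w, w \in s -> w \in_ E) ->
  exists2 z, z \in_ E & forall w, w \in s -> rational z w.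
Proof.
elim: s => [|w s IH] h; first by exists 0; [apply: hp0 | ].
have [|x xE hx] := IH; first by move=> u us; apply: h; rewrite inE us orbT.
have wE := h w (mem_head _ _).
have [n [zx zw]] := rational_PET x w.
exists (w *+ n - x) => [|u].
  by apply: hpB => //; rewrite -scaler_nat; apply: hpZ.
by rewrite inE => /orP[/eqP->//|/hx]; apply: rational_trans.
Qed.

Lemma hcomp_mev_ndvd i p : ~~ (M %| i)%N -> hcomp gR i (mev y p) = 0.
Proof.
move=> ndvd; rewrite (mpolyE p) rmorph_sum hcomp_sumE big1 // => m _ /=.
rewrite mevZ (hcompE _ (hpZ _ (mevX_piece h1 hy m))); case: eqP => // e.
by rewrite e dvdn_mulr in ndvd.
Qed.

(** Coefficients from A contribute only degrees divisible by M, so the component of degree M * j of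
    a combination involves no generator of another degree. *)
Lemma veronese_generators : exists2 s : seq R, (forall w, w \in s -> exists i, w \in_ (M * i)) &
  forall j f, f \in_ (M * j) -> rspan y s f.
Proof.
have [s hs fs] := fy.
pose good w := `[< exists i, w \in_ (M * i)%N >].
exists [seq w <- s | good w] => [w|j f fj].
  by rewrite mem_filter => /andP[/asboolP].
have P f' : rspan y s f' -> rspan y [seq w <- s | good w] (hcomp gR (M * j) f').
  elim=> [|a w g ws _ IH]; first by rewrite hcomp0; apply: (@lspan0 _ (restr_mod (mev y))).
  rewrite hcompD; apply: rspanD IH; rewrite -[a *: w]/(mev y a * (w : R)) mulrC.
  have [l wl] := hs w ws.
  have [lt|le] := ltnP (M * j) l.
    by rewrite (hcompM_lt _ wl lt); apply: (@lspan0 _ (restr_mod (mev y))).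
  rewrite -(subnKC le) (hcompM _ _ wl).
  have [/dvdnP[l' el]|nd] := boolP (M %| l)%N.
    have -> : (M * j - l = M * (j - l'))%N by rewrite el mulnBr [(l' * M)%N]mulnC.
    rewrite (hcomp_mev h1 hy) // mulrC; apply/rspanM/rspan_in.
    rewrite mem_filter ws andbT; apply/asboolP; exists l'; by rewrite mulnC -el.
  rewrite hcomp_mev_ndvd ?mulr0; first exact: (@lspan0 _ (restr_mod (mev y))).
  by apply: contra nd => d; rewrite -(dvdn_addl _ d) subnKC // dvdn_mulr.
by rewrite -(hcomp_id fj); apply: P.
Qed.

End Primitive.

Section WeightedHomogeneous.
Variables (k : fieldType) (N : nat).
Local Notation A := {mpoly k[N]}.

(* The component of weight j when the variable of {poly A} has weight E. *)
Definition wproj (E j : nat) (F : {poly A}) : {poly A} :=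
  \poly_(i < size F) (if (E * i <= j)%N then pihomog mdeg (j - E * i) F`_i else 0).

Lemma coef_wproj E j F i :
  (wproj E j F)`_i = if (E * i <= j)%N then pihomog mdeg (j - E * i) F`_i else 0.
Proof.
rewrite coef_poly; case: ltnP => // h; rewrite (nth_default _ h) pihomog0.
by case: ifP.
Qed.

Lemma size_wproj E j F : (size (wproj E j F) <= size F)%N.
Proof. exact: size_poly. Qed.

Variables (R : comAlgType k) (gR : grading R).
Local Notation "f \in_ i" := (f \in hpiece gR i) (at level 70).
Hypothesis h1 : 1 \in_ 0%N.
Variables (M E : nat) (y : 'I_N -> R) (theta : R).
Hypotheses (M0 : (0 < M)%N) (hy : forall i, y i \in_ M) (ht : theta \in_ (M * E)).

Lemma hcomp_evt j F : hcomp gR (M * j) (evt y theta F) = evt y theta (wproj E j F).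
Proof.
rewrite evtE hcomp_sumE [RHS](_ : _ = \sum_(i < size F) mev y (wproj E j F)`_i * theta ^+ i).
  apply: eq_bigr => i _; have tE := hpX h1 i ht; rewrite mulrC coef_wproj.
  case: leqP => Ej; last by rewrite (hcompM_lt _ tE) ?rmorph0 ?mul0r // -mulnA ltn_pmul2l.
  rewrite -(subnKC Ej) mulnDr mulnA (hcompM _ _ tE) (hcomp_mev h1 hy) //.
  by rewrite subnKC // mulrC.
rewrite /evt (@horner_coef_wide _ (size F)); last first.
  by apply: leq_trans (size_poly _ _) (size_wproj _ _ _).
by apply: eq_bigr => i _; rewrite coef_map.
Qed.

End WeightedHomogeneous.

Section Package.
Variables (k : closedFieldType) (R : comAlgType k) (gR : grading R).
Hypotheses (hchar : [pchar k] =i pred0) (hdom : GRing.integral_domain_axiom R).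
Local Notation "f \in_ i" := (f \in hpiece gR i) (at level 70).
Hypothesis h1 : 1 \in_ 0%N.
Variables (N M : nat) (y : 'I_N -> R) (i0 : 'I_N).
Hypotheses (M0 : (0 < M)%N) (hy : forall i, y i \in_ M).
Hypotheses (fy : finite_over gR y) (iy : alg_indep y).
Local Notation A := {mpoly k[N]}.

Definition minimal_annihilator theta (P : {poly A}) :=
  evt y theta P = 0 /\ forall F : {poly A}, evt y theta F = 0 -> (size F < size P)%N -> F = 0.

(** For a homogeneous primitive element the generators must share one degree. Powers of y_i0 achieve
    this, and they are invertible in Frac(A). *)
Lemma homogeneous_rational_generator : exists E theta,
  theta \in_ (M * E) /\ forall j f, f \in_ (M * j) -> rational y theta f.
Proof.
have [s hs fs] := veronese_generators h1 M0 hy fy.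
have [e he] : exists e : R -> nat, forall w, w \in s -> w \in_ (M * e w).
  have ex w : exists i, w \in s -> w \in_ (M * i).
    by have [/hs[i wi]|nws] := boolP (w \in s); [exists i | exists 0%N].
  by have [e he] := choice ex; exists e.
pose E := \max_(w <- s) e w; exists E.
have [|theta tE ht] := @rational_generator _ _ gR hchar hdom _ _ fy iy (M * E)
    [seq y i0 ^+ (E - e w) * w | w <- s].
  move=> _ /mapP[w ws ->]; have eE : (e w <= E)%N by apply: leq_bigmax_seq.
  by rewrite -(subnK eE) mulnDr addnK; apply: hpieceM; [apply: (hpX h1) | apply: he].
exists theta; split=> // j f /fs.
elim=> [|a w g ws _ IH]; first by rewrite -(rmorph0 (mev y)); apply: rational_mev.
apply: rationalD IH; apply: rationalM; first exact: rational_mev.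
apply: (@rational_div _ _ _ _ _ ('X_i0 ^+ (E - e w))).
  by rewrite expf_neq0 //; apply/eqP => /mpolyP/(_ U_(i0)%MM)/eqP; rewrite mcoeffX eqxx mcoeff0 oner_eq0.
by rewrite rmorphXn /= mevXU; apply: ht; apply: map_f.
Qed.

Lemma minimal_annihilator_exists theta : exists2 P, P != 0 & minimal_annihilator theta P.
Proof.
have [g gm gx] := finite_over_integral fy theta.
have := monic_neq0 gm; move: gx; rewrite -/(evt y theta g).
have [n] := ubnP (size g); elim: n g {gm} => // n IH g gn gx g0.
have [h|] := pselect (forall F : {poly A}, evt y theta F = 0 -> (size F < size g)%N -> F = 0).
  by exists g.
move=> h; have [F [Fx Fg F0]] : exists F : {poly A}, [/\ evt y theta F = 0, (size F < size g)%N & F != 0].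
  apply: contrapT => h'; apply: h => F Fx Fg; apply: contrapT => /eqP F0.
  by apply: h'; exists F.
by apply: (IH F) => //; apply: leq_trans Fg _.
Qed.

Lemma mpoly_homog_comp_neq0 (c : A) : c != 0 -> exists l, pihomog mdeg l c != 0.
Proof.
move=> c0; apply: contrapT => h; move/eqP: c0; apply.
rewrite (pihomog_partitionE (leqnn (mmeasure mdeg c))) big1 // => j _.
by apply: contrapT => /eqP hj; apply: h; exists (val j).
Qed.

(** The component of P in the weight of a homogeneous piece of its leading term still annihilates
    theta; by minimality it has the size of P. *)
Lemma homogeneous_minimal_annihilator E theta : theta \in_ (M * E) ->
  exists P l, [/\ P != 0, minimal_annihilator theta P & lead_coef P \is l.-homog].
Proof.
move=> tE; have [P P0 [Px Pmin]] := minimal_annihilator_exists theta.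
have lP : lead_coef P != 0 by rewrite lead_coef_eq0.
have [l hl] := mpoly_homog_comp_neq0 lP.
pose n := (size P).-1; pose P' := wproj E (l + E * n) P.
have cn : P'`_n = pihomog mdeg l (lead_coef P).
  by rewrite coef_wproj leq_addl addnK.
have P'0 : P' != 0 by apply: contra_neq hl => e; rewrite -cn e coef0.
have P'x : evt y theta P' = 0 by rewrite -(hcomp_evt h1 M0 hy tE) Px hcomp0.
have szP : size P' = size P.
  apply/eqP; rewrite eqn_leq size_wproj /= leqNgt; apply: contra P'0 => h.
  by apply/eqP/Pmin.
exists P', l; split=> //; first by split=> // F Fx; rewrite szP; apply: Pmin.
by rewrite lead_coefE szP -/n cn pihomogP.
Qed.

Lemma evt_rescale (c : A) theta F :
  evt y (mev y c * theta) F = evt y theta (\poly_(i < size F) (F`_i * c ^+ i)).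
Proof.
rewrite evtE /evt (@horner_coef_wide _ (size F)); last first.
  by apply: leq_trans (size_poly _ _) (size_poly _ _).
apply: eq_bigr => i _; rewrite coef_map coef_poly ltn_ord /= rmorphM rmorphXn exprMn.
by rewrite mulrA.
Qed.

(** As for algebraic integers, multiplying t0 by the leading coefficient c makes its minimal
    equation monic; c is homogeneous, hence so is theta. A homogeneous component of a common
    denominator serves as delta. *)
Lemma primitive_package : exists (E : nat) (theta : R) (l : nat) (delta : A) (P : {poly A}),
  [/\ theta \in_ (M * E), delta != 0 /\ delta \is l.-homog,
      P \is monic /\ minimal_annihilator theta P &
      forall j f, f \in_ (M * j) -> exists F, mev y delta * f = evt y theta F].
Proof.
have [E0 [t0 [t0E t0rat]]] := homogeneous_rational_generator.
have [P0 [l0 [P00 [P0x P0min] hl0]]] := homogeneous_minimal_annihilator t0E.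
pose c := lead_coef P0; pose n := (size P0).-1.
have c0 : c != 0 by rewrite lead_coef_eq0.
have szP0 : size P0 = n.+1 by rewrite prednK // size_poly_gt0.
have n0 : (0 < n)%N.
  rewrite lt0n; apply/eqP => n0; have s1 : (size P0 <= 1)%N by rewrite szP0 n0.
  move: P0x c0; rewrite /c (size1_polyC s1) evtC lead_coefC => /iy->.
  by rewrite eqxx.
pose E := (l0 + E0)%N; pose theta := mev y c * t0; exists E, theta.
have tE : theta \in_ (M * E).
  by rewrite mulnDr; apply: hpieceM => //; apply: (mev_piece h1 hy hl0).
pose Q := \poly_(i < n) (c ^+ (n.-1 - i) * P0`_i).
pose P := 'X^n + Q.
have szQ : (size Q < size ('X^n : {poly A}))%N by rewrite size_polyXn ltnS size_poly.
have Pm : P \is monic by rewrite monicE lead_coefDl // lead_coefXn.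
have szP : size P = n.+1 by rewrite size_polyDl // size_polyXn.
have Px : evt y theta P = 0.
  have: mev y c ^+ n.-1 * evt y t0 P0 = 0 by rewrite P0x mulr0.
  rewrite evtE szP0 big_ord_recr /= -/n -[P0`_n]/(lead_coef P0) -/c => e.
  rewrite -[RHS]e rmorphD rmorphXn /= evtX addrC mulrDr; congr (_ + _).
    by rewrite /theta exprMn mulrA -exprSr prednK.
  rewrite /evt (@horner_coef_wide _ n); last first.
    by apply: leq_trans (size_poly _ _) (size_poly _ _).
  rewrite mulr_sumr; apply: eq_bigr => i _; rewrite coef_map coef_poly ltn_ord /=.
  rewrite rmorphM rmorphXn /= /theta exprMn.
  have {2}-> : n.-1 = (n.-1 - i + i)%N by rewrite subnK // -ltnS prednK.
  by rewrite exprD; ring.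
have Pmin F : evt y theta F = 0 -> (size F < size P)%N -> F = 0.
  rewrite evt_rescale szP -szP0 => Fx Fs.
  have := P0min _ Fx (leq_ltn_trans (size_poly _ _) Fs).
  move=> /polyP h; apply/polyP => i; have [iF|/(nth_default _)->] := ltnP i (size F); last by rewrite coef0.
  have /eqP := h i; rewrite coef_poly iF !coef0 mulf_eq0 expf_eq0 (negPf c0) andbF orbF.
  by move=> /eqP.
have trat : rational y theta t0.
  apply: (rational_div c0); exact: rational_id.
have [s hs fs] := veronese_generators h1 M0 hy fy.
have [|d d0 hd] := @rational_common _ _ _ y theta s.
  by move=> w /hs[j wj]; apply: rational_trans trat (t0rat _ _ wj).
have [l hl] := mpoly_homog_comp_neq0 d0.
exists l, (pihomog mdeg l d), P; split=> //; first by rewrite pihomogP.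
move=> j f fj; have [F eF] : exists F, mev y d * f = evt y theta F.
  elim: (fs j f fj) => [|a w g ws _ [F eF]]; first by exists 0; rewrite mulr0 rmorph0.
  have [G eG] := hd w ws; exists (a%:P * G + F).
  rewrite [RHS]rmorphD rmorphM /= evtC -eF -eG.
  by rewrite -[a *: w]/(mev y a * (w : R)); ring.
(* Compares components of degree M * (j + l): since f is homogeneous, d is replaced by its component
   of degree l. *)
exists (wproj E (j + l) F); rewrite -(hcomp_evt h1 M0 hy tE) -eF [mev y d * f]mulrC mulnDr (hcompM _ _ fj).
by rewrite (hcomp_mev h1 hy) // mulrC.
Qed.

End Package.

Lemma leq1_of_pred_add x y z : (0 < x)%N -> (0 < y)%N -> (z <= x)%N -> z = (x + y).-1 -> (y <= 1)%N.
Proof. lia. Qed.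

Lemma ltn_pred_addr x y z : (1 < y)%N -> z = (x + y).-1 -> (0 < x)%N -> (x < z)%N.
Proof. lia. Qed.

(** * Irreducibility and generic separability of the minimal polynomial *)

Section MinimalAnnihilator.
Variables (k : closedFieldType) (R : comAlgType k).
Hypotheses (hchar : [pchar k] =i pred0) (hdom : GRing.integral_domain_axiom R).
Variables (N : nat) (y : 'I_N -> R) (theta : R) (P : {poly {mpoly k[N]}}).
Hypotheses (Pm : P \is monic) (Pmin : minimal_annihilator y theta P) (iy : alg_indep y).

(** R is a domain, so one of two factors annihilates theta, and by minimality it has the full
    size. *)
Lemma minimal_annihilator_irreducible : monic_irreducible P.
Proof.
have h (F G : {poly {mpoly k[N]}}) : F \is monic -> G \is monic -> P = F * G ->
    evt y theta F = 0 -> G = 1.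
  move=> Fm Gm e Fx; apply: monic_size1 => //.
  have sF : (size P <= size F)%N.
    by rewrite leqNgt; apply/negP => /(Pmin.2 F Fx) F0; move: (monic_neq0 Fm); rewrite F0 eqxx.
  have sP : size P = (size F + size G).-1 by rewrite e size_monicM ?monic_neq0.
  by apply: leq1_of_pred_add sF sP; rewrite size_poly_gt0 monic_neq0.
move=> F G Fm Gm e.
have : evt y theta F * evt y theta G = 0 by rewrite -rmorphM -e /= Pmin.1.
move=> /hdom/orP[]/eqP Fx; first by right; apply: h e Fx.
by left; apply: (h G F) => //; rewrite mulrC.
Qed.

Lemma minimal_annihilator_size : (1 < size P)%N.
Proof.
rewrite ltnNge; apply/negP => /(monic_size1 Pm) P1.
by have := Pmin.1; rewrite P1 rmorph1 => /eqP; rewrite oner_eq0.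
Qed.

(** In characteristic 0 the derivative is nonzero, and minimality excludes a common factor with P.
    The resulting Bezout identity has a nonzero c in A on its right-hand side and survives
    evaluation wherever c does not vanish. *)
Lemma minimal_annihilator_separable : exists2 c : {mpoly k[N]}, c != 0 &
  forall p, c.@[p] != 0 -> separable_poly (map_poly (meval p) P).
Proof.
have charA (n : nat) : n.+1%:R != 0 :> {mpoly k[N]}.
  by rewrite -mpolyC_nat mpolyC_eq0; move/pcharf0P: hchar => ->.
have sP := minimal_annihilator_size.
have P'0 : P^`() != 0.
  apply/eqP => /polyP/(_ (size P).-2); rewrite coef_deriv coef0.
  have -> : (size P).-2.+1 = (size P).-1 by rewrite prednK // -ltnS prednK // ltnW.
  rewrite -lead_coefE (monicP Pm) => /eqP.
  have -> : (size P).-1 = (size P).-2.+1 by rewrite prednK // -ltnS prednK // ltnW.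
  by rewrite (negPf (charA _)).
have P0 := monic_neq0 Pm.
have cop : coprimep P P^`().
  apply/negPn/negP; rewrite coprimep_def => ng.
  have g0 : gcdp P P^`() != 0 by rewrite gcdp_eq0 negb_and P0.
  have sg : (1 < size (gcdp P P^`()))%N by rewrite ltn_neqAle eq_sym ng size_poly_gt0.
  have gP : (size (gcdp P P^`()) < size P)%N.
    apply: leq_ltn_trans (lt_size_deriv P0); apply: dvdp_leq => //; exact: dvdp_gcdr.
  have /Pdiv.Idomain.dvdpP[[c q] /= c0 e] := dvdp_gcdl P P^`().
  have q0 : q != 0.
    apply: contra_neq P0 => q0; move/eqP: e; rewrite q0 mul0r -mul_polyC mulf_eq0.
    by rewrite polyC_eq0 (negPf c0) => /eqP.
  have : evt y theta q * evt y theta (gcdp P P^`()) = 0.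
    by rewrite -rmorphM -e -mul_polyC rmorphM /= Pmin.1 mulr0.
  move=> /hdom/orP[]/eqP.
    move=> /Pmin.2 h; move/eqP: (q0); apply; apply: h.
    have es : size P = (size q + size (gcdp P P^`())).-1.
      have := congr1 (fun u : {poly {mpoly k[N]}} => size u) e.
      by rewrite /= size_scale // => ->; rewrite size_mul.
    by apply: ltn_pred_addr sg es _; rewrite size_poly_gt0.
  by move=> /Pmin.2 h; move/eqP: g0; apply; apply: h.
have [[u v] /=] := Bezout_coprimepP _ _ cop.
rewrite -size_poly_eq1 => /size_poly1P[c c0 e].
exists c => // p cp.
rewrite unlock; apply/Bezout_coprimepP; exists (map_poly (meval p) u, map_poly (meval p) v) => /=.
rewrite deriv_map -(rmorphM (map_poly (meval p))) -(rmorphM (map_poly (meval p))) -(rmorphD (map_poly (meval p))) e /=.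
by rewrite map_polyC /= -size_poly_eq1 size_polyC cp.
Qed.

End MinimalAnnihilator.

(** * Linear coordinates adapted to a line *)

Section AxisLine.
Variables (k : fieldType) (m : nat).
Definition ord1' : 'I_m.+2 := lift ord0 ord0.

Definition axis_line : {mpoly k[m.+2]} -> {poly k} :=
  mmap polyC (fun i : 'I_m.+2 => if i == ord0 then 1 else if i == ord1' then 'X else 0).
HB.instance Definition _ := GRing.RMorphism.on axis_line.
End AxisLine.

Section CoordinateChange.
Variables (k : closedFieldType) (m : nat).
Local Notation N := m.+2.
Local Notation A := {mpoly k[N]}.
Local Notation x0 := (ord0 : 'I_N).
Local Notation x1 := (ord1' m).
Variables (p a : 'I_N -> k).
(** This minor makes p and a independent in the first two coordinates, so that X_2, X_3, ... still
    complete them to a coordinate system. *)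
Let D := p x0 * a x1 - p x1 * a x0.
Hypothesis D0 : D != 0.

(* The coordinates in which the line p + t a is (1, t, 0, ..., 0). *)
Let sX (i : 'I_N) : A := p i *: 'X_x0 + a i *: 'X_x1 + (if (1 < i)%N then 'X_i else 0).
Let t0 : A := D^-1 *: (a x1 *: 'X_x0 - a x0 *: 'X_x1).
Let t1 : A := D^-1 *: (p x0 *: 'X_x1 - p x1 *: 'X_x0).
Let tX (i : 'I_N) : A :=
  if i == x0 then t0 else if i == x1 then t1 else 'X_i - p i *: t0 - a i *: t1.

Definition coord_to : A -> A := mmap (@mpolyC N k) sX.
Definition coord_from : A -> A := mmap (@mpolyC N k) tX.
HB.instance Definition _ := GRing.RMorphism.on coord_to.
HB.instance Definition _ := GRing.RMorphism.on coord_from.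

Let ord_cases (i : 'I_N) : [\/ i = x0, i = x1 | [/\ (1 < i)%N, i != x0 & i != x1]].
Proof.
case: i => [[|[|i]] hi]; [constructor 1 | constructor 2 | constructor 3]; try exact: val_inj.
by split.
Qed.

Lemma coord_toC c : coord_to c%:MP = c%:MP. Proof. by rewrite /coord_to mmapC. Qed.
Lemma coord_toX i : coord_to 'X_i = sX i. Proof. by rewrite /coord_to mmapX mmap1U. Qed.
Lemma coord_fromC c : coord_from c%:MP = c%:MP. Proof. by rewrite /coord_from mmapC. Qed.
Lemma coord_fromX i : coord_from 'X_i = tX i. Proof. by rewrite /coord_from mmapX mmap1U. Qed.

Let coord_toZ c f : coord_to (c *: f) = c *: coord_to f.
Proof. by rewrite -!mul_mpolyC rmorphM /= coord_toC. Qed.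
Let coord_fromZ c f : coord_from (c *: f) = c *: coord_from f.
Proof. by rewrite -!mul_mpolyC rmorphM /= coord_fromC. Qed.

Let DV : (D^-1)%:MP * ((p x0)%:MP * (a x1)%:MP - (p x1)%:MP * (a x0)%:MP) = 1 :> A.
Proof. by rewrite -!mpolyCM -mpolyCB -mpolyCM mulVf. Qed.

Lemma coord_fromK f : coord_from (coord_to f) = f.
Proof.
have := @mpoly_hom_ext _ _ _ (coord_from \o coord_to) idfun; apply=> [c|i] /=.
  by rewrite coord_toC coord_fromC.
have t0E : coord_from 'X_x0 = t0 by rewrite coord_fromX /tX eqxx.
have t1E : coord_from 'X_x1 = t1 by rewrite coord_fromX.
rewrite coord_toX /sX !rmorphD /= !coord_fromZ t0E t1E.
have [->|->|[i2 i0 i1]] := ord_cases i.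
- rewrite rmorph0 addr0 /t0 /t1 -!mul_mpolyC -[RHS]mul1r -DV; ring.
- rewrite rmorph0 addr0 /t0 /t1 -!mul_mpolyC -[RHS]mul1r -DV; ring.
- by rewrite i2 coord_fromX /tX (negPf i0) (negPf i1) -!mul_mpolyC; ring.
Qed.

Lemma coord_toK f : coord_to (coord_from f) = f.
Proof.
have := @mpoly_hom_ext _ _ _ (coord_to \o coord_from) idfun; apply=> [c|i] /=.
  by rewrite coord_fromC coord_toC.
have s0 : coord_to 'X_x0 = p x0 *: 'X_x0 + a x0 *: 'X_x1 by rewrite coord_toX /sX addr0.
have s1 : coord_to 'X_x1 = p x1 *: 'X_x0 + a x1 *: 'X_x1 by rewrite coord_toX /sX addr0.
have st0 : coord_to t0 = 'X_x0.
  rewrite /t0 coord_toZ rmorphB /= !coord_toZ s0 s1 -!mul_mpolyC -[RHS]mul1r -DV; ring.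
have st1 : coord_to t1 = 'X_x1.
  rewrite /t1 coord_toZ rmorphB /= !coord_toZ s0 s1 -!mul_mpolyC -[RHS]mul1r -DV; ring.
rewrite coord_fromX /tX; have [->|->|[i2 i0 i1]] := ord_cases i; first by rewrite eqxx.
  by [].
rewrite (negPf i0) (negPf i1) !rmorphB /= (coord_toZ (p i)) (coord_toZ (a i)) st0 st1 coord_toX /sX i2; ring.
Qed.

Lemma coord_to_homog l f : f \is l.-homog -> coord_to f \is l.-homog.
Proof.
move=> /dhomogP hf; rewrite (mpolyE f) rmorph_sum big_seq; apply: rpred_sum => u /hf /= <-.
rewrite coord_toZ; apply: dhomogZ; rewrite mpolyXE_id rmorph_prod mdegE.
elim/big_rec2: _ => [|i d q _ h]; first exact: dhomog1.
have hX j : 'X_j \is [in k[N], 1.-homog] by rewrite dhomogX /= mdeg1.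
have hs : sX i \is 1.-homog by rewrite /sX !rpredD ?dhomogZ //; case: ifP => _; rewrite ?rpred0.
by apply: dhomogM => //; rewrite rmorphXn /= coord_toX -[X in X.-homog]mul1n; apply: dhomogMn.
Qed.

Lemma axis_line_coord f : axis_line (coord_to f) = line_sub p a f.
Proof.
have lC c : axis_line c%:MP = c%:P :> {poly k} by rewrite /axis_line mmapC.
have lX i : axis_line 'X_i = if i == x0 then 1 else if i == x1 then 'X else 0 :> {poly k}.
  by rewrite /axis_line mmapX mmap1U.
have lZ c g : axis_line (c *: g) = c%:P * axis_line g :> {poly k}.
  by rewrite -mul_mpolyC rmorphM /= lC.
have := @mpoly_hom_ext _ _ _ (@axis_line k m \o coord_to) (line_sub p a); apply=> [c|i] /=.
  by rewrite coord_toC lC /line_sub mmapC.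
rewrite coord_toX /sX !rmorphD /= !lZ !lX /= mulr1 /line_sub mmapX mmap1U /line_point.
rewrite -[RHS]addr0; congr (_ + _).
have [->|->|[i2 i0 i1]] := ord_cases i; rewrite ?rmorph0 //.
by rewrite i2 lX (negPf i0) (negPf i1).
Qed.

Variables (R : comAlgType k) (y : 'I_N -> R).

Definition new_coord (i : 'I_N) : R := mev y (coord_from 'X_i).

Lemma mev_new f : mev new_coord f = mev y (coord_from f).
Proof.
have := @mpoly_hom_ext _ _ _ (mev new_coord) (mev y \o coord_from); apply=> [c|i] /=.
  by rewrite coord_fromC !mevC.
by rewrite mevXU.
Qed.

Lemma evt_new theta F :
  evt new_coord theta F = evt y theta (map_poly coord_from F).
Proof.
rewrite /evt -map_poly_comp; congr (_.[_]).
by apply: eq_map_poly => f; rewrite /= mev_new.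
Qed.

Variables (gR : grading R) (M : nat).
Hypothesis hy : forall i, y i \in hpiece gR M.

Lemma new_coord_piece i : new_coord i \in hpiece gR M.
Proof.
rewrite /new_coord coord_fromX /tX /t0 /t1.
have h j : mev y 'X_j \in hpiece gR M by rewrite mevXU.
have hB f g : mev y f \in hpiece gR M -> mev y g \in hpiece gR M -> mev y (f - g) \in hpiece gR M.
  by move=> hf hg; rewrite rmorphB; apply: hpB.
have hZ c f : mev y f \in hpiece gR M -> mev y (c *: f) \in hpiece gR M.
  by move=> hf; rewrite mevZ; apply: hpZ.
have ht0 : mev y (D^-1 *: (a x1 *: 'X_x0 - a x0 *: 'X_x1)) \in hpiece gR M.
  by apply: (hZ); apply: (hB); apply: (hZ).
have ht1 : mev y (D^-1 *: (p x0 *: 'X_x1 - p x1 *: 'X_x0)) \in hpiece gR M.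
  by apply: (hZ); apply: (hB); apply: (hZ).
case: ifP => _ //; case: ifP => _ //.
by apply: (hB); [apply: (hB) => //|]; apply: (hZ).
Qed.

End CoordinateChange.

Section GoodCoordinates.
Variables (k : closedFieldType) (R : comAlgType k) (gR : grading R).
Hypotheses (hchar : [pchar k] =i pred0) (hdom : GRing.integral_domain_axiom R).
Local Notation "f \in_ i" := (f \in hpiece gR i) (at level 70).
Hypothesis h1 : 1 \in_ 0%N.
Variables (m M : nat) (y : 'I_m.+2 -> R).
Hypotheses (M0 : (0 < M)%N) (hy : forall i, y i \in_ M).
Hypotheses (fy : finite_over gR y) (iy : alg_indep y).
Local Notation A := {mpoly k[m.+2]}.

Lemma good_coordinates :
  exists (y' : 'I_m.+2 -> R) (E : nat) (theta : R) (l : nat) (delta : A) (P : {poly A}),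
  [/\ forall i, y' i \in_ M,
      theta \in_ (M * E) /\ (delta != 0 /\ delta \is l.-homog),
      P \is monic /\ minimal_annihilator y' theta P,
      forall j f, f \in_ (M * j) -> exists F, mev y' delta * f = evt y' theta F &
      monic_irreducible (map_poly (@axis_line k m) P)].
Proof.
have [E [theta [l [delta [P [tE [d0 dl] [Pm Pmin] Pgen]]]]]] :=
  primitive_package hchar hdom h1 ord0 M0 hy fy iy.
have [c c0 csep] := minimal_annihilator_separable hchar hdom Pm Pmin.
have X0 i : 'X_i != 0 :> A.
  by apply/eqP => /mpolyP/(_ U_(i)%MM)/eqP; rewrite mcoeffX eqxx mcoeff0 oner_eq0.
(* The nonzero first coordinate of p keeps [lin] below from vanishing identically. *)
have [p] := mpoly_nonroot (mulf_neq0 c0 (X0 ord0)).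
rewrite mevalM mevalXU mulf_eq0 negb_or => /andP[cp p0].
have Pirr := minimal_annihilator_irreducible hdom Pmin.
have [dlt dlt0 hdlt] := bertini Pm Pirr (csep p cp).
(* The determinant of the coordinate change as a function of a. *)
pose lin : A := p ord0 *: 'X_(ord1' m) - p (ord1' m) *: 'X_ord0.
have lin0 : lin != 0.
  apply/eqP => /mpolyP/(_ U_(ord1' m)%MM)/eqP.
  by rewrite mcoeffB !mcoeffZ !mcoeffXU mcoeff0 /= mulr1 mulr0 subr0 (negPf p0).
have [a] := mpoly_nonroot (mulf_neq0 dlt0 lin0).
rewrite mevalM mulf_eq0 negb_or => /andP[/hdlt irr].
rewrite mevalB !mevalZ !mevalXU => D0.
pose y' := new_coord p a y.
have evs F : evt y' theta (map_poly (coord_to p a) F) = evt y theta F.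
  rewrite evt_new // -map_poly_comp; congr (evt _ _ _); apply: map_poly_id => f _ /=.
  exact: coord_fromK.
have mevs f : mev y' (coord_to p a f) = mev y f.
  by rewrite mev_new coord_fromK.
exists y', E, theta, l, (coord_to p a delta), (map_poly (coord_to p a) P); split.
- by move=> i; apply: new_coord_piece.
- split=> //; split; last exact: coord_to_homog.
  by apply: contra_neq d0 => e; rewrite -(coord_fromK D0 delta) e rmorph0.
- have Pm' : map_poly (coord_to p a) P \is monic by apply: monic_map.
  have sz (F : {poly A}) : size (map_poly (coord_to p a) F) = size F.
    apply: size_map_inj_poly; last by rewrite rmorph0.
    exact: can_inj (coord_fromK D0).
  split=> //; split; first by rewrite evs Pmin.1.
  move=> F; rewrite evt_new sz => Fx Fs.
  have sz' : size (map_poly (coord_from p a) F) = size F.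
    apply: size_map_inj_poly; last by rewrite rmorph0.
    exact: can_inj (coord_toK D0).
  have F0 := Pmin.2 _ Fx; apply/eqP; rewrite -size_poly_eq0 -sz' size_poly_eq0.
  by apply/eqP/F0; rewrite sz'.
- move=> j f fj; have [F eF] := Pgen j f fj; exists (map_poly (coord_to p a) F).
  by rewrite mevs eF evs.
rewrite -map_poly_comp (eq_map_poly (g := line_sub p a)) //.
by move=> f; apply: axis_line_coord.
Qed.

End GoodCoordinates.

Import Order.TTheory Num.Theory.

(** * Initial forms *)

Section OrderedGroup.
Variable G : ordGroupType.
Implicit Types a b c d : G.

Lemma og_total a b : (a <= b) || (b <= a). Proof. exact: ogle_total. Qed.

Lemma og_ltNge a b : (a < b) = ~~ (b <= a).
Proof.
apply/idP/idP => [|nba].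
  by rewrite lt_neqAle => /andP[ab le]; apply: contra ab => le'; rewrite eq_le le.
rewrite lt_neqAle; have := og_total a b; rewrite (negPf nba) orbF => ab; rewrite ab andbT.
by apply: contra nba => /eqP->.
Qed.

Lemma og_leD2l c a b : (c + a <= c + b) = (a <= b).
Proof.
apply/idP/idP => [/(ogle_add2l (- c))|/(ogle_add2l c)//]; by rewrite !addKr.
Qed.

Lemma og_leD2r c a b : (a + c <= b + c) = (a <= b).
Proof. by rewrite ![_ + c]addrC og_leD2l. Qed.

Lemma og_ltD2l c a b : (c + a < c + b) = (a < b).
Proof. by rewrite !og_ltNge og_leD2l. Qed.

Lemma og_eqD a b c d : a <= c -> b <= d -> a + b = c + d -> a = c /\ b = d.
Proof.
move=> ac bd e; have [ac'|ac'] := eqVneq a c.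
  by split=> //; move: e; rewrite ac' => /addrI.
have : a + b < c + d by apply: og_ltD; rewrite // lt_def eq_sym ac'.
by rewrite e ltxx.
Qed.

Lemma og_leMn n a b : a <= b -> a *+ n <= b *+ n.
Proof. by move=> ab; elim: n => [|n IH]; rewrite ?mulr0n // !mulrS; apply: og_leD. Qed.

Lemma og_ltMn n a b : (0 < n)%N -> a < b -> a *+ n < b *+ n.
Proof. by case: n => // n _ ab; rewrite !mulrS; apply: og_ltD => //; apply/og_leMn/ltW. Qed.

Lemma og_minP a b : Order.min a b = a /\ a <= b \/ Order.min a b = b /\ b <= a.
Proof.
rewrite minEle; case: ifP => h; [left | right]; split=> //.
by have := og_total a b; rewrite h.
Qed.

Lemma seq_min_exists (T : eqType) (s : seq T) (f : T -> G) x0 : x0 \in s ->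
  exists2 x, x \in s & forall z, z \in s -> f x <= f z.
Proof.
elim: s x0 => // x s IH x0 _; case: s IH => [|u s] IH.
  by exists x; rewrite ?mem_head // => z; rewrite inE => /eqP->.
have [w ws hw] := IH u (mem_head _ _).
have [xw|wx] := orP (og_total (f x) (f w)).
  exists x; rewrite ?mem_head // => z; rewrite inE => /orP[/eqP->//|/hw]; exact: le_trans.
by exists w; first (by rewrite inE ws orbT); move=> z; rewrite inE => /orP[/eqP->|/hw].
Qed.

End OrderedGroup.

Section Weights.
Variables (k : fieldType) (N : nat) (G : ordGroupType).
Local Notation A := {mpoly k[N]}.
Variable wt : nat -> 'X_{1..N} -> G.
Hypothesis wtD : forall i j u v, wt (i + j) (u + v)%MM = wt i u + wt j v.
Implicit Types (F H Q : {poly A}) (a b c : G).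

Definition wge a F := forall i u, F`_i@_u != 0 -> a <= wt i u.

Definition wpart a i (f : A) : A := \sum_(u <- msupp f | wt i u == a) f@_u *: 'X_[u].

Lemma coef_wpart a i f u : (wpart a i f)@_u = if wt i u == a then f@_u else 0.
Proof.
rewrite /wpart raddf_sum /= -big_filter; set s := filter _ _.
have us : uniq s by rewrite filter_uniq // msupp_uniq.
have [uf|uf] := boolP (u \in s).
  rewrite (bigD1_seq u) //= mcoeffZ mcoeffX eqxx mulr1 big1 ?addr0.
    by move: uf; rewrite mem_filter => /andP[->].
  by move=> v vu; rewrite mcoeffZ mcoeffX (negPf vu) mulr0.
rewrite big_seq big1; last first.
  move=> v vs; rewrite mcoeffZ mcoeffX; case: eqP => [vu|]; last by rewrite mulr0.
  by rewrite -vu vs in uf.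
case: eqP => // wu; move: uf; rewrite mem_filter wu eqxx /= => uf.
by rewrite memN_msupp_eq0.
Qed.

Definition wcomp a F : {poly A} := \poly_(i < size F) wpart a i F`_i.

Lemma coef_wcomp a F i u : (wcomp a F)`_i@_u = if wt i u == a then F`_i@_u else 0.
Proof.
rewrite coef_poly; case: ltnP => [_|h]; first exact: coef_wpart.
by rewrite (nth_default _ h) mcoeff0; case: ifP.
Qed.

Lemma size_wcomp a F : (size (wcomp a F) <= size F)%N. Proof. exact: size_poly. Qed.

Lemma poly_mcoeffP F H : (forall i u, F`_i@_u = H`_i@_u) -> F = H.
Proof. by move=> h; apply/polyP => i; apply/mpolyP => u. Qed.

Lemma wcompD a F H : wcomp a (F + H) = wcomp a F + wcomp a H.
Proof.
apply: poly_mcoeffP => i u; rewrite coefD mcoeffD !coef_wcomp coefD mcoeffD.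
by case: ifP; rewrite ?addr0.
Qed.

Lemma wcomp0 a : wcomp a 0 = 0.
Proof. by apply: poly_mcoeffP => i u; rewrite coef_wcomp coef0 mcoeff0; case: ifP. Qed.

Lemma wcompN a F : wcomp a (- F) = - wcomp a F.
Proof.
apply: poly_mcoeffP => i u; rewrite coefN mcoeffN !coef_wcomp coefN mcoeffN.
by case: ifP; rewrite ?oppr0.
Qed.

Lemma wcompB a F H : wcomp a (F - H) = wcomp a F - wcomp a H.
Proof. by rewrite wcompD wcompN. Qed.

Lemma wcomp_id a F : wcomp a (wcomp a F) = wcomp a F.
Proof. by apply: poly_mcoeffP => i u; rewrite !coef_wcomp; case: (wt i u == a). Qed.

Lemma wge0 a : wge a 0.
Proof. by move=> i u; rewrite coef0 mcoeff0 eqxx. Qed.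

Lemma wgeD a F H : wge a F -> wge a H -> wge a (F + H).
Proof.
move=> hF hH i u; rewrite coefD mcoeffD => h.
have [e|] := eqVneq (F`_i@_u) 0; last exact: hF.
by apply: hH; rewrite e add0r in h.
Qed.

Lemma wgeN a F : wge a F -> wge a (- F).
Proof. by move=> hF i u; rewrite coefN mcoeffN oppr_eq0; apply: hF. Qed.

Lemma wgeB a F H : wge a F -> wge a H -> wge a (F - H).
Proof. by move=> hF hH; apply: wgeD => //; apply: wgeN. Qed.

Lemma wge_le a b F : a <= b -> wge b F -> wge a F.
Proof. by move=> ab hF i u /hF; apply: le_trans. Qed.

Lemma wge_wcomp a F : wge a (wcomp a F).
Proof. by move=> i u; rewrite coef_wcomp; case: (wt i u =P a) => [->|_]; rewrite ?eqxx ?lexx. Qed.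

Lemma wcomp_lt a b F : a < b -> wge b F -> wcomp a F = 0.
Proof.
move=> ab hF; apply: poly_mcoeffP => i u; rewrite coef_wcomp coef0 mcoeff0.
case: eqP => // e; apply: contrapT => /eqP/hF; rewrite e => ba.
by move: ab; rewrite og_ltNge ba.
Qed.

Let coefM2 F H i u : (F * H)`_i@_u = \sum_(j < i.+1)
  \sum_(v : 'X_{1..N < (mdeg u).+1, (mdeg u).+1} | u == (v.1 + v.2)%MM)
     (F`_j@_v.1 * H`_(i - j)@_v.2).
Proof. by rewrite coefM raddf_sum; apply: eq_bigr => j _; rewrite /= mcoeffM. Qed.

Let wt_split i j u (v w : 'X_{1..N}) : (j <= i)%N -> u = (v + w)%MM ->
  wt i u = wt j v + wt (i - j) w.
Proof. by move=> ji ->; rewrite -wtD subnKC. Qed.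

Lemma wgeM a b F H : wge a F -> wge b H -> wge (a + b) (F * H).
Proof.
move=> hF hH i u; rewrite coefM2 => h; apply: contrapT => nle; move/eqP: h; apply.
rewrite big1 // => j _; rewrite big1 // => v /eqP uv.
have [->|F0] := eqVneq (F`_j@_v.1) 0; first by rewrite mul0r.
have [->|H0] := eqVneq (H`_(i - j)@_v.2) 0; first by rewrite mulr0.
case: nle; rewrite (wt_split (leq_ord j) uv).
by apply: og_leD; [apply: hF | apply: hH].
Qed.

Lemma wcompM a b F H : wge a F -> wge b H -> wcomp (a + b) (F * H) = wcomp a F * wcomp b H.
Proof.
move=> hF hH; apply: poly_mcoeffP => i u; rewrite coef_wcomp !coefM2.
rewrite (_ : (if _ then _ else _) = \sum_(j < i.+1)
  \sum_(v : 'X_{1..N < (mdeg u).+1, (mdeg u).+1} | u == (v.1 + v.2)%MM)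
     (if wt i u == a + b then F`_j@_v.1 * H`_(i - j)@_v.2 else 0)); last first.
  by case: ifP => // _; rewrite big1 // => j _; rewrite big1.
apply: eq_bigr => j _; apply: eq_bigr => v /eqP uv; rewrite !coef_wcomp.
rewrite (wt_split (leq_ord j) uv).
have [->|F0] := eqVneq (F`_j@_v.1) 0; first by rewrite !if_same !mul0r if_same.
have [->|H0] := eqVneq (H`_(i - j)@_v.2) 0; first by rewrite !if_same !mulr0 if_same.
have := hF _ _ F0; have := hH _ _ H0 => le2 le1.
case: (eqVneq (wt j v.1) a) => [->|na].
  by rewrite (inj_eq (addrI _)); case: eqP => //; rewrite mulr0.
rewrite mul0r; case: eqP => // e.
by have [e' _] := og_eqD le1 le2 (esym e); rewrite e' eqxx in na.
Qed.

Lemma wcompMl a b F H : wcomp b H = H -> wcomp a (F * H) = wcomp (a - b) F * H.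
Proof.
move=> hH; apply: poly_mcoeffP => i u; rewrite coef_wcomp !coefM2.
rewrite (_ : (if _ then _ else _) = \sum_(j < i.+1)
  \sum_(v : 'X_{1..N < (mdeg u).+1, (mdeg u).+1} | u == (v.1 + v.2)%MM)
     (if wt i u == a then F`_j@_v.1 * H`_(i - j)@_v.2 else 0)); last first.
  by case: ifP => // _; rewrite big1 // => j _; rewrite big1.
apply: eq_bigr => j _; apply: eq_bigr => v /eqP uv; rewrite !coef_wcomp.
rewrite (wt_split (leq_ord j) uv) -hH coef_wcomp.
case: (wt (i - j) v.2 =P b) => [->|_]; last by rewrite !mulr0 if_same.
by rewrite eq_sym -subr_eq [a - b == _]eq_sym; case: ifP => // _; rewrite mul0r.
Qed.

Lemma wcomp_polyC a (c : A) : wcomp a c%:P = (wpart a 0 c)%:P.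
Proof.
apply/polyP => i; apply/mpolyP => u; rewrite coef_wcomp !coefC.
by case: (i =P 0%N) => [->|_]; rewrite ?coef_wpart // mcoeff0 if_same.
Qed.

Definition is_wt a F := wge a F /\ wcomp a F != 0.

Lemma is_wt_le a b F : is_wt a F -> wge b F -> b <= a.
Proof.
move=> [_ a0] hb; apply: contrapT => /negP; rewrite -og_ltNge => ab.
by rewrite (wcomp_lt ab hb) eqxx in a0.
Qed.

Lemma is_wt_unique a b F : is_wt a F -> is_wt b F -> a = b.
Proof.
move=> ha hb; apply/eqP; rewrite eq_le.
by rewrite (is_wt_le hb ha.1) (is_wt_le ha hb.1).
Qed.

Lemma is_wt_exists F : F != 0 -> exists a, is_wt a F.
Proof.
move=> F0; pose s := [seq (i, u) | i <- iota 0 (size F), u <- msupp F`_i].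
have sP i u : F`_i@_u != 0 -> (i, u) \in s.
  move=> h; apply/allpairsPdep; exists i, u; split=> //; last by rewrite mcoeff_msupp.
  rewrite mem_iota /= add0n ltnNge; apply: contra h => /(nth_default _)->.
  by rewrite mcoeff0.
have [x xs] : exists x, x \in s.
  have l0 : lead_coef F != 0 by rewrite lead_coef_eq0.
  exists ((size F).-1, mlead (lead_coef F)); apply: sP.
  by rewrite -lead_coefE mleadc_eq0.
have [[i u] ius hmin] := seq_min_exists (fun x => wt x.1 x.2) xs.
exists (wt i u); split; first by move=> j v /sP/hmin.
apply/eqP => /polyP/(_ i)/mpolyP/(_ u); rewrite coef_wcomp eqxx coef0 mcoeff0 => /eqP.
move: ius => /allpairsPdep[j [v [_]]]; rewrite mcoeff_msupp => h [-> ->].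
by rewrite (negPf h).
Qed.

Lemma wge_gt a b F : wge a F -> wcomp a F = 0 -> is_wt b F -> a < b.
Proof.
move=> ha a0 hb; rewrite lt_def (is_wt_le hb ha) andbT.
by apply/eqP => e; case: hb => _; rewrite e a0 eqxx.
Qed.

Section Reduction.
Variables (P : {poly A}) (p : G).
Hypotheses (Pm : P \is monic) (Pw : wge p P) (P0m : wcomp p P \is monic).
Hypothesis P0s : size (wcomp p P) = size P.

Let red0 Q (r : {poly A}) : (size r < size P)%N -> Q * wcomp p P + r = 0 -> Q = 0 /\ r = 0.
Proof.
move=> rs e; suff Q0 : Q = 0 by move: e; rewrite Q0 mul0r add0r.
apply/eqP; apply: contraTT rs => Q0; rewrite -leqNgt.
move/eqP: e; rewrite addr_eq0 => /eqP e; rewrite -[size r]size_polyN -e size_Mmonic //.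
rewrite P0s; move: Q0; rewrite -size_poly_gt0; move: (size Q) (size P) => x z; lia.
Qed.

(** Division by P does not lower weights. Otherwise let c < a be the least weight in Q * P and r.
    The components there satisfy Q_c * P_0 + r_c = 0, with P_0 monic of the size of P and r_c
    smaller, so both vanish. *)
Lemma wge_rdiv a F Q (r : {poly A}) : F = Q * P + r -> (size r < size P)%N -> wge a F ->
  wge a r /\ wge (a - p) Q.
Proof.
move=> e rs aF.
have [Q0|Q0] := eqVneq Q 0; first by rewrite Q0 mul0r add0r in e; rewrite -e Q0; split=> //; apply: wge0.
have [q hq] := is_wt_exists Q0.
suff aq : a <= q + p.
  have hQ : wge (a - p) Q by apply: wge_le hq.1; rewrite -(og_leD2r p) subrK.
  split=> //; have -> : r = F - Q * P by rewrite e addrC addKr.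
  apply: wgeB => //; rewrite -(subrK p a); exact: wgeM.
apply: contrapT => /negP; rewrite -og_ltNge => qa.
have key c : wge (c - p) Q -> wge c r -> c < a -> wcomp (c - p) Q = 0 /\ wcomp c r = 0.
  move=> cQ cr ca; apply: red0; first exact: leq_ltn_trans (size_wcomp _ _) rs.
  by rewrite -wcompM // subrK -wcompD -e (wcomp_lt ca).
have [r0|r0] := eqVneq r 0.
  have [||h _] := key (q + p) _ _ qa; rewrite ?addrK ?r0; [exact: hq.1 | exact: wge0 |].
  by case: hq => _; rewrite -[q in wcomp q](addrK p) h eqxx.
have [b hb] := is_wt_exists r0.
have [qb|bq] := orP (og_total (q + p) b).
  have [||h _] := key (q + p) _ _ qa; rewrite ?addrK; [exact: hq.1 | exact: wge_le hb.1 |].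
  by case: hq => _; rewrite -[q in wcomp q](addrK p) h eqxx.
have [|_ h] := key b _ hb.1 (le_lt_trans bq qa).
  by apply: wge_le hq.1; rewrite -(og_leD2r p) subrK.
by case: hb => _; rewrite h eqxx.
Qed.

Hypothesis prime0 : forall a b F H Q, wcomp a F != 0 -> wcomp b H != 0 ->
  (size F < size P)%N -> (size H < size P)%N ->
  wcomp a F * wcomp b H = Q * wcomp p P -> False.

(* The product of the initial forms of F and H is not a multiple of that of P, so
   its reduction modulo the latter is the initial form of r. *)
Lemma is_wt_mod a b F H (r Q : {poly A}) : is_wt a F -> is_wt b H ->
  (size F < size P)%N -> (size H < size P)%N -> F * H = Q * P + r -> (size r < size P)%N ->
  is_wt (a + b) r.
Proof.
move=> [aF a0] [bH b0] sF sH e sr.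
have [hr hQ] := wge_rdiv e sr (wgeM aF bH); split=> //; apply/eqP => r0.
apply: (prime0 a0 b0 sF sH (Q := wcomp (a + b - p) Q)).
by rewrite -wcompM // e wcompD r0 addr0 -[in LHS](subrK p (a + b)) wcompM.
Qed.

End Reduction.

End Weights.

Section DeglexWeights.
Variables (m E : nat).
Local Notation N := m.+2.
Local Notation x0 := (ord0 : 'I_N).
Local Notation x1 := (ord1' m).

Definition high (j : 'I_m) : 'I_N := lift ord0 (lift ord0 j).

Lemma deglexP (x y : deglex m) : x.1 = y.1 -> (forall j, x.2 0 j = y.2 0 j) -> x = y.
Proof. by case: x y => [a u] [b v] /= -> h; congr pair; apply/rowP. Qed.

Lemma deglex_lt_first (x y : deglex m) : y.1 < x.1 -> x < y.
Proof.
move=> yx; rewrite og_ltNge deglex_leE leEprodlexi leEdual /=.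
by rewrite leNgt yx.
Qed.

Lemma deglex_le_zero (x y : deglex m) : x.1 = y.1 -> x.2 = 0 -> (forall j, 0 <= y.2 0 j) ->
  x <= y.
Proof.
move=> e x0 y0; rewrite deglex_leE leEprodlexi leEdual /= e lexx /= x0.
apply/implyP => _; elim: (enum _) => [|i s IHs]; first by rewrite lexi0s.
by rewrite /= lexi_cons mxE IHs y0 implybT.
Qed.

(* The weight of y ^ u theta ^ i. *)
Definition dwt (i : nat) (u : 'X_{1..N}) : deglex m :=
  ((mdeg u + E * i)%N%:Z, \row_(j < m) (u (high j))%:Z).

Lemma dwtD i j u v : dwt (i + j) (u + v)%MM = dwt i u + dwt j v.
Proof.
apply: deglexP => [|l].
  rewrite -[RHS]/((mdeg u + E * i)%N%:Z + (mdeg v + E * j)%N%:Z) -PoszD.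
  by rewrite -[LHS]/((mdeg (u + v)%MM + E * (i + j))%N%:Z) mdegD mulnDr addnACA.
by rewrite -[RHS]/(((dwt i u).2 + (dwt j v).2) 0 l) !mxE mnmDE PoszD.
Qed.

Lemma mdeg_split (u : 'X_{1..N}) : mdeg u = (u x0 + (u x1 + \sum_(j < m) u (high j)))%N.
Proof. by rewrite mdegE !big_ord_recl. Qed.

Lemma ord_high (i : 'I_N) : [\/ i = x0, i = x1 | exists j, i = high j].
Proof.
case: (unliftP ord0 i) => [i' ->|->]; last by constructor 1.
case: (unliftP ord0 i') => [i'' ->|->]; last by constructor 2.
by constructor 3; exists i''.
Qed.

(** The vector part determines the exponents of y_2, ..., y_d; the total degree then determines that
    of y_0 from that of y_1. *)
Lemma dwt_inj i u v : dwt i u = dwt i v -> u x1 = v x1 -> u = v.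
Proof.
move=> e e1.
have hh j : u (high j) = v (high j).
  have := congr1 (fun x : deglex m => x.2 0 j) e.
  by rewrite !mxE => -[].
have := congr1 (fun x : deglex m => x.1) e; rewrite /= => -[] /addIn.
rewrite !mdeg_split e1 (eq_bigr (fun j => v (high j))); last by move=> j _; rewrite hh.
move=> /addIn e0; apply/mnmP => l.
by have [->|->|[j ->]] := ord_high l.
Qed.

Section Prime.
Variables (k : closedFieldType).
Local Notation A := {mpoly k[N]}.
Variables (P : {poly A}).
Hypothesis Pm : P \is monic.
Hypothesis Phom : forall i u, P`_i@_u != 0 -> (mdeg u + E * i = E * (size P).-1)%N.
Hypothesis Pirr : monic_irreducible (map_poly (@axis_line k m) P).

(* The weight and the exponent of X_1 determine a monomial, so ones_line is
   injective on initial forms; on that of P it coincides with axis_line. *)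
Definition ones_line : A -> {poly k} := mmap polyC (fun i : 'I_N => if i == x1 then 'X else 1).
HB.instance Definition _ := GRing.RMorphism.on ones_line.

Local Notation p := (dwt (size P).-1 0%MM).

Lemma ones_lineE (f : A) : ones_line f = \sum_(u <- msupp f) (f@_u)%:P * 'X^(u x1).
Proof.
rewrite /ones_line /mmap; apply: eq_bigr => u _; congr (_ * _).
rewrite /mmap1 (bigD1 x1) //= big1 ?mulr1 // => i /negPf->.
by rewrite expr1n.
Qed.

Lemma axis_lineE (f : A) : axis_line f =
  \sum_(u <- msupp f) (if [forall j, u (high j) == 0%N] then (f@_u)%:P * 'X^(u x1) else 0 : {poly k}).
Proof.
rewrite /axis_line /mmap; apply: eq_bigr => u _.
case: forallP => h.
  congr (_ * _); rewrite /mmap1 (bigD1 x1) //= big1 ?mulr1 // => i i1.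
  have [->|e|[j ->]] := ord_high i; first by rewrite expr1n.
    by rewrite e eqxx in i1.
  by rewrite (eqP (h j)) expr0.
have [j hj] : exists j, u (high j) != 0%N.
  by apply: contrapT => h'; apply: h => j; apply: contrapT => /negP hj; apply: h'; exists j.
rewrite /mmap1 (bigD1 (high j)) //=.
by rewrite expr0n (negPf hj) mul0r mulr0.
Qed.

(** P is weighted homogeneous, so its monomials of weight p are those free of y_2, ..., y_d, and on
    them it does not matter whether these variables become 1 or 0. *)
Lemma ones_lead : map_poly ones_line (wcomp dwt p P) = map_poly (@axis_line k m) P.
Proof.
apply/polyP => i; rewrite !coef_map /= axis_lineE coef_poly.
have -> : (if (i < size P)%N then wpart dwt p i P`_i else 0) = wpart dwt p i P`_i.
  case: ltnP => // h; rewrite (nth_default _ h) /wpart big1_seq // => u.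
  by rewrite msupp0 andbF.
rewrite /wpart rmorph_sum /= [LHS]big_mkcond; apply: eq_big_seq => u; rewrite mcoeff_msupp => hu.
have -> : (dwt i u == p) = [forall j, u (high j) == 0%N].
  apply/eqP/forallP => [e j|h].
    have := congr1 (fun x : deglex m => x.2 0 j) e; rewrite !mxE mnm0E => -[->].
    exact: eqxx.
  apply: deglexP => [|j]; last by rewrite !mxE mnm0E (eqP (h j)).
  by rewrite /= Phom // mdeg0.
case: ifP => // _; rewrite -mul_mpolyC rmorphM /= /ones_line mmapC mmapX; congr (_ * _).
rewrite /mmap1 (bigD1 x1) //= big1 ?mulr1 // => l /negPf->.
by rewrite expr1n.
Qed.

Lemma ones_wcomp_neq0 a F : wcomp dwt a F != 0 -> map_poly ones_line (wcomp dwt a F) != 0.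
Proof.
set H := wcomp dwt a F => H0.
have wH i u : H`_i@_u != 0 -> dwt i u = a.
  by rewrite coef_wcomp; case: (dwt i u =P a) => //; rewrite eqxx.
pose i := (size H).-1; have l0 : lead_coef H != 0 by rewrite lead_coef_eq0.
pose u := mlead (lead_coef H).
have Hu : H`_i@_u != 0 by rewrite -lead_coefE mleadc_eq0.
apply/eqP => /polyP/(_ i)/polyP/(_ (u x1))/eqP; apply/negP.
rewrite coef_map coef0 coef0 /= ones_lineE coef_sum (bigD1_seq u) ?msupp_uniq ?mcoeff_msupp //=.
rewrite coefCM coefXn eqxx mulr1 big1_seq ?addr0 // => v /andP[vu vs].
rewrite coefCM coefXn; case: eqP => e; last by rewrite mulr0.
case/eqP: vu; apply: (@dwt_inj i) => //.
by rewrite (wH i u Hu); apply: wH; rewrite -mcoeff_msupp.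
Qed.

Lemma lead_prime a b F H Q : wcomp dwt a F != 0 -> wcomp dwt b H != 0 ->
  (size F < size P)%N -> (size H < size P)%N ->
  wcomp dwt a F * wcomp dwt b H = Q * wcomp dwt p P -> False.
Proof.
move=> F0 H0 sF sH /(congr1 (map_poly ones_line)); rewrite !rmorphM /= ones_lead.
have sP : size (map_poly (@axis_line k m) P) = size P.
  by rewrite size_map_poly_id0 // (monicP Pm) rmorph1 oner_eq0.
apply: monic_irreducible_prime => //; first exact: monic_map.
- exact: ones_wcomp_neq0.
- exact: ones_wcomp_neq0.
- rewrite sP; apply: leq_ltn_trans sF; apply: leq_trans (size_poly _ _) (size_wcomp _ _ _).
- rewrite sP; apply: leq_ltn_trans sH; apply: leq_trans (size_poly _ _) (size_wcomp _ _ _).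
Qed.

(** Homogeneity equalizes the first components, and exponents are nonnegative, so the leading power
    of the polynomial variable has least weight. *)
Lemma lead_wge : wge dwt p P.
Proof.
move=> i u /Phom e; apply: deglex_le_zero.
- by rewrite /= e mdeg0.
- by apply/rowP => j; rewrite !mxE mnm0E.
- by move=> j; rewrite mxE.
Qed.

Lemma lead_coefn : (wcomp dwt p P)`_(size P).-1 = 1.
Proof.
apply/mpolyP => u; rewrite coef_wcomp -lead_coefE (monicP Pm) mcoeff1.
by have [->|] := eqVneq u 0%MM; rewrite ?eqxx // if_same.
Qed.

Lemma lead_size : size (wcomp dwt p P) = size P.
Proof.
apply/eqP; rewrite eqn_leq size_wcomp /=.
have P0 : (0 < size P)%N by rewrite size_poly_gt0 monic_neq0.
rewrite -(prednK P0) ltnNge; apply/negP => /(nth_default 0)/eqP.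
by rewrite lead_coefn oner_eq0.
Qed.

Lemma lead_monic : wcomp dwt p P \is monic.
Proof. by rewrite monicE lead_coefE lead_size lead_coefn. Qed.

Lemma dwt_mod a b F H (r Q : {poly A}) : is_wt dwt a F -> is_wt dwt b H ->
  (size F < size P)%N -> (size H < size P)%N -> F * H = Q * P + r -> (size r < size P)%N ->
  is_wt dwt (a + b) r.
Proof. exact: (is_wt_mod dwtD Pm lead_wge lead_monic lead_size lead_prime). Qed.

End Prime.
End DeglexWeights.

(** * The valuation *)

Section VeroneseValuation.
Variables (k : closedFieldType) (R : comAlgType k) (gR : grading R).
Hypothesis hdom : GRing.integral_domain_axiom R.
Local Notation "f \in_ i" := (f \in hpiece gR i) (at level 70).
Hypothesis h1 : 1 \in_ 0%N.
Variables (m M : nat) (y : 'I_m.+2 -> R) (E : nat) (theta : R) (l : nat).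
Local Notation A := {mpoly k[m.+2]}.
Variables (delta : A) (P : {poly A}).
Hypotheses (M0 : (0 < M)%N) (hy : forall i, y i \in_ M) (tE : theta \in_ (M * E)).
Hypotheses (d0 : delta != 0) (dl : delta \is l.-homog).
Hypotheses (Pm : P \is monic) (Pmin : minimal_annihilator y theta P).
Hypothesis Pgen : forall j f, f \in_ (M * j) -> exists F, mev y delta * f = evt y theta F.
Hypothesis Pirr : monic_irreducible (map_poly (@axis_line k m) P).
Local Notation wt := (@dwt m E).
Implicit Types (F : {poly A}) (f g : R) (a b : deglex m).

Let sP : (1 < size P)%N := minimal_annihilator_size Pm Pmin.

Lemma evt_inj F F' : (size F < size P)%N -> (size F' < size P)%N ->
  evt y theta F = evt y theta F' -> F = F'.
Proof.
move=> s s' e; apply/eqP; rewrite -subr_eq0; apply/eqP; apply: Pmin.2.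
  by rewrite rmorphB /= e subrr.
by apply: leq_ltn_trans (size_polyD _ _) _; rewrite gtn_max size_polyN s s'.
Qed.

Lemma wproj_id F j : (size F < size P)%N -> evt y theta F \in_ (M * j) -> wproj E j F = F.
Proof.
move=> sF hF; apply: evt_inj => //; first exact: leq_ltn_trans (size_wproj _ _ _) sF.
by rewrite -(hcomp_evt h1 M0 hy tE) (hcomp_id hF).
Qed.

Lemma wproj_homog F j i u : wproj E j F = F -> F`_i@_u != 0 -> (mdeg u + E * i = j)%N.
Proof.
move=> <-; rewrite coef_wproj; case: ifP => [le|_]; last by rewrite mcoeff0 eqxx.
rewrite -mcoeff_msupp => /(dhomogP _ _ _ (pihomogP _ _ _))-> /=.
by rewrite subnK.
Qed.

(** P minus its component in the weight of its leading term annihilates theta and is smaller than P,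
    hence 0. *)
Let Phom i u : P`_i@_u != 0 -> (mdeg u + E * i = E * (size P).-1)%N.
Proof.
apply: wproj_homog; set n := (size P).-1.
apply/eqP; rewrite -subr_eq0; apply/eqP; apply: Pmin.2.
  by rewrite rmorphB /= -(hcomp_evt h1 M0 hy tE) Pmin.1 hcomp0 subrr.
have P0 : (0 < size P)%N by apply: ltnW.
rewrite -[X in (_ < X)%N](prednK P0) -/n ltnS; apply/leq_sizeP => i'; rewrite leq_eqVlt.
move=> /orP[/eqP<-|ni]; rewrite coefB.
  rewrite coef_wproj leqnn subnn -[P`_n]/(lead_coef P) (monicP Pm).
  by rewrite pihomog_dE ?subrr // dhomog1.
rewrite !nth_default ?subrr //; first by rewrite -(prednK P0).
by apply: leq_trans (size_wproj _ _ _) _; rewrite -(prednK P0).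
Qed.

Let wt_mod := dwt_mod Pm Phom Pirr.

Definition reduced f F := (size F < size P)%N /\ evt y theta F = mev y delta * f.

Lemma reduced_exists j f : f \in_ (M * j) -> exists F, reduced f F.
Proof.
move=> /Pgen[F e]; exists (Pdiv.Ring.rmodp F P); split.
  by rewrite Pdiv.Ring.ltn_rmodpN0 // monic_neq0.
rewrite e [in RHS](Pdiv.RingMonic.rdivp_eq Pm F) rmorphD rmorphM /= Pmin.1.
by rewrite mulr0 add0r.
Qed.

Lemma reduced_unique f F F' : reduced f F -> reduced f F' -> F = F'.
Proof. by move=> [s e] [s' e']; apply: evt_inj; rewrite // e e'. Qed.

Lemma reducedD f g F H : reduced f F -> reduced g H -> reduced (f + g) (F + H).
Proof.
move=> [s e] [s' e']; split; last by rewrite rmorphD /= e e' mulrDr.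
by apply: leq_ltn_trans (size_polyD _ _) _; rewrite gtn_max s s'.
Qed.

Lemma reduced_mev f F c : reduced f F -> reduced (mev y c * f) (c%:P * F).
Proof.
move=> [s e]; split; last by rewrite rmorphM /= evtC e mulrCA.
by rewrite mul_polyC; apply: leq_ltn_trans (size_scale_leq _ _) s.
Qed.

Lemma reduced_const c : reduced (mev y c) (delta * c)%:P.
Proof.
split; last by rewrite evtC rmorphM.
exact: leq_ltn_trans (size_polyC_leq1 _) sP.
Qed.

Lemma delta_neq0 : mev y delta != 0.
Proof.
apply/eqP => e; move/eqP: d0; apply; apply/polyC_inj/Pmin.2; first by rewrite evtC.
exact: leq_ltn_trans (size_polyC_leq1 _) sP.
Qed.

Lemma reduced_neq0 f F : reduced f F -> f != 0 -> F != 0.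
Proof.
move=> [_ e]; apply: contra_neq => F0; move: e; rewrite F0 rmorph0 => /esym/eqP.
by rewrite (dom_mulf_eq0 hdom) (negPf delta_neq0) => /eqP.
Qed.

Let dw_ex : exists a, is_wt wt a delta%:P.
Proof. by apply: is_wt_exists; rewrite polyC_eq0. Qed.

Definition delta_wt : deglex m := projT1 (cid dw_ex).
Lemma delta_wtP : is_wt wt delta_wt delta%:P.
Proof. exact: (projT2 (cid dw_ex)). Qed.

Definition has_val f a := exists2 F, reduced f F & is_wt wt (a + delta_wt) F.

Lemma has_val_unique f a b : has_val f a -> has_val f b -> a = b.
Proof.
move=> [F rF hF] [F' rF' hF']; apply: (addIr delta_wt).
by apply: (is_wt_unique hF); rewrite (reduced_unique rF rF').
Qed.

Lemma has_val_exists j f : f \in_ (M * j) -> f != 0 -> exists a, has_val f a.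
Proof.
move=> fj f0; have [F rF] := reduced_exists fj.
have [a ha] := is_wt_exists wt (reduced_neq0 rF f0).
by exists (a - delta_wt), F => //; rewrite subrK.
Qed.

Definition wval f : deglex m := if pselect (exists a, has_val f a) is left e
  then projT1 (cid e) else 0.

Lemma wvalP j f : f \in_ (M * j) -> f != 0 -> has_val f (wval f).
Proof.
move=> fj f0; rewrite /wval; case: pselect => [e|]; first exact: (projT2 (cid e)).
by case; apply: has_val_exists fj f0.
Qed.

Lemma wval_unique f a : has_val f a -> wval f = a.
Proof.
move=> ha; rewrite /wval; case: pselect => [e|]; last by case; exists a.
exact: has_val_unique (projT2 (cid e)) ha.
Qed.

(** Multiplication by c needs no reduction modulo P, so this is [wt_mod] with quotient 0. *)
Lemma is_wt_mulC a b F c : is_wt wt a F -> is_wt wt b c%:P -> (size F < size P)%N ->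
  is_wt wt (a + b) (c%:P * F).
Proof.
move=> ha hb sF; apply: (wt_mod (Q := 0) ha hb sF _ _ _).
- exact: leq_ltn_trans (size_polyC_leq1 _) sP.
- by rewrite mul0r add0r mulrC.
- by rewrite mul_polyC; apply: leq_ltn_trans (size_scale_leq _ _) sF.
Qed.

Lemma has_valM i j f g a b : f \in_ (M * i) -> g \in_ (M * j) -> f * g != 0 ->
  has_val f a -> has_val g b -> has_val (f * g) (a + b).
Proof.
move=> fi gj fg0 [F [sF eF] hF] [H [sH eH] hH].
have fgij : f * g \in_ (M * (i + j)) by rewrite mulnDr; apply: hpieceM.
have [r rr] := reduced_exists fgij; exists r => //.
have [c hc] := is_wt_exists wt (reduced_neq0 rr fg0).
have e : F * H = Pdiv.Ring.rdivp (F * H) P * P + Pdiv.Ring.rmodp (F * H) P.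
  exact: Pdiv.RingMonic.rdivp_eq.
have sr : (size (Pdiv.Ring.rmodp (F * H)%R P) < size P)%N.
  by rewrite Pdiv.Ring.ltn_rmodpN0 // monic_neq0.
have h3 := wt_mod hF hH sF sH e sr.
(* F and H carry one factor delta each, the reduced form r of f * g only one; so F * H reduces to
   delta * r, and comparing weights cancels one [delta_wt]. *)
have e2 : Pdiv.Ring.rmodp (F * H) P = delta%:P * r.
  apply: evt_inj => //.
    by rewrite mul_polyC; apply: leq_ltn_trans (size_scale_leq _ _) rr.1.
  have := congr1 (evt y theta) e; rewrite rmorphM rmorphD !rmorphM /= Pmin.1 mulr0 add0r => <-.
  by rewrite eF eH evtC rr.2; ring.
have := is_wt_mulC hc delta_wtP rr.1; rewrite -e2 => h4.
have := is_wt_unique h3 h4 => e3.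
suff -> : a + b + delta_wt = c by [].
by apply: (addIr delta_wt); rewrite -e3; rewrite !addrA -!addrA; congr (_ + _); rewrite addrCA.
Qed.

Lemma wvalM i j f g : f \in_ (M * i) -> g \in_ (M * j) -> f != 0 -> g != 0 ->
  wval (f * g) = wval f + wval g.
Proof.
move=> fi gj f0 g0; apply: wval_unique; apply: has_valM fi gj _ (wvalP fi f0) (wvalP gj g0).
exact: dom_mulf_neq0.
Qed.

Lemma wval_add j f g : f \in_ (M * j) -> g \in_ (M * j) -> f != 0 -> g != 0 -> f + g != 0 ->
  Order.min (wval f) (wval g) <= wval (f + g).
Proof.
move=> fj gj f0 g0 fg0; have [F rF hF] := wvalP fj f0; have [H rH hH] := wvalP gj g0.
have [r rr hr] := wvalP (hpD fj gj) fg0.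
rewrite -(og_leD2r delta_wt); apply: is_wt_le hr _.
rewrite (reduced_unique rr (reducedD rF rH)); apply: wgeD.
  apply: wge_le hF.1; rewrite og_leD2r.
  by have [[-> //]|[-> //]] := og_minP (wval f) (wval g).
apply: wge_le hH.1; rewrite og_leD2r.
by have [[-> //]|[-> //]] := og_minP (wval f) (wval g).
Qed.

Lemma is_wt_attained a F : is_wt wt a F -> exists i u, F`_i@_u != 0 /\ wt i u = a.
Proof.
move=> [_ h]; apply: contrapT => nex; move/eqP: h; apply; apply: poly_mcoeffP => i u.
rewrite coef_wcomp coef0 mcoeff0; case: eqP => // e.
by apply: contrapT => /eqP hn; apply: nex; exists i, u.
Qed.

Lemma delta_wt_first : delta_wt.1 = l%:Z.
Proof.
have [i [u [hu <-]]] := is_wt_attained delta_wtP; move: hu.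
rewrite coefC; case: (i =P 0%N) => [->|_]; last by rewrite mcoeff0 eqxx.
by rewrite -mcoeff_msupp => /(dhomogP _ _ _ dl) /= ->; rewrite muln0 addn0.
Qed.

Lemma reduced_homog j f F i u : f \in_ (M * j) -> reduced f F -> F`_i@_u != 0 ->
  (mdeg u + E * i = l + j)%N.
Proof.
move=> fj [sF eF]; apply: wproj_homog; apply: wproj_id => //.
by rewrite eF mulnDr; apply: hpieceM => //; apply: (mev_piece h1 hy dl).
Qed.

Lemma wval_first j f : f \in_ (M * j) -> f != 0 -> (wval f).1 = j%:Z.
Proof.
move=> fj f0; have [F rF hF] := wvalP fj f0.
have [i [u [hu e]]] := is_wt_attained hF.
have := congr1 (fun x : deglex m => x.1) e; rewrite /= (reduced_homog fj rF hu) PoszD.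
by rewrite [X in _ = X]/= delta_wt_first addrC => /addIr.
Qed.

Lemma has_val_mev b c : is_wt wt b c%:P -> has_val (mev y c) b.
Proof.
move=> hb; exists (delta * c)%:P; first exact: reduced_const.
rewrite addrC mulrC polyCM; apply: is_wt_mulC delta_wtP hb _.
exact: leq_ltn_trans (size_polyC_leq1 _) sP.
Qed.

End VeroneseValuation.

(** * From the Veronese subring to R *)

Section DegreeOfElements.
Variables (k : closedFieldType) (R : comAlgType k) (gR : grading R).
Hypothesis hdom : GRing.integral_domain_axiom R.
Local Notation "f \in_ i" := (f \in hpiece gR i) (at level 70).
Implicit Types f g : R.

Lemma has_degree_exists f : f != 0 -> exists n, has_degree gR f n.
Proof.
move=> f0; have [n fn _] := hcomp_total gR f.
elim: n fn => [|n IH] fn.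
  by case/eqP: f0; apply: hcomp_eq0 => i; apply: fn.
have [e|] := eqVneq (hcomp gR n f) 0; last by exists n; split.
by apply: IH => i; rewrite leq_eqVlt => /orP[/eqP<-//|]; apply: fn.
Qed.

Lemma has_degree_unique f a b : has_degree gR f a -> has_degree gR f b -> a = b.
Proof.
move=> [a0 ha] [b0 hb]; case: (ltngtP a b) => // h.
  by rewrite (ha _ h) eqxx in b0.
by rewrite (hb _ h) eqxx in a0.
Qed.

Lemma has_degree_piece f i : f \in_ i -> f != 0 -> has_degree gR f i.
Proof.
move=> fi f0; split; first by rewrite (hcomp_id fi).
by move=> j ij; rewrite (hcompE _ fi) gtn_eqF.
Qed.

Lemma has_degree_sum f n : has_degree gR f n -> f = \sum_(i < n.+1) hcomp gR i f.
Proof.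
move=> [_ fn]; have [N fN {1}->] := hcomp_total gR f.
have wid a b : (a <= b)%N -> (forall i, (a <= i)%N -> hcomp gR i f = 0) ->
    \sum_(i < b) hcomp gR i f = \sum_(i < a) hcomp gR i f.
  move=> ab h; rewrite -(subnKC ab) big_split_ord /= [X in _ + X]big1 ?addr0 // => i _.
  by rewrite h // leq_addr.
by have [nN|Nn] := leqP n.+1 N; [apply: wid | rewrite (wid N n.+1) // ltnW].
Qed.

Lemma has_degreeM f g a b : has_degree gR f a -> has_degree gR g b ->
  has_degree gR (f * g) (a + b) /\ hcomp gR (a + b) (f * g) = hcomp gR a f * hcomp gR b g.
Proof.
move=> ha hb.
have key n : (a + b <= n)%N -> hcomp gR n (f * g) = hcomp gR a f * hcomp gR (n - a) g.
  move=> abn; rewrite [in LHS](has_degree_sum ha) mulr_suml hcomp_sumE (bigD1 ord_max) //=.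
  have an : (a <= n)%N by apply: leq_trans abn; apply: leq_addr.
  rewrite -[n in hcomp gR n (hcomp gR a f * g)](subnKC an) (hcompM _ _ (hcomp_piece _ _ _)).
  rewrite big1 ?addr0 // => i; rewrite -val_eqE /= => ia.
  have ia' : (i < a)%N by rewrite ltn_neqAle ia -ltnS ltn_ord.
  have in' : (i <= n)%N by apply: leq_trans an; apply: ltnW.
  rewrite -(subnKC in') (hcompM _ _ (hcomp_piece _ _ _)) hb.2 ?mulr0 //.
  by rewrite ltn_subRL; apply: leq_trans abn; rewrite ltn_add2r.
have e : hcomp gR (a + b) (f * g) = hcomp gR a f * hcomp gR b g by rewrite key // addKn.
split=> //; split; first by rewrite e (dom_mulf_neq0 hdom) ?ha.1 ?hb.1.
move=> i abi; rewrite key ?(ltnW abi) // hb.2 ?mulr0 //.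
by rewrite ltn_subRL.
Qed.

End DegreeOfElements.

Section Extension.
Variables (k : closedFieldType) (R : comAlgType k) (gR : grading R).
Hypothesis hdom : GRing.integral_domain_axiom R.
Local Notation "f \in_ i" := (f \in hpiece gR i) (at level 70).
Hypothesis h1 : 1 \in_ 0%N.
Variables (m M : nat) (w : R -> deglex m).
Hypothesis M0 : (0 < M)%N.
Hypothesis wM : forall i j f g, f \in_ (M * i) -> g \in_ (M * j) -> f != 0 -> g != 0 ->
  w (f * g) = w f + w g.
Hypothesis wD : forall j f g, f \in_ (M * j) -> g \in_ (M * j) -> f != 0 -> g != 0 ->
  f + g != 0 -> Order.min (w f) (w g) <= w (f + g).
Hypothesis w_first : forall j f, f \in_ (M * j) -> f != 0 -> (w f).1 = j%:Z.
Hypothesis wC : forall c : k, c != 0 -> w c%:A = 0.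
Implicit Types f g : R.

Lemma dom_expf_neq0 f n : f != 0 -> f ^+ n != 0.
Proof.
move=> f0; elim: n => [|n IH]; first by rewrite expr0 oner_neq0.
by rewrite exprS dom_mulf_neq0.
Qed.

Let alg_neq0 (c : k) : c != 0 -> c%:A != 0 :> R.
Proof. by move=> c0; rewrite scaler_eq0 negb_or c0 oner_neq0. Qed.

Lemma wX i f n : f \in_ (M * i) -> f != 0 -> w (f ^+ n) = w f *+ n.
Proof.
move=> fi f0; elim: n => [|n IH].
  by rewrite expr0 mulr0n -(wC (oner_neq0 k)) scale1r.
have fn : f ^+ n \in_ (M * (i * n)) by rewrite mulnA; apply: (hpX h1).
by rewrite exprS mulrS -IH; apply: (wM fi fn f0); apply: dom_expf_neq0.
Qed.

Let pw i f : f \in_ i -> f ^+ M \in_ (M * i).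
Proof. by move=> fi; rewrite mulnC; apply: (hpX h1). Qed.

Lemma homog_valM i j f g : f \in_ i -> g \in_ j -> f != 0 -> g != 0 ->
  w ((f * g) ^+ M) = w (f ^+ M) + w (g ^+ M).
Proof. by move=> fi gj f0 g0; rewrite exprMn (wM (pw fi) (pw gj)) ?dom_expf_neq0. Qed.

(* Multiplying by h := f ^+ M.-1 moves a sum in R_i into the piece of degree M * i. *)
Lemma homog_valD i f g : f \in_ i -> g \in_ i -> f != 0 -> g != 0 -> f + g != 0 ->
  Order.min (w (f ^+ M)) (w (g ^+ M)) <= w ((f + g) ^+ M).
Proof.
move=> fi gi f0 g0 fg0; pose h := f ^+ M.-1.
have h0 : h != 0 by apply: dom_expf_neq0.
have hi : h \in_ (i * M.-1) by apply: (hpX h1).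
have hu u : u \in_ i -> h * u \in_ (M * i).
  move=> ui; have -> : (M * i = i * M.-1 + i)%N by rewrite -{1}(prednK M0) mulSn mulnC addnC.
  exact: hpieceM.
have key u : u \in_ i -> u != 0 -> w (h ^+ M) + w (u ^+ M) = w (h * u) *+ M.
  move=> ui u0; rewrite -(homog_valM hi ui h0 u0) (wX M (hu u ui)) //.
  exact: dom_mulf_neq0.
have hfg : h * f + h * g != 0 by rewrite -mulrDr dom_mulf_neq0.
have := wD (hu f fi) (hu g gi) (dom_mulf_neq0 hdom h0 f0) (dom_mulf_neq0 hdom h0 g0) hfg.
rewrite -mulrDr => h3.
have efg := key _ (hpD fi gi) fg0.
have ef := key f fi f0; have eg := key g gi g0.
rewrite -(og_leD2l (w (h ^+ M))) efg.
have [[e h2]|[e h2]] := og_minP (w (h * f)) (w (h * g)); rewrite e in h3.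
  apply: le_trans (og_leMn M h3); rewrite -ef og_leD2l.
  by have [[-> //]|[-> //]] := og_minP (w (f ^+ M)) (w (g ^+ M)).
apply: le_trans (og_leMn M h3); rewrite -eg og_leD2l.
by have [[-> //]|[-> //]] := og_minP (w (f ^+ M)) (w (g ^+ M)).
Qed.

Definition ext_val f : deglex m := if pselect (exists n, has_degree gR f n) is left e
  then w (hcomp gR (projT1 (cid e)) f ^+ M) else 0.

Lemma ext_valE f n : has_degree gR f n -> ext_val f = w (hcomp gR n f ^+ M).
Proof.
move=> fn; rewrite /ext_val; case: pselect => [e|]; last by case; exists n.
by rewrite (has_degree_unique (projT2 (cid e)) fn).
Qed.

Lemma ext_val_piece i f : f \in_ i -> f != 0 -> ext_val f = w (f ^+ M).
Proof. by move=> fi f0; rewrite (ext_valE (has_degree_piece fi f0)) (hcomp_id fi). Qed.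

(** The top component of f to the power M lies in degree M * n, and w records n for that piece, so
    no rescaling is left. *)
Lemma ext_val_first f n : has_degree gR f n -> (ext_val f).1 = n%:Z.
Proof.
move=> fn; rewrite (ext_valE fn); apply: w_first; first exact/pw/hcomp_piece.
exact/dom_expf_neq0/fn.1.
Qed.

Fact ext_valM f g : f != 0 -> g != 0 -> ext_val (f * g) = ext_val f + ext_val g.
Proof.
move=> /(has_degree_exists gR)[a fa] /(has_degree_exists gR)[b gb].
have [fgab e] := has_degreeM hdom fa gb.
rewrite (ext_valE fgab) e (ext_valE fa) (ext_valE gb).
by apply: (homog_valM (hcomp_piece _ _ _) (hcomp_piece _ _ _)); [exact: fa.1 | exact: gb.1].
Qed.

Fact ext_valZ (c : k) f : c != 0 -> f != 0 -> ext_val (c *: f) = ext_val f.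
Proof.
move=> c0 f0; rewrite -mulr_algl ext_valM ?alg_neq0 //.
rewrite (ext_val_piece (hpZ _ h1)) ?alg_neq0 //.
rewrite -(in_algE R c) -rmorphXn /= wC ?add0r //; exact: expf_neq0.
Qed.

(** A summand of degree above that of the sum has smaller value by the first component, whose order
    is reversed. Otherwise the top component of the sum is that of one summand, or the sum of two
    nonzero ones of equal degree, the case of [homog_valD]. *)
Fact ext_valD f g : f != 0 -> g != 0 -> f + g != 0 ->
  Order.min (ext_val f) (ext_val g) <= ext_val (f + g).
Proof.
move=> f0 g0 fg0.
have [a fa] := has_degree_exists gR f0; have [b gb] := has_degree_exists gR g0.
have [c fgc] := has_degree_exists gR fg0.
have minl : Order.min (ext_val f) (ext_val g) <= ext_val f.
  by have [[-> //]|[-> //]] := og_minP (ext_val f) (ext_val g).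
have minr : Order.min (ext_val f) (ext_val g) <= ext_val g.
  by have [[-> //]|[-> //]] := og_minP (ext_val f) (ext_val g).
have lt u n : has_degree gR u n -> (c < n)%N -> ext_val u < ext_val (f + g).
  move=> un cn; apply: deglex_lt_first.
  by rewrite (ext_val_first un) (ext_val_first fgc) ltz_nat.
have [ca|ac] := ltnP c a; first exact: le_trans minl (ltW (lt _ _ fa ca)).
have [cb|bc] := ltnP c b; first exact: le_trans minr (ltW (lt _ _ gb cb)).
have ec := hcompD gR c f g.
have [fc0|fc0] := eqVneq (hcomp gR c f) 0.
  have gc0 : hcomp gR c g != 0 by move: fgc.1; rewrite ec fc0 add0r.
  have e : c = b.
    apply/eqP; rewrite eqn_leq bc andbT leqNgt; apply/negP => /gb.2 e.
    by rewrite e eqxx in gc0.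
  apply: le_trans minr _; rewrite (ext_valE fgc) ec fc0 add0r e.
  by rewrite (ext_valE gb).
have eca : c = a.
  apply/eqP; rewrite eqn_leq ac andbT leqNgt; apply/negP => /fa.2 e.
  by rewrite e eqxx in fc0.
have [gc0|gc0] := eqVneq (hcomp gR c g) 0.
  apply: le_trans minl _; rewrite (ext_valE fgc) ec gc0 addr0 eca.
  by rewrite (ext_valE fa).
have ecb : c = b.
  apply/eqP; rewrite eqn_leq bc andbT leqNgt; apply/negP => /gb.2 e.
  by rewrite e eqxx in gc0.
rewrite (ext_valE fgc) ec (ext_valE fa) (ext_valE gb) -eca -ecb.
by apply: (@homog_valD c) => //; try exact: hcomp_piece; rewrite -ec; exact: fgc.1.
Qed.

Definition ext_valuation : valuation R (deglex m) := Valuation ext_valD ext_valM ext_valZ.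

Lemma ext_valuation_homogeneous : homogeneous_valuation gR ext_valuation.
Proof.
move=> f f0; have [n fn] := has_degree_exists gR f0.
have e i : hcomp gR i f != 0 -> ext_val (hcomp gR i f) = w (hcomp gR i f ^+ M).
  by move=> fi0; apply: (ext_val_piece (hcomp_piece gR i f)).
split; first by exists n; [exact: fn.1 | rewrite /= (ext_valE fn) (e _ fn.1)].
move=> i fi0; have : (i <= n)%N.
  by rewrite leqNgt; apply/negP => /fn.2 h; rewrite h eqxx in fi0.
rewrite leq_eqVlt => /orP[/eqP->|lt]; first by rewrite /= (ext_valE fn) (e _ fn.1).
apply/ltW/deglex_lt_first => /=; rewrite (ext_val_first fn).
by rewrite (ext_val_first (has_degree_piece (hcomp_piece gR i f) fi0)) ltz_nat.
Qed.

End Extension.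

(** * Rank in the lexicographic value group *)

Section DeglexRank.
Variable m : nat.

Definition deglex_coord (t : 'I_m.+1) (x : deglex m) : int :=
  if unlift ord0 t is Some j then x.2 0 j else x.1.

Lemma deglex_coordP x : (forall t, deglex_coord t x = 0) -> x = 0.
Proof.
move=> h; apply: deglexP => [|j]; first by have := h ord0; rewrite /deglex_coord unlift_none.
by have := h (lift ord0 j); rewrite /deglex_coord liftK mxE.
Qed.

Lemma deglex_coord0 t : deglex_coord t 0 = 0.
Proof. by rewrite /deglex_coord; case: unlift => // j; rewrite mxE. Qed.

Lemma deglex_coordD t : {morph deglex_coord t : x z / x + z}.
Proof. by move=> x z; rewrite /deglex_coord; case: unlift => // j; rewrite mxE. Qed.

Lemma deglex_coordN t : {morph deglex_coord t : x / - x}.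
Proof. by move=> x; rewrite /deglex_coord; case: unlift => // j; rewrite mxE. Qed.

Lemma deglex_coordMn t n : {morph deglex_coord t : x / x *+ n}.
Proof.
move=> x; elim: n => [|n IH]; first by rewrite !mulr0n deglex_coord0.
by rewrite !mulrS deglex_coordD IH.
Qed.

Lemma deglex_coord_sum n (x : 'I_n -> deglex m) (c : 'I_n -> int) t :
  deglex_coord t (\sum_i x i *~ c i) = \sum_i deglex_coord t (x i) * c i.
Proof.
rewrite (big_morph (deglex_coord t) (deglex_coordD t) (deglex_coord0 t)).
apply: eq_bigr => i _; rewrite -mulrzz; case: (c i) => l; first exact: deglex_coordMn.
by rewrite NegzE !mulrNz deglex_coordN; congr (- _); apply: deglex_coordMn.
Qed.

Lemma common_denominator n (l : 'I_n -> rat) :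
  exists (D : int) (c : 'I_n -> int), D != 0 /\ forall i, (c i)%:~R = D%:~R * l i :> rat.
Proof.
exists (\prod_i denq (l i)), (fun i => (\prod_(j | j != i) denq (l j)) * numq (l i)).
split=> [|i]; first by apply/prodf_neq0 => i _; apply: denq_neq0.
rewrite [\prod_j denq (l j)](bigD1 i) //= !intrM numqE.
by ring.
Qed.

(** Too many elements are dependent over the rationals, and clearing denominators gives an integral
    relation. *)
Lemma deglex_rank_le n (x : 'I_n -> deglex m) : Z_independent x -> (n <= m.+1)%N.
Proof.
move=> xi; rewrite leqNgt; apply/negP => lt.
pose A i t : rat := (deglex_coord t (x i))%:~R.
have [||l [[i li] e]] := @linear_dependence rat 'rV[rat]_m.+1 'I_n 'I_m.+1
    (fun i => \row_t A i t) (fun t => delta_mx 0 t) A.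
- by move=> i; rewrite {1}[\row_t _]row_sum_delta; apply: eq_bigr => t _; rewrite mxE.
- by rewrite !card_ord.
have [D [c [D0 cE]]] := common_denominator l.
have c0 j : c j = 0.
  apply: xi; apply: deglex_coordP => t; rewrite deglex_coord_sum.
  apply/eqP; rewrite -(intr_eq0 rat) rmorph_sum /=; apply/eqP.
  transitivity (D%:~R * \sum_i l i * A i t).
    by rewrite mulr_sumr; apply: eq_bigr => s _; rewrite rmorphM /= cE mulrC mulrA.
  have := congr1 (fun z : 'rV[rat]_m.+1 => z 0 t) e; rewrite summxE mxE => e'.
  rewrite (_ : \sum_i _ = 0) ?mulr0 // -[RHS]e'; apply: eq_bigr => s _.
  by rewrite !mxE.
move/eqP: li; apply; have := cE i; rewrite c0 => /esym/eqP.
by rewrite mulf_eq0 intr_eq0 (negPf D0) => /eqP.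
Qed.

End DeglexRank.

(** * Finite generation of the graded algebra *)

Section SubalgClosed.
Variables (k : fieldType) (B : comAlgType k) (U : {pred B}).
Hypothesis hU : GRing.subalg_closed U.

Lemma subalg_in1 : 1 \in U. Proof. by case: hU. Qed.

Lemma subalg_inM x z : x \in U -> z \in U -> x * z \in U. Proof. by case: hU => _ _; apply. Qed.

Lemma subalg_in0 : 0 \in U.
Proof. by case: hU => u1 lin _; rewrite -(addNr 1) -scaleN1r; apply: lin. Qed.

Lemma subalg_inD x z : x \in U -> z \in U -> x + z \in U.
Proof. by case: hU => _ lin _ xU zU; rewrite -[x]scale1r; apply: lin. Qed.

Lemma subalg_inZ (c : k) x : x \in U -> c *: x \in U.
Proof. by case: hU => _ lin _ xU; rewrite -[c *: x]addr0; apply: lin subalg_in0. Qed.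

End SubalgClosed.

Section GradedAlgebra.
Variables (k : closedFieldType) (R : comAlgType k) (G : ordGroupType) (v : valuation R G).
Implicit Types (f g : R) (a b : G).

Lemma in_Rge a f : f != 0 -> (f \in Rge v a) = (a <= v f).
Proof. by move=> f0; rewrite inE (negPf f0). Qed.

Lemma in_Rgt a f : f != 0 -> (f \in Rgt v a) = (a < v f).
Proof. by move=> f0; rewrite inE (negPf f0). Qed.

Lemma Rge_self f : f \in Rge v (v f). Proof. by rewrite inE lexx orbT. Qed.

Lemma gr_in_sub a f g : f \in Rge v a -> g \in Rge v a -> f - g \in Rgt v a ->
  gr_in v a f = gr_in v a g.
Proof.
move=> fa ga fg; apply: gr_eqP => b /=; rewrite /gr_in_fun.
by case: eqP => // ->; apply/eqP; rewrite gr_class_eq.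
Qed.

Lemma gr_in_add a f g : f \in Rge v a -> g \in Rge v a ->
  gr_in v a (f + g) = gr_in v a f + gr_in v a g.
Proof.
move=> fa ga; apply: gr_eqP => b; rewrite gr_compD /= /gr_in_fun.
by case: eqP => [->|_]; rewrite ?addr0 // gr_classD.
Qed.

Lemma gr_in0 a : gr_in v a 0 = 0.
Proof.
by apply: gr_eqP => b /=; rewrite /gr_in_fun gr_class0 if_same.
Qed.

Lemma gr_imageM f g : f != 0 -> g != 0 -> gr_image v (f * g) = gr_image v f * gr_image v g.
Proof. by move=> f0 g0; rewrite /gr_image gr_inM ?Rge_self // vfun_mul. Qed.

Lemma gr_in_sum (U : {pred assoc_gr v}) a (I : Type) (r : seq I) (F : I -> R) (Q : pred I) :
    GRing.subalg_closed U ->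
    (forall i, Q i -> F i \in Rge v a /\ gr_in v a (F i) \in U) ->
  \sum_(i <- r | Q i) F i \in Rge v a /\ gr_in v a (\sum_(i <- r | Q i) F i) \in U.
Proof.
move=> hU h; elim/big_rec: _ => [|i x Qi [xa xU]].
  by rewrite gr_in0 rpred0 subalg_in0.
have [fa fU] := h i Qi.
by rewrite rpredD // gr_in_add // subalg_inD.
Qed.

Lemma gr_image1 : gr_image v 1 = 1.
Proof.
rewrite /gr_image (_ : v 1 = 0) //; apply: (addrI (v 1)).
by rewrite addr0 -vfun_mul ?oner_neq0 // mulr1.
Qed.

Hypothesis hdom : GRing.integral_domain_axiom R.

Lemma gr_image_exp (U : {pred assoc_gr v}) f n : GRing.subalg_closed U -> f != 0 ->
  gr_image v f \in U -> gr_image v (f ^+ n) \in U.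
Proof.
move=> hU f0 fU; elim: n => [|n IH]; first by rewrite expr0 gr_image1 subalg_in1.
by rewrite exprS gr_imageM ?subalg_inM //; apply: dom_expf_neq0.
Qed.

Lemma gr_image_prod (U : {pred assoc_gr v}) n (f : 'I_n -> R) (e : 'I_n -> nat) :
    GRing.subalg_closed U -> (forall i, f i != 0) -> (forall i, gr_image v (f i) \in U) ->
  \prod_i f i ^+ e i != 0 /\ gr_image v (\prod_i f i ^+ e i) \in U.
Proof.
move=> hU f0 fU; elim/big_rec: _ => [|i x _ [x0 xU]].
  by rewrite oner_neq0 gr_image1 subalg_in1.
have fi0 : f i ^+ e i != 0 by apply: dom_expf_neq0.
by rewrite (dom_mulf_neq0 hdom) // gr_imageM // subalg_inM // gr_image_exp.
Qed.

End GradedAlgebra.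

Lemma int_sub_shift (n a b c : nat) : n%:Z = (a + b)%N%:Z - (a + c)%N%:Z -> (b = n + c)%N.
Proof. lia. Qed.

Lemma is_wt_monomial (k : fieldType) N (G : ordGroupType) (wt : nat -> 'X_{1..N} -> G)
  (u : 'X_{1..N}) (c : k) : c != 0 -> is_wt wt (wt 0%N u) (c *: 'X_[u] : {mpoly k[N]})%:P.
Proof.
move=> c0; split=> [i u'|].
  rewrite coefC; case: (i =P 0%N) => [->|_]; last by rewrite mcoeff0 eqxx.
  rewrite mcoeffZ mcoeffX; case: (u =P u') => [->|_]; first by rewrite lexx.
  by rewrite mulr0 eqxx.
have e : (wcomp wt (wt 0%N u) (c *: 'X_[u])%:P)`_0@_u = c.
  by rewrite coef_wcomp coefC !eqxx mcoeffZ mcoeffX eqxx mulr1.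
by apply/eqP => e0; move: c0; rewrite -e e0 coef0 mcoeff0 eqxx.
Qed.

Section GradedFinite.
Variables (k : closedFieldType) (R : comAlgType k) (gR : grading R).
Hypothesis hdom : GRing.integral_domain_axiom R.
Local Notation "f \in_ i" := (f \in hpiece gR i) (at level 70).
Hypothesis h1 : 1 \in_ 0%N.
Variables (m M : nat) (y : 'I_m.+2 -> R) (E : nat) (theta : R) (l : nat).
Local Notation A := {mpoly k[m.+2]}.
Variables (delta : A) (P : {poly A}).
Hypotheses (M0 : (0 < M)%N) (hy : forall i, y i \in_ M) (tE : theta \in_ (M * E)).
Hypotheses (d0 : delta != 0) (dl : delta \is l.-homog).
Hypotheses (Pm : P \is monic) (Pmin : minimal_annihilator y theta P).
Hypothesis Pgen : forall j f, f \in_ (M * j) -> exists F, mev y delta * f = evt y theta F.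
Hypothesis Pirr : monic_irreducible (map_poly (@axis_line k m) P).
Local Notation wt := (@dwt m E).
Local Notation w := (wval y E theta P d0).
Local Notation red := (reduced y theta delta P).
Local Notation dw := (delta_wt E d0).
Implicit Types (F : {poly A}) (f g : R) (a b : deglex m) (u : 'X_{1..m.+2}).

Let w_mul i j f g : f \in_ (M * i) -> g \in_ (M * j) -> f != 0 -> g != 0 ->
  w (f * g) = w f + w g.
Proof. exact: (wvalM hdom h1 M0 hy tE d0 Pm Pmin Pgen Pirr). Qed.

Let w_add j f g : f \in_ (M * j) -> g \in_ (M * j) -> f != 0 -> g != 0 -> f + g != 0 ->
  Order.min (w f) (w g) <= w (f + g).
Proof. exact: (wval_add hdom E d0 Pm Pmin Pgen). Qed.

Let w_fst j f : f \in_ (M * j) -> f != 0 -> (w f).1 = j%:Z.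
Proof. exact: (wval_first hdom h1 M0 hy tE d0 dl Pm Pmin Pgen). Qed.

Let w_monomial u (c : k) : c != 0 -> w (mev y (c *: 'X_[u])) = wt 0 u.
Proof.
move=> c0; apply: (wval_unique Pmin); apply: (has_val_mev h1 M0 hy tE d0 Pm Pmin Pirr).
exact: is_wt_monomial.
Qed.

Let w_const (c : k) : c != 0 -> w c%:A = 0.
Proof.
move=> c0; have -> : c%:A = mev y (c *: 'X_[0%MM]) by rewrite mevZ mpolyX0 rmorph1.
rewrite w_monomial //; apply: deglexP => [|j]; rewrite /= ?mdeg0 ?muln0 //.
by rewrite !mxE mnm0E.
Qed.

Definition veronese_valuation : valuation R (deglex m) :=
  ext_valuation hdom h1 M0 w_mul w_add w_fst w_const.
Local Notation v := veronese_valuation.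

Lemma veronese_valuation_homogeneous : homogeneous_valuation gR v.
Proof. exact: ext_valuation_homogeneous. Qed.

Lemma veronese_valuation_first f n : has_degree gR f n -> (v f).1 = n%:Z.
Proof. exact: (ext_val_first hdom h1 w_fst). Qed.

Let v_veronese j f : f \in_ (M * j) -> f != 0 -> v f = w f *+ M.
Proof.
move=> fj f0; rewrite -(wX hdom h1 w_mul w_const _ fj f0).
exact: (ext_val_piece M w fj f0).
Qed.

Lemma mev_neq0 (c : A) : c != 0 -> mev y c != 0.
Proof.
move=> c0; apply/eqP => e; move/eqP: c0; apply; apply/polyC_inj/Pmin.2; first by rewrite evtC.
exact: leq_ltn_trans (size_polyC_leq1 _) (minimal_annihilator_size Pm Pmin).
Qed.

Let mon_neq0 u : mev y 'X_[u] != 0.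
Proof.
apply: mev_neq0; apply/eqP => /mpolyP/(_ u)/eqP.
by rewrite mcoeffX eqxx mcoeff0 oner_eq0.
Qed.

Let v_monomial u : v (mev y 'X_[u]) = wt 0 u *+ M.
Proof.
rewrite (v_veronese (mevX_piece h1 hy u) (mon_neq0 u)) -{1}[mpolyX _ u]scale1r.
by rewrite w_monomial ?oner_neq0.
Qed.

Let v_class h f a j : h * f \in_ (M * j) -> h != 0 -> f != 0 -> has_val y E theta P d0 (h * f) a ->
  v f = a *+ M - v h.
Proof.
move=> hfj h0 f0 ha; apply/eqP; rewrite eq_sym subr_eq addrC -vfun_mul //; apply/eqP.
by rewrite (v_veronese hfj) ?(dom_mulf_neq0 hdom) // (wval_unique Pmin ha).
Qed.

Lemma gr_monomial (U : {pred assoc_gr v}) u : GRing.subalg_closed U ->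
  (forall j, gr_image v (y j) \in U) -> gr_image v (mev y 'X_[u]) \in U.
Proof.
move=> hU yU; rewrite mevX; have [|//] := gr_image_prod hdom u hU _ yU; move=> i.
by rewrite -mevXU mon_neq0.
Qed.

(* Multiplication by h moves the pieces of degree congruent to i0 into the Veronese
   subring. *)
Section ResidueClass.
Variables (i0 : nat) (f0 : R).
Hypotheses (f0i : f0 \in_ i0) (f00 : f0 != 0).
Local Notation h := (f0 ^+ M.-1).

Let hh : h \in_ (i0 * M.-1). Proof. exact: (hpX h1). Qed.
Let h0 : h != 0. Proof. exact: dom_expf_neq0. Qed.

(** Records f through h * f: j is the index of its Veronese piece, and [wcomp wt a F] is the initial
    form that stands for f. *)
Definition lead_datum i j f a F :=
  [/\ f \in_ i /\ f != 0, (i0 * M.-1 + i = M * j)%N, red (h * f) F & is_wt wt a F].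

Let datum_in i j f a F : lead_datum i j f a F -> h * f \in_ (M * j).
Proof. by case=> [[fi _] <- _ _]; apply: hpieceM. Qed.

Let datum_val i j f a F : lead_datum i j f a F -> v f = (a - dw) *+ M - v h.
Proof.
move=> hf; have := datum_in hf; case: hf => [[fi fn0] _ rF hF] hfj.
by apply: (v_class hfj) => //; exists F; rewrite ?subrK.
Qed.

Let datum_first i j f a F : lead_datum i j f a F -> a.1 = (l + j)%N%:Z.
Proof.
move=> hf; have hfj := datum_in hf; case: hf => [_ _ rF hF].
have [i' [u [hu <-]]] := is_wt_attained hF.
by rewrite /= (reduced_homog h1 M0 hy tE dl Pmin hfj rF hu).
Qed.

(** Only the part c' of c of weight a - a' contributes in weight a. Each monomial of c' takes f' to
    an element with the degree and the value of f, so the class of S in grade [v f] lies in U even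
    when terms cancel. *)
Let lead_multiple (U : {pred assoc_gr v}) i j f a F i' j' f' a' F' (c : A) :
    GRing.subalg_closed U -> (forall j, gr_image v (y j) \in U) -> gr_image v f' \in U ->
    lead_datum i j f a F -> lead_datum i' j' f' a' F' ->
  exists S C, [/\ S \in_ i, S \in Rge v (v f) /\ gr_in v (v f) S \in U,
    red (h * S) C, wge wt a C & wcomp wt a C = wcomp wt a (c *: wcomp wt a' F')].
Proof.
move=> hU yU fU hf hf'; pose c' := wpart wt (a - a') 0 c.
have c'E : c'%:P = wcomp wt (a - a') c%:P by rewrite wcomp_polyC.
have ef := datum_val hf; have ef' := datum_val hf'.
have e1 := datum_first hf; have e1' := datum_first hf'.
case: hf => [[fi fn0] ij rF hF]; case: hf' => [[fi' fn0'] ij' rF' hF'].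
have term u : c'@_u != 0 -> wt 0 u = a - a'.
  by rewrite coef_wpart; case: (wt 0 u =P a - a') => //; rewrite eqxx.
have e : mev y c' * f' = \sum_(u <- msupp c') c'@_u *: (mev y 'X_[u] * f').
  rewrite {1}[c']mpolyE rmorph_sum mulr_suml; apply: eq_bigr => u _ /=.
  by rewrite mevZ scalerAl.
exists (mev y c' * f'), (c'%:P * F'); split.
- rewrite e; apply: hp_sum => u _; have [->|/term eu] := eqVneq (c'@_u) 0.
    by rewrite scale0r hp0.
  apply: hpZ; have ei : i = (M * mdeg u + i')%N.
    have := congr1 fst eu; rewrite /= e1 e1' muln0 addn0 => eu1.
    have ej := int_sub_shift eu1.
    by apply: (@addnI (i0 * M.-1)); rewrite ij ej mulnDr -ij' addnCA.
  by rewrite ei; apply: hpieceM => //; apply: (mevX_piece h1 hy).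
- rewrite e big_seq; apply: gr_in_sum => // u; rewrite mcoeff_msupp => cu.
  have t0 : mev y 'X_[u] * f' != 0 by rewrite (dom_mulf_neq0 hdom) ?mon_neq0.
  have et : v (mev y 'X_[u] * f') = v f.
    rewrite vfun_mul ?mon_neq0 // v_monomial ef ef' (term _ cu) addrA -mulrnDl.
    by rewrite addrA subrK.
  have tge : mev y 'X_[u] * f' \in Rge v (v f) by rewrite -et Rge_self.
  split; first by rewrite rpredZ.
  rewrite -gr_inZ // subalg_inZ // -et -[gr_in _ _ _]/(gr_image v _) gr_imageM ?mon_neq0 //.
  by rewrite subalg_inM // gr_monomial.
- by rewrite mulrCA; apply: reduced_mev.
- by rewrite -[a in wge _ a](subrK a') c'E; apply: (wgeM (@dwtD m E)); [apply: wge_wcomp | case: hF'].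
rewrite -[a in LHS](subrK a') (wcompM (@dwtD m E)) ?c'E ?wcomp_id.
- by rewrite -mul_polyC (wcompMl (@dwtD m E) _ (b := a')) ?wcomp_id.
- exact: wge_wcomp.
by case: hF'.
Qed.

Let datum_exists i f : (i = i0 %[mod M])%N -> f \in_ i -> f != 0 ->
  exists j a F, lead_datum i j f a F.
Proof.
move=> e fi fn0; have /dvdnP[j ej] : (M %| i0 * M.-1 + i)%N.
  by rewrite /dvdn -modnDmr e modnDmr -mulnSr prednK // modnMl.
have hfj : h * f \in_ (M * j) by rewrite mulnC -ej; apply: hpieceM.
have [F rF] := reduced_exists Pm Pmin Pgen hfj.
have hf0 : h * f != 0 by rewrite (dom_mulf_neq0 hdom).
have [a hF] := is_wt_exists wt (reduced_neq0 hdom d0 Pm Pmin rF hf0).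
by exists j, a, F; split=> //; rewrite ej mulnC.
Qed.

(** Finitely many initial forms t span all those of the residue class over A. Expressing the initial
    form of f through t yields S in the same piece with the same initial form; then f - S is 0 or
    has larger value, so f and S have the same class. *)
Lemma class_finite : exists s : seq R, forall (U : {pred assoc_gr v}) i f,
  GRing.subalg_closed U -> (forall j, gr_image v (y j) \in U) ->
  (forall q, q \in s -> gr_image v q \in U) ->
  (i = i0 %[mod M])%N -> f \in_ i -> f != 0 -> gr_image v f \in U.
Proof.
pose X (H : {poly A}) := exists i j f a F, lead_datum i j f a F /\ H = wcomp wt a F.
have [t tX Xt] : exists2 t : seq {poly A}, (forall H, H \in t -> X H) &
    (forall H, X H -> lspan (fun H => H \in t) H).
  apply: (@noetherian_bounded A (size P)); first exact: (@noetherian_mpoly k _ (@noetherian_field k)).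
  move=> _ [i [j [f [a [F [[_ _ [sF _] _] ->]]]]]].
  by apply: leq_trans (size_wcomp _ _ _) _; apply: ltnW.
have [q qP] : exists q : {poly A} -> R, forall H, H \in t ->
    exists i j a F, lead_datum i j (q H) a F /\ H = wcomp wt a F.
  have ex (H : {poly A}) : exists f, H \in t -> exists i j a F, lead_datum i j f a F /\ H = wcomp wt a F.
    have [/tX[i [j [f [a [F hF]]]]]|nt] := boolP (H \in t); last by exists 0.
    by exists f => _; exists i, j, a, F.
  by have [q hq] := choice ex; exists q.
exists (map q t) => U i f hU yU tU ei fi fn0.
have [j [a [F hf]]] := datum_exists ei fi fn0.
have [S [C [Si [Sv SU] rC wC eC]]] : exists S C, [/\ S \in_ i,
    S \in Rge v (v f) /\ gr_in v (v f) S \in U, red (h * S) C, wge wt a C &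
    wcomp wt a C = wcomp wt a (wcomp wt a F)].
  have XF : X (wcomp wt a F) by exists i, j, f, a, F.
  elim: (Xt _ XF) => [|c H W Ht _ [S [C [Si [Sv SU] rC wC eC]]]].
    exists 0, 0; split; rewrite ?hp0 ?wcomp0 //; last exact: wge0.
      by rewrite gr_in0 rpred0 subalg_in0.
    by split; rewrite ?size_poly0 ?mulr0 ?rmorph0 ?(leq_trans _ (minimal_annihilator_size Pm Pmin)).
  have [i' [j' [a' [F' [hf' eH]]]]] := qP H Ht.
  have qU : gr_image v (q H) \in U by apply: tU; apply: map_f.
  have [S' [C' [Si' [Sv' SU'] rC' wC' eC']]] := lead_multiple c hU yU qU hf hf'.
  exists (S' + S), (C' + C); split; first exact: hpD.
  - by rewrite rpredD // gr_in_add // subalg_inD.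
  - by rewrite mulrDr; apply: reducedD.
  - exact: wgeD.
  by rewrite !wcompD eC eC' -eH.
suff eS : gr_in v (v f) f = gr_in v (v f) S by rewrite -[gr_image v f]/(gr_in v (v f) f) eS.
apply: gr_in_sub; [exact: Rge_self | exact: Sv |].
have [->|g0] := eqVneq (f - S) 0; first by rewrite rpred0.
have gi : f - S \in_ i by apply: hpB.
have [j' [a' [F' hg]]] := datum_exists ei gi g0.
(* Both values arise from weights by the same shifts and the factor M, so weights can be compared
   instead. *)
rewrite in_Rgt // (datum_val hf) (datum_val hg) ![_ - v h]addrC og_ltD2l.
apply: og_ltMn => //; rewrite ![_ - dw]addrC og_ltD2l.
case: hf => [_ _ rF hF]; case: hg => [_ _ rF' hF'].
have rg : red (h * (f - S)) (F - C).
  rewrite mulrBr -[- C]mulN1r -[- (h * S)]mulN1r.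
  have -> : -1 = mev y (-1 : A) by rewrite rmorphN1.
  have -> : -1 = (-1 : A)%:P by rewrite polyCN.
  by apply: reducedD => //; apply: reduced_mev.
rewrite -(reduced_unique Pmin rg rF') in hF'.
apply: wge_gt hF'; first by apply: wgeB => //; case: hF.
by rewrite wcompB eC wcomp_id subrr.
Qed.

End ResidueClass.
Lemma veronese_khovanskii : exists B : seq R, khovanskii_basis v [set` B]%classic.
Proof.
have ex (c : 'I_M) : exists s : seq R, forall (U : {pred assoc_gr v}) i f,
    GRing.subalg_closed U -> (forall j, gr_image v (y j) \in U) ->
    (forall q, q \in s -> gr_image v q \in U) ->
    (i = c %[mod M])%N -> f \in_ i -> f != 0 -> gr_image v f \in U.
  have [[i0 [f0 [e [f0i f00]]]]|no] :=
      pselect (exists i0 f0, (i0 = c %[mod M])%N /\ (f0 \in_ i0 /\ f0 != 0)).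
    have [s sP] := class_finite f0i f00; exists s => U i f hU yU sU ei.
    by apply: sP => //; rewrite ei e.
  by exists [::] => U i f hU yU sU ei fi fn0; case: no; exists i, f.
have [s sP] := choice ex.
exists (codom y ++ flatten [seq s c | c <- enum 'I_M]) => U hU BU x.
have yU j : gr_image v (y j) \in U.
  by apply: BU; exists (y j) => //=; rewrite mem_cat codom_f.
have sU c q : q \in s c -> gr_image v q \in U.
  move=> qs; apply: BU; exists q => //=; rewrite mem_cat; apply/orP; right.
  by apply/flattenP; exists (s c) => //; apply: map_f; rewrite mem_enum.
have homU i f : f \in_ i -> f != 0 -> gr_image v f \in U.
  move=> fi fn0; apply: (sP (Ordinal (ltn_pmod i M0)) U i f) => //; first exact: sU.
  by rewrite /= modn_mod.
elim/gr_ind: x => [|x z xU zU|a f fa]; first exact: subalg_in0.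
  exact: subalg_inD.
(* Unless its class is 0, f has value exactly a. Subtracting the top component leaves lower degree,
   hence larger value, so f may be replaced by that component. *)
have [ft|nft] := boolP (f \in Rgt v a).
  have -> : gr_in v a f = gr_in v a 0 by apply: gr_in_sub; [exact: fa | exact: rpred0 | rewrite subr0].
  by rewrite gr_in0 subalg_in0.
have fn0 : f != 0 by apply: contra nft => /eqP->; rewrite rpred0.
have va : v f = a.
  apply/eqP; rewrite eq_le -(in_Rge _ _ fn0) fa andbT.
  by move: nft; rewrite in_Rgt // og_ltNge negbK.
have [n fn] := has_degree_exists gR fn0; have tn0 := fn.1.
have vt : v (hcomp gR n f) = a.
  rewrite -va; have tP := hcomp_piece gR n f.
  by rewrite [RHS](ext_valE M w fn) [LHS](ext_val_piece M w tP tn0).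
suff -> : gr_in v a f = gr_in v a (hcomp gR n f).
  by rewrite -vt; apply: homU (hcomp_piece _ _ _) tn0.
apply: gr_in_sub; [exact: fa | rewrite -[X in Rge v X]vt; exact: Rge_self |].
have [->|g0] := eqVneq (f - hcomp gR n f) 0; first by rewrite rpred0.
have [n' gn'] := has_degree_exists gR g0.
have gE i : hcomp gR i (f - hcomp gR n f) = hcomp gR i f - hcomp gR i (hcomp gR n f).
  by apply: (canRL (addrK _)); rewrite -hcompD subrK.
rewrite in_Rgt // -va; apply: deglex_lt_first.
rewrite (veronese_valuation_first gn') (veronese_valuation_first fn) ltz_nat ltnNge.
apply/negP; rewrite leq_eqVlt => /orP[/eqP en|nn].
  by case: gn'; rewrite -en gE (hcomp_id (hcomp_piece _ _ _)) subrr eqxx.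
case: gn'; rewrite gE fn.2 // (hcompE _ (hcomp_piece gR n f)).
by rewrite gtn_eqF // subrr eqxx.
Qed.

Lemma veronese_rank : valuation_has_rank v m.+1.
Proof.
split=> [|n x _ xi]; last exact: deglex_rank_le xi.
(* Selects y_0 and y_2, ..., y_d; y_1 has the same value as y_0. *)
pose e (i : 'I_m.+1) : 'I_m.+2 := if unlift ord0 i is Some j then high j else ord0.
exists (fun i => wt 0 U_(e i) *+ M); split=> [i H _ hH|c].
  apply: hH; exists (mev y 'X_(e i)); [exact: mon_neq0 | exact: v_monomial].
have coordE t i : deglex_coord t (wt 0 U_(e i) *+ M) =
    ((if unlift ord0 t is Some j then (e i == high j : nat) else 1) * M)%N%:Z.
  rewrite deglex_coordMn /deglex_coord -mulr_natr natz PoszM; congr (_ * _).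
  case: unliftP => [j _|_]; first by rewrite mxE mnm1E.
  by rewrite /= mdeg1 muln0.
move=> h; have hs t := congr1 (deglex_coord t) h.
have c1 j : c (lift ord0 j) = 0.
  have := hs (lift ord0 j); rewrite deglex_coord_sum deglex_coord0 (bigD1 (lift ord0 j)) //=.
  rewrite coordE liftK {1}/e liftK eqxx big1 ?addr0 => [/eqP|i ij].
    by rewrite mul1n mulf_eq0 eqz_nat eqn0Ngt M0 => /eqP.
  rewrite coordE liftK /e; case: unliftP ij => [j' -> ij|_ _].
    rewrite (inj_eq (@lift_inj _ _)) in ij.
    by rewrite /high !(inj_eq (@lift_inj _ _)) (negPf ij) mul0n mul0r.
  by rewrite /high (negPf (neq_lift _ _)) mul0n mul0r.
move=> i; case: (unliftP ord0 i) => [j ->|->]; first exact: c1.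
have := hs ord0; rewrite deglex_coord_sum deglex_coord0 big_ord_recl big1 => [|j _].
  rewrite addr0 coordE unlift_none mul1n => /eqP.
  by rewrite mulf_eq0 eqz_nat eqn0Ngt M0 => /eqP.
by rewrite c1 mulr0.
Qed.

End GradedFinite.

Local Open Scope classical_set_scope.

Theorem theorem2 (k : closedFieldType) (hchar : [pchar k] =i pred0)
    (d : nat) (hd : (1 <= d)%N)
    (R : comAlgType k) (hdom : GRing.integral_domain_axiom R)
    (hfg : finitely_generated_algebra R)
    (gR : grading R)
    (hR0 : forall f : R, f \in hpiece gR 0%N <-> exists c : k, f = c%:A)
    (hdim : krull_dimension_is R d.+1) :
  exists v : valuation R (deglex d.-1),
    [/\ homogeneous_valuation gR v,
        valuation_has_rank v d,
        forall f n, has_degree gR f n -> (v f).1 = n%:Z,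
        finitely_generated_algebra (assoc_gr v) &
        exists B : set R, finite_set B /\ khovanskii_basis v B].
Proof.
have h1 : 1 \in hpiece gR 0%N by apply/hR0; exists 1; rewrite scale1r.
have [N [M [y [M0 hy fy iy]]]] := noether_normalization hfg hR0.
have eN := normalization_dimension hdom fy iy hdim.
(* With d = m + 1 the normalization has m + 2 variables, as [dwt] requires. *)
case: d hd eN hdim => // m _ eN _; subst N.
have [z [E [theta [l [delta [P [hz [tE [d0 dl]] [Pm Pmin] Pgen Pirr]]]]]]] :=
  good_coordinates hchar hdom h1 M0 hy fy iy.
pose v : valuation R (deglex m) := veronese_valuation hdom h1 M0 hz tE d0 dl Pm Pmin Pgen Pirr.
have [B hB] : exists B : seq R, khovanskii_basis v [set` B].
  exact: veronese_khovanskii.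
exists v; split.
- exact: veronese_valuation_homogeneous.
- exact: veronese_rank.
- exact: veronese_valuation_first.
- exists (gr_image v @` [set` B]); split; last exact: hB.
  exact/finite_image/finite_seq.
by exists [set` B]; split; first exact: finite_seq.
Qed.
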